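(* Assume that there are constants $A,B,\ell>0$ and a function $h$ such that $\mathcal{K}(r)=A+Br^{\ell}+h(r)$ and $\lim_{r\to 0}\frac{|h(r)|+r|h'(r)|}{r^{\ell}}=0$. Assume also that $\mathcal{K}(r)$ is increasing (i.e. nondecreasing) for $r\ge 0$, strictly in some interval. Let $\ell_p^*=\frac{n-p}{p-1}$. For $\mathcal{R}>0$ consider the problem $$\Delta_p u(x)+\mathcal{K}(|x|)\,u(x)|u(x)|^{q-2}=0,\quad u(x)>0 \text{ for } |x|<\mathcal{R},\quad u(x)=0 \text{ for } |x|=\mathcal{R}.\qquad (P_{\mathcal{R}})$$ (i) If $\ell=\ell_p^*$, then there exists $\mathcal{R}_0>0$ such that $(P_{\mathcal{R}})$ does not admit any radial solution when $\mathcal{R}<\mathcal{R}_0$, and admits at least one radial solution when $\mathcal{R}>\mathcal{R}_0$. (ii) If $\ell>\ell_p^*$, then there exists $\mathcal{R}_0>0$ such that $(P_{\mathcal{R}})$ does not admit any radial solution when $\mathcal{R}<\mathcal{R}_0$, admits at least one radial solution when $\mathcal{R}=\mathcal{R}_0$, and admits at least two radial solutions when $\mathcal{R}>\mathcal{R}_0$.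
   Context: Standing assumptions: $n$ is a positive integer (the space dimension, $x\in\mathbb{R}^n$), $p$ is real with $1<p<n$ and $\frac{2n}{n+2}\le p\le 2$, $q=\frac{np}{n-p}$, and $\mathcal{K}:[0,+\infty)\to(0,+\infty)$ is $C^1$. $\Delta_p u=\operatorname{div}(\nabla u|\nabla u|^{p-2})$. Radial solutions $u=u(r)$, $r=|x|$, solve $(r^{n-1}u'|u'|^{p-2})'+r^{n-1}\mathcal{K}(r)u|u|^{q-2}=0$. For each $d>0$ there is a unique (regular) solution $u(r;d)$ of this ODE with $\lim_{r\to0}u(r;d)=d$; it satisfies $u'(0;d)=0$. A radial solution of $(P_{\mathcal{R}})$ is a regular solution $u(\cdot;d)$, $d>0$, with $u(r;d)>0$ for $0\le r<\mathcal{R}$ and $u(\mathcal{R};d)=0$. *)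

(* Defs.v *)
From Stdlib Require Import Reals Lra Lia.
From Coquelicot Require Import Coquelicot.
Open Scope R_scope.

(* Real power on [0, +oo).  [Rpower 0 a] is 1, so 0 is treated separately,
   with the value 0 needed for r ^ l (l > 0) at r = 0 and, in [sgnpow], for
   s |s|^(m - 2) (m > 1) at s = 0. *)
Definition rpow (x a : R) : R :=
  if Rlt_dec 0 x then Rpower x a else 0.

(* s |s|^(m - 2) *)
Definition sgnpow (m s : R) : R := s * rpow (Rabs s) (m - 2).

(* q = n p / (n - p) *)
Definition crit_exp (n : nat) (p : R) : R := INR n * p / (INR n - p).

(* l*_p = (n - p) / (p - 1) *)
Definition crit_ell (n : nat) (p : R) : R := (INR n - p) / (p - 1).

(* C^1 on the closed half-line [0, +oo), with one-sided notions at 0; values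
   of f on the negative reals are irrelevant. *)
Definition C1_halfline (f : R -> R) : Prop :=
  exists f' : R -> R,
    forall r, 0 <= r ->
      filterlim (fun s => (f s - f r) / (s - r))
        (within (fun s => 0 <= s) (locally' r)) (locally (f' r)) /\
      filterlim f' (within (fun s => 0 <= s) (locally r)) (locally (f' r)).

(* r^(n-1) u'(r) |u'(r)|^(p-2) *)
Definition flux (n : nat) (p : R) (u : R -> R) (r : R) : R :=
  r ^ (n - 1) * sgnpow p (Derive u r).

(* u = u(.; d) on [0, +oo): the ODE holds classically for r > 0 and u extends
   continuously to r = 0 with value d.  That u'(0) = 0 is a consequence.
   Values of u on the negative reals are irrelevant. *)
Definition regular_solution
    (n : nat) (p : R) (K : R -> R) (d : R) (u : R -> R) : Prop :=
  u 0 = d /\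
  filterlim u (at_right 0) (locally d) /\
  forall r, 0 < r ->
    ex_derive u r /\
    ex_derive (flux n p u) r /\
    Derive (flux n p u) r
      + r ^ (n - 1) * K r * sgnpow (crit_exp n p) (u r) = 0.

Definition radial_solution
    (n : nat) (p : R) (K : R -> R) (Rad : R) (u : R -> R) : Prop :=
  exists d, 0 < d /\ regular_solution n p K d u /\
    (forall r, 0 <= r < Rad -> 0 < u r) /\ u Rad = 0.

Definition admits_radial_solution
    (n : nat) (p : R) (K : R -> R) (Rad : R) : Prop :=
  exists u, radial_solution n p K Rad u.

(* The two solutions must differ on the ball, i.e. somewhere on [0, Rad]. *)
Definition admits_two_radial_solutions
    (n : nat) (p : R) (K : R -> R) (Rad : R) : Prop :=
  exists u1 u2,
    radial_solution n p K Rad u1 /\ radial_solution n p K Rad u2 /\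
    exists r, 0 <= r <= Rad /\ u1 r <> u2 r.

(* Main.v *)
Require Import Defs.
From Stdlib Require Import Reals Lra Lia ClassicalEpsilon.
From Coquelicot Require Import Coquelicot.
Open Scope R_scope.

(* Write s = (n-p)/(p-1), and let R(d) be the first zero of u(.; d); then
   (P_R) is solvable iff R is a value of R(d).  With w = - r^(n-1) u' |u'|^(p-2),
   the Pohozaev function P, whose value at a zero R is
   (p-1)/p R^(-s) w(R)^(p/(p-1)), satisfies P' = r^n K' u^q / q >= 0.  The
   inequality P >= 0 says that a quantity which is constant along the bubbles of
   a constant weight is nondecreasing, and this gives
   u <= C d^(-1/(p-1)) r^(-s) before the first zero.
   - As K is not constant, P is eventually bounded below by a positive constant,
     which is incompatible with u > 0 on (0, +oo): hence R(d) is finite, and it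
     depends continuously on d.
   - R(d) -> +oo as d -> 0 because q > p.
   - Let eps = d^(-p/(n-p)).  At scale eps, w is already at least c / d, so
     P(R) >= c (eps / R)^s; if K' <= C r^(lam-1) with s <= lam < n/(p-1),
     the bubble bound gives P(R) <= C eps^lam.  Hence R(d)^s >= c eps^(s-lam):
     R(d) is bounded below if l = s, and R(d) -> +oo as d -> +oo if l > s.
   The theorem follows from the intermediate value theorem applied to
   t |-> R(e^t), with R_0 the infimum (attained if l > s) of R(d). *)

(** * Limits at 0+, the mean value theorem and real powers *)

(** The two bounds on [p] make the problem Lipschitz: [2n/(n+2) <= p] amounts to [q >= 2] and
    [p <= 2] to [p/(p-1) >= 2], so both powers in the first-order system for [(u, w)] are locally
    Lipschitz even where their arguments vanish. Uniqueness, existence and dependence on [d] then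
    all follow from one contraction estimate. A regular solution is only known to have a limit at 0;
    that its flux tends to 0 has to be derived before this system is available. The exponent
    [n/(p-1)] comes from the tail of the bubble: if [u <= C r^(-s)], then [r^n r^(lam-1) u^q] is of
    order [r^(lam-1-n/(p-1))], integrable at infinity exactly when [lam < n/(p-1)]. For larger [l] a
    smaller [lam] serves, since only [lam > s] matters. The bound on [K'] is required on a bounded
    interval [(0, M]] only, because a lower bound for [R(d)] has to be proved only when [R(d) <= M].
    Most quantitative estimates are stated through logarithms, which turns products of real powers
    into linear identities between exponents. *)

Definition lim0 (f : R -> R) (l : R) : Prop := filterlim f (at_right 0) (locally l).

Lemma at_right0_eps (P : R -> Prop) :
  at_right 0 P <-> exists del, 0 < del /\ forall x, 0 < x < del -> P x.
Proof.
  split.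
  - intros [e He]. exists e. split; [apply cond_pos|].
    intros x Hx. apply He; [|lra].
    change (Rabs (x - 0) < e). rewrite Rminus_0_r, Rabs_pos_eq; lra.
  - intros [d [Hd H]]. exists (mkposreal d Hd). intros x Hx H0. apply H.
    change (Rabs (x - 0) < d) in Hx. rewrite Rminus_0_r, Rabs_pos_eq in Hx; lra.
Qed.

Lemma lim0_eps (f : R -> R) (l : R) :
  lim0 f l <-> forall eps, 0 < eps ->
    exists del, 0 < del /\ forall x, 0 < x < del -> Rabs (f x - l) < eps.
Proof.
  unfold lim0. rewrite filterlim_locally. split.
  - intros H e He. specialize (H (mkposreal e He)).
    apply at_right0_eps in H. exact H.
  - intros H e. apply at_right0_eps. apply (H e). apply cond_pos.
Qed.

Lemma lim0_ext (f g : R -> R) (l : R) :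
  (forall x, 0 < x -> f x = g x) -> lim0 f l -> lim0 g l.
Proof.
  intros H Hf. apply lim0_eps. intros e He.
  destruct (proj1 (lim0_eps f l) Hf e He) as [d [Hd Hx]].
  exists d. split; [lra|]. intros x Hx'. rewrite <- H by lra. auto.
Qed.

Lemma lim0_continuous (f : R -> R) : continuous f 0 -> lim0 f (f 0).
Proof.
  intros H. unfold lim0. eapply filterlim_filter_le_1; [|apply H].
  unfold at_right. apply filter_le_within.
Qed.

Lemma lim0_const (c : R) : lim0 (fun _ => c) c.
Proof. apply filterlim_const. Qed.

Lemma lim0_id : lim0 (fun x => x) 0.
Proof. apply (lim0_continuous (fun x => x)). apply continuous_id. Qed.

Lemma lim0_comp (f g : R -> R) (l : R) :
  lim0 f l -> continuous g l -> lim0 (fun x => g (f x)) (g l).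
Proof. intros Hf Hg. eapply filterlim_comp; [apply Hf|apply Hg]. Qed.

Lemma lim0_plus (f g : R -> R) (a b : R) :
  lim0 f a -> lim0 g b -> lim0 (fun x => f x + g x) (a + b).
Proof.
  intros Hf Hg. unfold lim0 in *.
  eapply filterlim_comp_2; [exact Hf|exact Hg|apply (filterlim_plus a b)].
Qed.

Lemma lim0_mult (f g : R -> R) (a b : R) :
  lim0 f a -> lim0 g b -> lim0 (fun x => f x * g x) (a * b).
Proof.
  intros Hf Hg. unfold lim0 in *.
  eapply filterlim_comp_2; [exact Hf|exact Hg|apply (filterlim_mult a b)].
Qed.

Lemma lim0_opp (f : R -> R) (a : R) : lim0 f a -> lim0 (fun x => - f x) (- a).
Proof. intros Hf. apply (lim0_comp f Ropp); [exact Hf|]. apply (continuous_opp (fun x : R => x) a), continuous_id. Qed.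

Lemma lim0_minus (f g : R -> R) (a b : R) :
  lim0 f a -> lim0 g b -> lim0 (fun x => f x - g x) (a - b).
Proof. intros Hf Hg. apply lim0_plus; [exact Hf|]. apply lim0_opp, Hg. Qed.

Lemma lim0_le (f g : R -> R) (a b del : R) :
  0 < del -> (forall x, 0 < x < del -> f x <= g x) -> lim0 f a -> lim0 g b -> a <= b.
Proof.
  intros Hd H Hf Hg. destruct (Rle_or_lt a b) as [|Hab]; [assumption|exfalso].
  destruct (proj1 (lim0_eps _ _) Hf ((a - b) / 2)) as [d1 [Hd1 H1]]; [lra|].
  destruct (proj1 (lim0_eps _ _) Hg ((a - b) / 2)) as [d2 [Hd2 H2]]; [lra|].
  set (x := Rmin del (Rmin d1 d2) / 2).
  assert (Hx : 0 < x < del /\ x < d1 /\ x < d2).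
  { unfold x. pose proof (Rmin_l del (Rmin d1 d2)). pose proof (Rmin_r del (Rmin d1 d2)).
    pose proof (Rmin_l d1 d2). pose proof (Rmin_r d1 d2).
    assert (0 < Rmin del (Rmin d1 d2)) by (repeat apply Rmin_pos; lra). lra. }
  destruct Hx as [Hx [Hx1 Hx2]].
  specialize (H x Hx). specialize (H1 x ltac:(lra)). specialize (H2 x ltac:(lra)).
  apply Rabs_def2 in H1. apply Rabs_def2 in H2. lra.
Qed.

Lemma lim0_squeeze (f g : R -> R) (del : R) :
  0 < del -> (forall x, 0 < x < del -> Rabs (f x) <= g x) -> lim0 g 0 -> lim0 f 0.
Proof.
  intros Hd H Hg. apply lim0_eps. intros e He.
  destruct (proj1 (lim0_eps _ _) Hg e He) as [d1 [Hd1 H1]].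
  exists (Rmin del d1). split; [apply Rmin_pos; lra|].
  intros x [Hx0 Hx]. pose proof (Rmin_l del d1). pose proof (Rmin_r del d1).
  specialize (H x ltac:(lra)). specialize (H1 x ltac:(lra)). apply Rabs_def2 in H1.
  rewrite Rminus_0_r in *. lra.
Qed.

Lemma is_derive_continuity (f : R -> R) (x l : R) : is_derive f x l -> continuity_pt f x.
Proof.
  intros H. apply continuity_pt_filterlim.
  apply (ex_derive_continuous f x). exists l; exact H.
Qed.

Lemma is_derive_linear (c x : R) : is_derive (fun t => c * t) x c.
Proof. auto_derive; [exact I|ring]. Qed.

Lemma mvt (f df : R -> R) (a b : R) :
  a <= b -> (forall x, a <= x <= b -> is_derive f x (df x)) ->
  exists c, a <= c <= b /\ f b - f a = df c * (b - a).
Proof.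
  intros Hab H. destruct (MVT_gen f a b df) as [c [Hc E]].
  - rewrite Rmin_left, Rmax_right by lra. intros x Hx. apply H; lra.
  - rewrite Rmin_left, Rmax_right by lra. intros x Hx.
    eapply is_derive_continuity, H; lra.
  - exists c. rewrite Rmin_left, Rmax_right in Hc by lra. auto.
Qed.

Lemma deriv_nonneg_le (f df : R -> R) (a b : R) :
  a <= b -> (forall x, a <= x <= b -> is_derive f x (df x)) ->
  (forall x, a <= x <= b -> 0 <= df x) -> f a <= f b.
Proof.
  intros Hab H H0. destruct (mvt f df a b Hab H) as [c [Hc E]].
  specialize (H0 c Hc). nra.
Qed.

Lemma deriv_pos_lt (f df : R -> R) (a b : R) :
  a < b -> (forall x, a <= x <= b -> is_derive f x (df x)) ->
  (forall x, a <= x <= b -> 0 < df x) -> f a < f b.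
Proof.
  intros Hab H H0. destruct (mvt f df a b ltac:(lra) H) as [c [Hc E]].
  specialize (H0 c Hc). nra.
Qed.

(** Meant for functions whose value at 0 carries no information, such as quotients by [r ^ (n - 1)]:
    the limit at 0+ replaces the left endpoint. *)
Lemma deriv_nonneg_le0 (f df : R -> R) (l b : R) :
  0 < b -> lim0 f l -> (forall x, 0 < x <= b -> is_derive f x (df x)) ->
  (forall x, 0 < x <= b -> 0 <= df x) -> l <= f b.
Proof.
  intros Hb Hl H H0. apply (lim0_le f (fun _ => f b) l (f b) b Hb); auto.
  - intros x Hx. apply (deriv_nonneg_le f df x b); [lra| |]; intros y Hy;
      [apply H|apply H0]; lra.
  - apply lim0_const.
Qed.

(** Replaces the bound of an integral by the integral of the absolute value: [G - f] and [G + f] are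
    both nondecreasing. *)
Lemma deriv_bound (f df G dG : R -> R) (a b : R) :
  a <= b ->
  (forall x, a <= x <= b -> is_derive f x (df x)) ->
  (forall x, a <= x <= b -> is_derive G x (dG x)) ->
  (forall x, a <= x <= b -> Rabs (df x) <= dG x) -> Rabs (f b - f a) <= G b - G a.
Proof.
  intros Hb Df DG H.
  assert (G a - f a <= G b - f b).
  { apply (deriv_nonneg_le (fun x => G x - f x) (fun x => dG x - df x) a b Hb).
    - intros x Hx. apply (is_derive_minus G f); auto.
    - intros x Hx. specialize (H x Hx). apply Rabs_le_between in H. lra. }
  assert (G a + f a <= G b + f b).
  { apply (deriv_nonneg_le (fun x => G x + f x) (fun x => dG x + df x) a b Hb).
    - intros x Hx. apply (is_derive_plus G f); auto.
    - intros x Hx. specialize (H x Hx). apply Rabs_le_between in H. lra. }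
  apply Rabs_le. lra.
Qed.

Lemma deriv_bound0 (f df G dG : R -> R) (lf lG b : R) :
  0 < b -> lim0 f lf -> lim0 G lG ->
  (forall x, 0 < x <= b -> is_derive f x (df x)) ->
  (forall x, 0 < x <= b -> is_derive G x (dG x)) ->
  (forall x, 0 < x <= b -> Rabs (df x) <= dG x) -> Rabs (f b - lf) <= G b - lG.
Proof.
  intros Hb Hf HG Df DG H.
  apply (lim0_le (fun x => Rabs (f b - f x)) (fun x => G b - G x) _ _ b Hb).
  - intros x Hx. apply (deriv_bound f df G dG); [lra| | |]; intros y Hy;
      [apply Df|apply DG|apply H]; lra.
  - apply (lim0_comp (fun x => f b - f x) Rabs).
    + apply lim0_minus; [apply lim0_const|exact Hf].
    + apply continuous_Rabs.
  - apply lim0_minus; [apply lim0_const|exact HG].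
Qed.

Lemma deriv_const_bound0 (f df : R -> R) (lf S b : R) :
  0 < b -> lim0 f lf ->
  (forall x, 0 < x <= b -> is_derive f x (df x)) ->
  (forall x, 0 < x <= b -> Rabs (df x) <= S) -> Rabs (f b - lf) <= S * b.
Proof.
  intros Hb Hf Df H.
  replace (S * b) with (S * b - S * 0) by ring.
  apply (deriv_bound0 f df (fun x => S * x) (fun _ => S) lf (S * 0) b); auto.
  - apply lim0_mult; [apply lim0_const|apply lim0_id].
  - intros x Hx. apply is_derive_linear.
Qed.

(** * Real powers and the odd power [sgnpow] *)

Lemma Rpower_pos (x a : R) : 0 < Rpower x a.
Proof. apply exp_pos. Qed.

Lemma is_derive_Rpower (f : R -> R) (x l a : R) :
  is_derive f x l -> 0 < f x ->
  is_derive (fun t => Rpower (f t) a) x (a * (l / f x) * Rpower (f x) a).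
Proof.
  intros Hf Hp. unfold Rpower.
  assert (E : ex_derive f x) by (exists l; exact Hf).
  auto_derive; [split; [exact E|split; [exact Hp|exact I]]|].
  replace (Derive (fun x0 : R => f x0) x) with l by (symmetry; apply is_derive_unique; exact Hf).
  field. lra.
Qed.

Lemma is_derive_Rpower_id (x a : R) :
  0 < x -> is_derive (fun t => Rpower t a) x (a * Rpower x (a - 1)).
Proof. intros H. apply is_derive_Reals, derivable_pt_lim_power, H. Qed.

Lemma Rpower_minus_1 (x a : R) : 0 < x -> Rpower x (a - 1) = Rpower x a / x.
Proof.
  intros H. unfold Rminus. rewrite Rpower_plus, Rpower_Ropp, Rpower_1 by exact H. reflexivity.
Qed.

Lemma lim0_Rpower (a : R) : 0 < a -> lim0 (fun x => Rpower x a) 0.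
Proof.
  intros Ha. apply lim0_eps. intros e He. exists (Rpower e (/ a)).
  split; [apply Rpower_pos|]. intros x Hx.
  rewrite Rminus_0_r, Rabs_pos_eq by apply Rlt_le, Rpower_pos.
  replace e with (Rpower (Rpower e (/ a)) a) at 1.
  - apply Rlt_Rpower_l; lra.
  - rewrite Rpower_mult, Rinv_l, Rpower_1; lra.
Qed.

Lemma rpow_pos (x a : R) : 0 < x -> rpow x a = Rpower x a.
Proof. intros H. unfold rpow. destruct (Rlt_dec 0 x); [reflexivity|lra]. Qed.

Lemma rpow_0 (a : R) : rpow 0 a = 0.
Proof. unfold rpow. destruct (Rlt_dec 0 0); [lra|reflexivity]. Qed.

Lemma rpow_nonneg (x a : R) : 0 <= rpow x a.
Proof. unfold rpow. destruct (Rlt_dec 0 x); [apply Rlt_le, Rpower_pos|lra]. Qed.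

Lemma sgnpow_0 (m : R) : sgnpow m 0 = 0.
Proof. unfold sgnpow. ring. Qed.

Lemma sgnpow_opp (m s : R) : sgnpow m (- s) = - sgnpow m s.
Proof. unfold sgnpow. rewrite Rabs_Ropp. ring. Qed.

Lemma sgnpow_pos (m s : R) : 0 < s -> sgnpow m s = Rpower s (m - 1).
Proof.
  intros H. unfold sgnpow. rewrite Rabs_pos_eq, rpow_pos by lra.
  replace (m - 1) with (1 + (m - 2)) by ring. rewrite Rpower_plus, Rpower_1 by lra. ring.
Qed.

Lemma sgnpow_mult_nonneg (m s : R) : 0 <= s * sgnpow m s.
Proof.
  unfold sgnpow. rewrite <- Rmult_assoc. apply Rmult_le_pos; [nra|apply rpow_nonneg].
Qed.

Lemma sgnpow_mult_self (m s : R) : s * sgnpow m s = rpow (Rabs s) m.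
Proof.
  destruct (Req_dec s 0) as [->|H].
  - rewrite Rabs_R0, rpow_0. ring.
  - assert (0 < Rabs s) by (apply Rabs_pos_lt, H).
    unfold sgnpow. rewrite !rpow_pos by assumption.
    replace m with (1 + 1 + (m - 2)) at 2 by ring.
    rewrite !Rpower_plus, Rpower_1 by assumption.
    rewrite <- Rmult_assoc. f_equal. unfold Rabs; destruct (Rcase_abs s); ring.
Qed.

(** Conjugate exponents satisfy [(p - 1) * (p / (p - 1) - 1) = 1], so the two odd powers are
    mutually inverse; this translates between [u'] and the flux. *)
Lemma sgnpow_inv (p s : R) : 1 < p -> sgnpow p (sgnpow (p / (p - 1)) s) = s.
Proof.
  intros Hp.
  assert (Hpos : forall s, 0 < s -> sgnpow p (sgnpow (p / (p - 1)) s) = s).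
  { intros t Ht. rewrite (sgnpow_pos _ t Ht), sgnpow_pos by apply Rpower_pos.
    rewrite Rpower_mult. replace ((p / (p - 1) - 1) * (p - 1)) with 1 by (field; lra).
    apply Rpower_1, Ht. }
  destruct (Rtotal_order s 0) as [H|[->|H]].
  - rewrite <- (Ropp_involutive s) at 1. rewrite sgnpow_opp, sgnpow_opp, (Hpos (- s)) by lra. ring.
  - rewrite !sgnpow_0. reflexivity.
  - apply Hpos, H.
Qed.

Lemma sgnpow_inv' (p s : R) : 1 < p -> sgnpow (p / (p - 1)) (sgnpow p s) = s.
Proof.
  intros Hp.
  assert (Hq : 1 < p / (p - 1)) by (apply -> (Rlt_div_r 1 p (p - 1)); lra).
  rewrite <- (sgnpow_inv (p / (p - 1)) s Hq) at 2.
  replace (p / (p - 1) / (p / (p - 1) - 1)) with p by (field; lra). reflexivity.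
Qed.

Lemma Rpower_lipschitz (a M s t : R) :
  1 <= a -> 0 < s <= M -> 0 < t <= M ->
  Rabs (Rpower s a - Rpower t a) <= a * Rpower M (a - 1) * Rabs (s - t).
Proof.
  intros Ha.
  assert (Hw : forall s t, 0 < s <= M -> s <= t <= M ->
    Rabs (Rpower t a - Rpower s a) <= a * Rpower M (a - 1) * t - a * Rpower M (a - 1) * s).
  { intros s' t' Hs Ht.
    apply (deriv_bound (fun x => Rpower x a) (fun x => a * Rpower x (a - 1))
      (fun x => a * Rpower M (a - 1) * x) (fun _ => a * Rpower M (a - 1))); [lra| | |].
    - intros x Hx. apply is_derive_Rpower_id; lra.
    - intros x Hx. apply is_derive_linear.
    - intros x Hx. pose proof (Rpower_pos x (a - 1)).
      rewrite Rabs_pos_eq by (apply Rmult_le_pos; lra).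
      apply Rmult_le_compat_l; [lra|]. apply Rle_Rpower_l; lra. }
  intros Hs Ht. destruct (Rle_or_lt s t) as [H|H].
  - rewrite Rabs_minus_sym, (Rabs_minus_sym s t), (Rabs_pos_eq (t - s)) by lra.
    specialize (Hw s t Hs). lra.
  - rewrite (Rabs_pos_eq (s - t)) by lra. specialize (Hw t s). lra.
Qed.

Lemma sgnpow_abs_le (m M s : R) : 2 <= m -> 0 < M -> Rabs s <= M ->
  Rabs (sgnpow m s) <= Rpower M (m - 2) * Rabs s.
Proof.
  intros Hm HM Hs. unfold sgnpow. rewrite Rabs_mult, Rmult_comm.
  apply Rmult_le_compat_r; [apply Rabs_pos|].
  rewrite (Rabs_pos_eq _ (rpow_nonneg _ _)).
  unfold rpow. destruct (Rlt_dec 0 (Rabs s)); [|apply Rlt_le, Rpower_pos].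
  apply Rle_Rpower_l; lra.
Qed.

Lemma sgnpow_lipschitz (m M s t : R) :
  2 <= m -> 0 < M -> Rabs s <= M -> Rabs t <= M ->
  Rabs (sgnpow m s - sgnpow m t) <= (m - 1) * Rpower M (m - 2) * Rabs (s - t).
Proof.
  intros Hm HM.
  assert (HL : 0 < Rpower M (m - 2)) by apply Rpower_pos.
  assert (Hpp : forall s t, 0 < s -> 0 < t -> Rabs s <= M -> Rabs t <= M ->
    Rabs (sgnpow m s - sgnpow m t) <= (m - 1) * Rpower M (m - 2) * Rabs (s - t)).
  { intros s' t' Hs Ht. rewrite !Rabs_pos_eq by lra. intros H1 H2.
    rewrite !sgnpow_pos by assumption.
    replace (m - 2) with (m - 1 - 1) by ring. apply Rpower_lipschitz; lra. }
  (* For opposite signs [|s| + |t| = |s - t|], so it is enough to bound each value against 0, and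
     [1 <= m - 1]. *)
  assert (Hpn : forall s t, 0 <= s -> t <= 0 -> Rabs s <= M -> Rabs t <= M ->
    Rabs (sgnpow m s - sgnpow m t) <= (m - 1) * Rpower M (m - 2) * Rabs (s - t)).
  { intros s' t' Hs Ht H1 H2.
    pose proof (sgnpow_abs_le m M s' Hm HM H1) as E1.
    pose proof (sgnpow_abs_le m M t' Hm HM H2) as E2.
    replace (sgnpow m s' - sgnpow m t') with (sgnpow m s' + - sgnpow m t') by ring.
    eapply Rle_trans; [apply Rabs_triang|]. rewrite Rabs_Ropp.
    rewrite (Rabs_pos_eq s') in E1 by lra. rewrite (Rabs_left1 t') in E2 by lra.
    rewrite (Rabs_pos_eq (s' - t')) by lra.
    apply Rle_trans with (1 * Rpower M (m - 2) * (s' - t')); [lra|].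
    apply Rmult_le_compat_r; [lra|]. apply Rmult_le_compat_r; lra. }
  intros Hs Ht.
  destruct (Rle_or_lt s 0) as [H1|H1]; destruct (Rle_or_lt t 0) as [H2|H2].
  - destruct (Req_dec s 0) as [->|H1'].
    + apply Hpn; lra || assumption.
    + destruct (Req_dec t 0) as [->|H2'].
      * rewrite Rabs_minus_sym, (Rabs_minus_sym s). apply Hpn; lra || assumption.
      * specialize (Hpp (- s) (- t)). rewrite !sgnpow_opp, !Rabs_Ropp in Hpp.
        replace (- sgnpow m s - - sgnpow m t) with (- (sgnpow m s - sgnpow m t)) in Hpp by ring.
        replace (- s - - t) with (- (s - t)) in Hpp by ring.
        rewrite !Rabs_Ropp in Hpp. apply Hpp; lra || assumption.
  - rewrite Rabs_minus_sym, (Rabs_minus_sym s). apply Hpn; lra || assumption.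
  - apply Hpn; lra || assumption.
  - apply Hpp; assumption.
Qed.

Lemma continuous_eps (f : R -> R) (x : R) :
  (forall eps, 0 < eps -> exists del, 0 < del /\
     forall y, Rabs (y - x) < del -> Rabs (f y - f x) < eps) -> continuous f x.
Proof.
  intros H. apply filterlim_locally. intros e.
  destruct (H e (cond_pos e)) as [d [Hd Hx]].
  exists (mkposreal d Hd). intros y Hy. apply Hx, Hy.
Qed.

Lemma continuous_eps_inv (f : R -> R) (x : R) :
  continuous f x -> forall eps, 0 < eps -> exists del, 0 < del /\
     forall y, Rabs (y - x) < del -> Rabs (f y - f x) < eps.
Proof.
  intros H e He. destruct (proj1 (filterlim_locally f (f x)) H (mkposreal e He)) as [d Hd].
  exists d. split; [apply cond_pos|]. intros y Hy. apply Hd, Hy.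
Qed.

Lemma sgnpow_continuous (m x : R) : 2 <= m -> continuous (sgnpow m) x.
Proof.
  intros Hm. apply continuous_eps. intros e He.
  set (L := (m - 1) * Rpower (Rabs x + 1) (m - 2)).
  pose proof (Rabs_pos x) as Hx0. pose proof (Rpower_pos (Rabs x + 1) (m - 2)) as Hr.
  assert (HL : 0 < L) by (apply Rmult_lt_0_compat; lra).
  exists (Rmin 1 (e / L)). split; [apply Rmin_pos; [lra|apply Rdiv_lt_0_compat; lra]|].
  intros y Hy. pose proof (Rmin_l 1 (e / L)). pose proof (Rmin_r 1 (e / L)).
  eapply Rle_lt_trans; [apply (sgnpow_lipschitz m (Rabs x + 1)); try lra|].
  - replace y with (x + (y - x)) by ring. eapply Rle_trans; [apply Rabs_triang|]. lra.
  - fold L. replace e with (L * (e / L)) by (field; lra). apply Rmult_lt_compat_l; lra.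
Qed.

Lemma is_derive_rpow_abs (m s : R) :
  1 < m -> is_derive (fun t => rpow (Rabs t) m) s (m * sgnpow m s).
Proof.
  intros Hm.
  assert (Hpos : forall s, 0 < s -> is_derive (fun t => rpow (Rabs t) m) s (m * sgnpow m s)).
  { intros t Ht. rewrite sgnpow_pos by exact Ht.
    apply (is_derive_ext_loc (fun x => Rpower x m)); [|apply is_derive_Rpower_id, Ht].
    exists (mkposreal t Ht). intros y Hy. change (Rabs (y - t) < t) in Hy.
    apply Rabs_def2 in Hy. rewrite Rabs_pos_eq, rpow_pos; lra. }
  destruct (Rtotal_order s 0) as [H|[->|H]].
  - apply (is_derive_ext (fun t => rpow (Rabs (- t)) m)).
    { intros t. rewrite Rabs_Ropp. reflexivity. }
    replace (m * sgnpow m s) with (scal (-1) (m * sgnpow m (- s))).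
    2:{ rewrite sgnpow_opp. unfold scal; simpl; unfold mult; simpl. ring. }
    apply (is_derive_comp (fun t => rpow (Rabs t) m) Ropp s).
    + apply Hpos; lra.
    + apply (is_derive_opp (fun x => x) s 1), (is_derive_id s).
  (* At 0 the difference quotient has absolute value [|k|^(m-1)], which is below [e] once
     [|k| < e^(1/(m-1))]. *)
  - rewrite sgnpow_0, Rmult_0_r. apply is_derive_Reals. intros e He.
    assert (Hd : 0 < Rpower e (/ (m - 1))) by apply Rpower_pos.
    exists (mkposreal _ Hd). intros k Hk Hk'. simpl in Hk'.
    rewrite Rplus_0_l, Rabs_R0, rpow_0, !Rminus_0_r.
    assert (H0 : 0 < Rabs k) by (apply Rabs_pos_lt, Hk).
    unfold Rdiv. rewrite Rabs_mult, Rabs_inv, (Rabs_pos_eq _ (rpow_nonneg _ _)).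
    rewrite rpow_pos by exact H0. change (Rpower (Rabs k) m / Rabs k < e).
    rewrite <- Rpower_minus_1 by exact H0.
    replace e with (Rpower (Rpower e (/ (m - 1))) (m - 1)).
    + apply Rlt_Rpower_l; lra.
    + rewrite Rpower_mult, Rinv_l, Rpower_1; lra.
  - apply Hpos, H.
Qed.

(** * The first-order system and its Volterra contraction *)

(* [w] is minus the flux of [u]. *)
Definition sysol (n : nat) (p : R) (g : R -> R) (d : R) (u w : R -> R) : Prop :=
  u 0 = d /\ lim0 u d /\ lim0 w 0 /\
  forall r, 0 < r ->
    is_derive u r (- sgnpow (p / (p - 1)) (w r / r ^ (n - 1))) /\
    is_derive w r (r ^ (n - 1) * g r).

Lemma sgnpow_abs (m s : R) : s <> 0 -> Rabs (sgnpow m s) = Rpower (Rabs s) (m - 1).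
Proof.
  intros H. destruct (Rlt_or_le 0 s) as [H0|H0].
  - rewrite (sgnpow_pos m s H0), (Rabs_pos_eq s), Rabs_pos_eq; [reflexivity|apply Rlt_le, Rpower_pos|lra].
  - rewrite <- (Rabs_Ropp s), <- (Ropp_involutive s) at 1.
    rewrite sgnpow_opp, Rabs_Ropp, sgnpow_pos by lra.
    rewrite (Rabs_pos_eq (- s)), Rabs_pos_eq; [reflexivity|apply Rlt_le, Rpower_pos|lra].
Qed.

Lemma pow_le_pow_of_le_1 (x : R) (a b : nat) : 0 <= x <= 1 -> (a <= b)%nat -> x ^ b <= x ^ a.
Proof.
  intros Hx H. induction H as [|b H IH]; [lra|]. simpl.
  assert (0 <= x ^ b) by (apply pow_le; lra). nra.
Qed.

Lemma lim0_bounded (f : R -> R) (l : R) : lim0 f l ->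
  exists del, 0 < del /\ forall x, 0 < x < del -> Rabs (f x) <= Rabs l + 1.
Proof.
  intros H. destruct (proj1 (lim0_eps f l) H 1 ltac:(lra)) as [d [Hd Hx]].
  exists d. split; [exact Hd|]. intros x Hx0. specialize (Hx x Hx0).
  replace (f x) with (l + (f x - l)) by ring.
  eapply Rle_trans; [apply Rabs_triang|lra].
Qed.

Lemma pow_split_pred (n : nat) (r : R) : (0 < n)%nat -> r ^ n = r * r ^ (n - 1).
Proof. intros H. replace n with (S (n - 1)) at 1 by lia. reflexivity. Qed.

Section System.

Context (n : nat) (p : R).
Context (Hp : 1 < p < INR n).

(** Because of [p < n], [r ^ (- (n - 1) / (p - 1))] dominates [1 / r] for [r < 1]; [nra] finds this
    in the context inside [flux_small]. *)
Let beta_gt : 1 < (INR n - 1) * / (p - 1).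
Proof.
  apply Rmult_lt_reg_r with (p - 1); [lra|]. rewrite Rmult_assoc, Rinv_l by lra. lra.
Qed.

Lemma dim_ge_2 : (2 <= n)%nat.
Proof.
  destruct n as [|[|m]]; [simpl in Hp; lra|simpl in Hp; lra|lia].
Qed.

Lemma INR_dim_pred : INR (n - 1) = INR n - 1.
Proof. rewrite minus_INR; [reflexivity|]. pose proof dim_ge_2. lia. Qed.

(* A nonzero limit of the flux at 0 would make [u'] of order
   [r ^ (- (n - 1) / (p - 1))], which is not integrable. *)
Lemma flux_small (u W : R -> R) (d G del : R) :
  0 < del -> lim0 u d ->
  (forall r, 0 < r -> is_derive u r (sgnpow (p / (p - 1)) (W r / r ^ (n - 1)))) ->
  (forall r, 0 < r < del -> ex_derive W r /\ Rabs (Derive W r) <= G) ->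
  forall r, 0 < r < del -> Rabs (W r) <= G * r.
Proof.
  intros Hdel Hu Du DW r0 Hr0.
  destruct (Rle_or_lt (Rabs (W r0)) (G * r0)) as [|Hlt]; [assumption|exfalso].
  assert (HG : 0 <= G).
  { destruct (DW r0 Hr0) as [_ H]. pose proof (Rabs_pos (Derive W r0)). lra. }
  set (eta := Rabs (W r0) - G * r0).
  assert (Heta : 0 < eta) by (unfold eta; lra).
  assert (HW : forall t, 0 < t <= r0 -> eta <= Rabs (W t)).
  { intros t Ht.
    assert (Rabs (W r0 - W t) <= G * r0 - G * t).
    { apply (deriv_bound W (Derive W) (fun x => G * x) (fun _ => G)); [lra| | |].
      - intros x Hx. apply Derive_correct, DW; lra.
      - intros x _. apply is_derive_linear.
      - intros x Hx. apply DW; lra. }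
    assert (Rabs (W r0) <= Rabs (W t) + Rabs (W r0 - W t)).
    { replace (W r0) with (W t + (W r0 - W t)) at 1 by ring. apply Rabs_triang. }
    unfold eta. nra. }
  (* Calibrated for the dyadic interval [[t, 2 * t]]: there [|u'| >= 4 * e / c >= 2 * e / t], so [u]
     changes by at least [2 * e], while the limit of [u] at 0 allows strictly less. *)
  set (e := Rpower eta (/ (p - 1)) / 4).
  assert (He : 0 < e) by (apply Rdiv_lt_0_compat; [apply Rpower_pos|lra]).
  destruct (proj1 (lim0_eps u d) Hu e He) as [d1 [Hd1 H1]].
  set (t := Rmin (Rmin r0 1) d1 / 4).
  assert (Ht : 0 < t /\ 2 * t < r0 /\ 2 * t < 1 /\ 2 * t < d1).
  { unfold t. pose proof (Rmin_l (Rmin r0 1) d1). pose proof (Rmin_r (Rmin r0 1) d1).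
    pose proof (Rmin_l r0 1). pose proof (Rmin_r r0 1).
    assert (0 < Rmin (Rmin r0 1) d1) by (repeat apply Rmin_pos; lra). lra. }
  destruct (mvt u (fun r => sgnpow (p / (p - 1)) (W r / r ^ (n - 1))) t (2 * t)) as [c [Hc E]];
    [lra|intros x Hx; apply Du; lra|].
  pose proof (H1 t ltac:(lra)) as A1. pose proof (H1 (2 * t) ltac:(lra)) as A2.
  assert (Hsm : Rabs (u (2 * t) - u t) < 2 * e).
  { apply Rabs_def2 in A1. apply Rabs_def2 in A2. apply Rabs_def1; lra. }
  rewrite E, Rabs_mult in Hsm. replace (2 * t - t) with t in Hsm by ring.
  rewrite (Rabs_pos_eq t) in Hsm by lra.
  specialize (HW c ltac:(lra)).
  assert (Hcn : 0 < c ^ (n - 1)) by (apply pow_lt; lra).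
  assert (HWc : W c <> 0) by (intros HH; rewrite HH, Rabs_R0 in HW; lra).
  rewrite sgnpow_abs in Hsm.
  2:{ apply Rmult_integral_contrapositive_currified; [exact HWc|apply Rinv_neq_0_compat; lra]. }
  replace (p / (p - 1) - 1) with (/ (p - 1)) in Hsm by (field; lra).
  assert (Hb : 0 < / (p - 1)) by (apply Rinv_0_lt_compat; lra).
  assert (Hlow : Rpower eta (/ (p - 1)) / c <= Rpower (Rabs (W c / c ^ (n - 1))) (/ (p - 1))).
  { unfold Rdiv at 2. rewrite Rabs_mult, Rabs_inv, (Rabs_pos_eq (c ^ (n - 1))) by lra.
    rewrite <- Rpower_mult_distr; [|lra|apply Rinv_0_lt_compat; lra].
    apply Rmult_le_compat; [apply Rlt_le, Rpower_pos|apply Rlt_le, Rinv_0_lt_compat; lra| |].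
    - apply Rle_Rpower_l; lra.
    - rewrite <- Rpower_pow, <- Rpower_Ropp, Rpower_mult, INR_dim_pred by lra.
      replace (- (INR n - 1) * / (p - 1)) with (- ((INR n - 1) * / (p - 1))) by ring.
      rewrite Rpower_Ropp. apply Rinv_le_contravar; [apply Rpower_pos|].
      replace c with (Rpower c 1) at 2 by (apply Rpower_1; lra).
      unfold Rpower. apply Rlt_le, exp_increasing.
      assert (ln c < 0) by (rewrite <- ln_1; apply ln_increasing; lra). nra. }
  assert (Hq : Rpower eta (/ (p - 1)) / (2 * t) <= Rpower eta (/ (p - 1)) / c).
  { apply Rmult_le_compat_l; [apply Rlt_le, Rpower_pos|]. apply Rinv_le_contravar; lra. }
  assert (Rpower eta (/ (p - 1)) / (2 * t) * t < 2 * e) by nra.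
  assert (Rpower eta (/ (p - 1)) / (2 * t) * t = 2 * e) by (unfold e; field; lra).
  lra.
Qed.

(** The substance is the limit 0 of the flux. Near 0 both [K] and [u] are bounded, hence so is the
    derivative of the flux, and [flux_small] applies. *)
Lemma regular_sysol (K : R -> R) (d : R) (u : R -> R) :
  2 <= crit_exp n p -> lim0 K (K 0) ->
  regular_solution n p K d u ->
  sysol n p (fun r => K r * sgnpow (crit_exp n p) (u r)) d u (fun r => - flux n p u r).
Proof.
  intros Hq HK [H0 [Hl Hr]].
  assert (Du : forall r, 0 < r ->
    is_derive u r (sgnpow (p / (p - 1)) (flux n p u r / r ^ (n - 1)))).
  { intros r Hr0. destruct (Hr r Hr0) as [E _]. unfold flux.
    assert (0 < r ^ (n - 1)) by (apply pow_lt; lra).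
    replace (r ^ (n - 1) * sgnpow p (Derive u r) / r ^ (n - 1)) with (sgnpow p (Derive u r)) by (field; lra).
    rewrite sgnpow_inv' by lra. apply Derive_correct, E. }
  assert (Hb : lim0 (fun r => K r * sgnpow (crit_exp n p) (u r)) (K 0 * sgnpow (crit_exp n p) d)).
  { apply lim0_mult; [exact HK|]. apply lim0_comp; [exact Hl|]. apply sgnpow_continuous, Hq. }
  destruct (lim0_bounded _ _ Hb) as [del [Hdel HB]].
  set (G := Rabs (K 0 * sgnpow (crit_exp n p) d) + 1) in HB.
  split; [exact H0|split; [exact Hl|split]].
  - replace 0 with (- 0) by ring. apply lim0_opp.
    apply (lim0_squeeze _ (fun r => G * r) (Rmin del 1)); [apply Rmin_pos; lra| |].
    + intros x Hx. pose proof (Rmin_l del 1). pose proof (Rmin_r del 1).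
      apply (flux_small u (flux n p u) d G (Rmin del 1)); auto; [lra|].
      intros r Hr1. destruct (Hr r) as [_ [E1 E2]]; [lra|]. split; [exact E1|].
      replace (Derive (flux n p u) r) with
        (- (r ^ (n - 1) * (K r * sgnpow (crit_exp n p) (u r)))) by lra.
      rewrite Rabs_Ropp, Rabs_mult. specialize (HB r ltac:(lra)).
      assert (0 <= r ^ (n - 1) <= 1).
      { split; [apply pow_le; lra|]. replace 1 with (r ^ 0) by reflexivity.
        apply pow_le_pow_of_le_1; [lra|lia]. }
      rewrite (Rabs_pos_eq (r ^ (n - 1))) by lra.
      pose proof (Rabs_pos (K r * sgnpow (crit_exp n p) (u r))). nra.
    + replace 0 with (G * 0) by ring. apply lim0_mult; [apply lim0_const|apply lim0_id].
  - intros r Hr0. split.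
    { replace (- flux n p u r / r ^ (n - 1)) with (- (flux n p u r / r ^ (n - 1))).
      - rewrite sgnpow_opp, Ropp_involutive. apply Du; assumption.
      - unfold Rdiv. ring. }
    destruct (Hr r) as [_ [E1 E2]]; [assumption|].
    replace (r ^ (n - 1) * (K r * sgnpow (crit_exp n p) (u r))) with (- Derive (flux n p u) r) by lra.
    apply (is_derive_opp (flux n p u) r (Derive (flux n p u) r)), Derive_correct, E1.
Qed.

Lemma sysol_flux (g : R -> R) (d : R) (u w : R -> R) (r : R) :
  sysol n p g d u w -> 0 < r -> flux n p u r = - w r.
Proof.
  intros [_ [_ [_ H]]] Hr. destruct (H r Hr) as [Du _].
  unfold flux. rewrite (is_derive_unique _ _ _ Du), sgnpow_opp, sgnpow_inv by lra.
  assert (0 < r ^ (n - 1)) by (apply pow_lt; lra). field. lra.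
Qed.

Lemma sysol_regular (K : R -> R) (d : R) (u w g : R -> R) :
  sysol n p g d u w ->
  (forall r, 0 < r -> g r = K r * sgnpow (crit_exp n p) (u r)) ->
  regular_solution n p K d u.
Proof.
  intros S Hg. pose proof S as [H0 [Hu [_ H]]]. split; [exact H0|split; [exact Hu|]].
  intros r Hr. destruct (H r Hr) as [Du Dw].
  assert (E : is_derive (flux n p u) r (- (r ^ (n - 1) * g r))).
  { apply (is_derive_ext_loc (fun t => - w t)).
    - exists (mkposreal r Hr). intros y Hy. change (Rabs (y - r) < r) in Hy.
      apply Rabs_def2 in Hy. symmetry. apply (sysol_flux g d u w y S). lra.
    - apply (is_derive_opp w), Dw. }
  split; [eexists; exact Du|]. split; [eexists; exact E|].
  rewrite (is_derive_unique _ _ _ E), Hg by exact Hr. ring.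
Qed.

(** The weight [x ^ (n - 1)] is replaced by its maximum [r ^ (n - 1)] on [(0, r]]; this loses a
    factor [n] but cancels the denominator at once. *)
Lemma cumulative_bound (g w : R -> R) (M G : R) :
  lim0 w 0 -> (forall r, 0 < r -> is_derive w r (r ^ (n - 1) * g r)) ->
  (forall r, 0 < r <= M -> Rabs (g r) <= G) ->
  forall r, 0 < r <= M -> Rabs (w r / r ^ (n - 1)) <= G * r.
Proof.
  intros Hw H HG r Hr.
  assert (Hrn : 0 < r ^ (n - 1)) by (apply pow_lt; lra).
  assert (HG0 : 0 <= G) by (eapply Rle_trans; [apply Rabs_pos|apply (HG r Hr)]).
  assert (E : Rabs (w r - 0) <= r ^ (n - 1) * G * r).
  { apply (deriv_const_bound0 w (fun x => x ^ (n - 1) * g x)); [lra|exact Hw| |].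
    - intros x Hx. apply H; lra.
    - intros x Hx. rewrite Rabs_mult, Rabs_pos_eq by (apply pow_le; lra).
      apply Rmult_le_compat; [apply pow_le; lra|apply Rabs_pos|apply pow_incr; lra|apply HG; lra]. }
  rewrite Rminus_0_r in E. unfold Rdiv. rewrite Rabs_mult, Rabs_inv, (Rabs_pos_eq (r ^ (n - 1))) by lra.
  apply Rmult_le_reg_r with (r ^ (n - 1)); [exact Hrn|].
  rewrite Rmult_assoc, Rinv_l, Rmult_1_r by lra. lra.
Qed.

Context (Hp2 : p <= 2).

(** This is what [p <= 2] provides: [u'] is a locally Lipschitz function of [w r / r ^ (n - 1)]. *)
Lemma conj_exp_ge_2 : 2 <= p / (p - 1).
Proof. apply Rle_div_r; lra. Qed.

(** Differences are measured against the growing weight [exp (c * r)]. Integrating the second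
    equation costs a factor [M], integrating the first gains [1 / c], so a large [c] gives a
    contraction on all of [(0, M]], however large [M] is. *)
Lemma volterra_contraction (g1 g2 u1 w1 u2 w2 : R -> R) (d1 d2 M G c m : R) :
  sysol n p g1 d1 u1 w1 -> sysol n p g2 d2 u2 w2 -> 0 < M -> 0 < G -> 0 < c -> 0 <= m ->
  (forall r, 0 < r <= M -> Rabs (g1 r) <= G /\ Rabs (g2 r) <= G) ->
  (forall r, 0 < r <= M -> Rabs (g1 r - g2 r) <= m * exp (c * r)) ->
  forall r, 0 < r <= M ->
    Rabs (u1 r - u2 r) <=
    Rabs (d1 - d2) + (p / (p - 1) - 1) * Rpower (G * M) (p / (p - 1) - 2) * M / c * m * exp (c * r).
Proof.
  intros S1 S2 HM HG Hc Hm Hb Hd r Hr.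
  pose proof conj_exp_ge_2 as Hp'.
  (* Lipschitz constant of the conjugate power on [[- G * M, G * M]], where [cumulative_bound] keeps
     both arguments. *)
  set (L := (p / (p - 1) - 1) * Rpower (G * M) (p / (p - 1) - 2)).
  assert (HL : 0 < L) by (apply Rmult_lt_0_compat; [lra|apply Rpower_pos]).
  destruct S1 as [_ [Hu1 [Hw1 D1]]]. destruct S2 as [_ [Hu2 [Hw2 D2]]].
  pose proof (cumulative_bound g1 w1 M G Hw1 (fun r H => proj2 (D1 r H)) (fun r H => proj1 (Hb r H))) as Q1.
  pose proof (cumulative_bound g2 w2 M G Hw2 (fun r H => proj2 (D2 r H)) (fun r H => proj2 (Hb r H))) as Q2.
  assert (HW : forall x, 0 < x <= M ->
    Rabs (w1 x / x ^ (n - 1) - w2 x / x ^ (n - 1)) <= M * (m * exp (c * x))).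
  { intros x Hx. assert (Hxn : 0 < x ^ (n - 1)) by (apply pow_lt; lra).
    pose proof (exp_pos (c * x)) as Hex.
    assert (E : Rabs (w1 x - w2 x - (0 - 0)) <= x ^ (n - 1) * (m * exp (c * x)) * x).
    { apply (deriv_const_bound0 (fun x => w1 x - w2 x)
        (fun x => x ^ (n - 1) * g1 x - x ^ (n - 1) * g2 x)); [lra|apply lim0_minus; assumption| |].
      - intros y Hy. apply (is_derive_minus w1 w2); [apply D1|apply D2]; lra.
      - intros y Hy. rewrite <- Rmult_minus_distr_l, Rabs_mult, Rabs_pos_eq by (apply pow_le; lra).
        apply Rmult_le_compat; [apply pow_le; lra|apply Rabs_pos|apply pow_incr; lra|].
        eapply Rle_trans; [apply Hd; lra|]. apply Rmult_le_compat_l; [exact Hm|].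
        destruct (Req_dec y x) as [->|Hyx]; [lra|]. apply Rlt_le, exp_increasing. nra. }
    replace (w1 x / x ^ (n - 1) - w2 x / x ^ (n - 1)) with ((w1 x - w2 x - (0 - 0)) * / x ^ (n - 1))
      by (field; lra).
    rewrite Rabs_mult, Rabs_inv, (Rabs_pos_eq (x ^ (n - 1))) by lra.
    apply Rmult_le_reg_r with (x ^ (n - 1)); [exact Hxn|].
    rewrite Rmult_assoc, Rinv_l, Rmult_1_r by lra.
    eapply Rle_trans; [exact E|].
    assert (0 <= m * exp (c * x)) by (apply Rmult_le_pos; lra).
    assert (0 <= x ^ (n - 1) * (m * exp (c * x))) by (apply Rmult_le_pos; lra). nra. }
  assert (E : Rabs (u1 r - u2 r - (d1 - d2)) <=
    L * M / c * m * exp (c * r) - L * M / c * m * exp (c * 0)).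
  { apply (deriv_bound0 (fun x => u1 x - u2 x)
      (fun x => - sgnpow (p / (p - 1)) (w1 x / x ^ (n - 1))
                - - sgnpow (p / (p - 1)) (w2 x / x ^ (n - 1)))
      (fun x => L * M / c * m * exp (c * x)) (fun x => L * (M * (m * exp (c * x))))); [lra| | | | |].
    - apply lim0_minus; assumption.
    - apply (lim0_continuous (fun x => L * M / c * m * exp (c * x))).
      apply (ex_derive_continuous (fun x => L * M / c * m * exp (c * x))). auto_derive. exact I.
    - intros x Hx. apply (is_derive_minus u1 u2); [apply D1|apply D2]; lra.
    - intros x Hx. auto_derive; [exact I|]. field. lra.
    - intros x Hx.
      replace (- sgnpow (p / (p - 1)) (w1 x / x ^ (n - 1)) - - sgnpow (p / (p - 1)) (w2 x / x ^ (n - 1)))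
        with (- (sgnpow (p / (p - 1)) (w1 x / x ^ (n - 1)) - sgnpow (p / (p - 1)) (w2 x / x ^ (n - 1)))) by ring.
      rewrite Rabs_Ropp. specialize (Q1 x ltac:(lra)). specialize (Q2 x ltac:(lra)).
      assert (G * x <= G * M) by nra.
      eapply Rle_trans; [apply (sgnpow_lipschitz (p / (p - 1)) (G * M)); try lra; nra|].
      fold L. apply Rle_trans with (L * (M * (m * exp (c * x)))); [|lra].
      apply Rmult_le_compat_l; [lra|]. apply HW; lra. }
  fold L.
  assert (0 <= L * M / c * m * exp (c * 0)).
  { pose proof (exp_pos (c * 0)). assert (0 < / c) by (apply Rinv_0_lt_compat; lra).
    unfold Rdiv.
    apply Rmult_le_pos; [apply Rmult_le_pos; [apply Rmult_le_pos; [nra|]|]|]; lra. }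
  replace (u1 r - u2 r) with ((d1 - d2) + (u1 r - u2 r - (d1 - d2))) by ring.
  eapply Rle_trans; [apply Rabs_triang|]. lra.
Qed.

End System.

(** * Amplitude bound and continuous dependence on [d] *)

Lemma is_derive_primitive (f : R -> R) (x : R) :
  (forall y, continuous f y) -> is_derive (fun t => RInt f 0 t) x (f x).
Proof.
  intros H. apply (is_derive_RInt f (fun t => RInt f 0 t) 0 x); [|apply H].
  exists (mkposreal 1 Rlt_0_1). intros y _. apply (RInt_correct (V := R_CompleteNormedModule)).
  apply (ex_RInt_continuous (V := R_CompleteNormedModule)). intros z _. apply H.
Qed.

Lemma is_derive_pow_div (k : nat) (x : R) :
  0 < x -> is_derive (fun t => t ^ k) x (INR k * (x ^ k / x)).
Proof.
  intros Hx. destruct k as [|k].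
  - simpl. rewrite Rmult_0_l. apply (is_derive_const (V := R_NormedModule) 1 x).
  - replace (INR (S k) * (x ^ S k / x)) with (INR (S k) * 1 * x ^ Init.Nat.pred (S k)).
    + apply (is_derive_pow (fun t => t)), (is_derive_id x).
    + simpl Init.Nat.pred. rewrite <- tech_pow_Rmult. field. lra.
Qed.

(** Freezing a function at its value at 0 on the negative side makes it continuous on the whole
    line, so that two-sided continuity and integration from 0 can be used. *)
Lemma continuous_extend (k : R -> R) :
  lim0 k (k 0) -> (forall r, 0 < r -> continuous k r) ->
  forall x, continuous (fun r => k (Rmax 0 r)) x.
Proof.
  intros H0 H x. apply continuous_eps. intros e He.
  destruct (Rtotal_order x 0) as [Hx|[->|Hx]].
  - exists (- x). split; [lra|]. intros y Hy. apply Rabs_def2 in Hy.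
    rewrite !Rmax_left by lra. rewrite Rminus_diag, Rabs_R0. exact He.
  - destruct (proj1 (lim0_eps k _) H0 e He) as [d [Hd Hk]].
    exists d. split; [exact Hd|]. intros y Hy. rewrite (Rmax_left 0 0) by lra.
    destruct (Rle_or_lt y 0) as [Hy0|Hy0].
    + rewrite Rmax_left by lra. rewrite Rminus_diag, Rabs_R0. exact He.
    + rewrite Rmax_right by lra. apply Hk. rewrite Rminus_0_r in Hy. apply Rabs_def2 in Hy. lra.
  - destruct (continuous_eps_inv k x (H x Hx) e He) as [d [Hd Hk]].
    exists (Rmin d x). split; [apply Rmin_pos; lra|]. intros y Hy.
    pose proof (Rmin_l d x). pose proof (Rmin_r d x).
    assert (0 < y) by (apply Rabs_def2 in Hy; lra).
    rewrite !Rmax_right by lra. apply Hk. lra.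
Qed.

Lemma continuous_bounded (f : R -> R) (a b : R) :
  a <= b -> (forall x, a <= x <= b -> continuous f x) ->
  exists B, 0 < B /\ forall x, a <= x <= b -> Rabs (f x) <= B.
Proof.
  intros Hab H.
  destruct (continuity_ab_maj (fun x => Rabs (f x)) a b Hab) as [x0 [Hx0 _]].
  - intros c Hc. apply continuity_pt_filterlim.
    apply (continuous_comp f Rabs); [apply H, Hc|apply continuous_Rabs].
  - exists (Rabs (f x0) + 1). split; [pose proof (Rabs_pos (f x0)); lra|].
    intros x Hx. specialize (Hx0 x Hx). simpl in Hx0. lra.
Qed.

Lemma le_of_le_half_pow (a b C : R) :
  (forall k : nat, a <= b + C * (/ 2) ^ k) -> a <= b.
Proof.
  intros H.
  assert (L : is_lim_seq (fun k => b + C * (/ 2) ^ k) (b + C * 0)).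
  { apply (is_lim_seq_plus _ _ b (C * 0)); [apply is_lim_seq_const| |reflexivity].
    apply (is_lim_seq_scal_l _ C 0). apply is_lim_seq_geom. rewrite Rabs_pos_eq; lra. }
  pose proof (is_lim_seq_le (fun _ => a) _ a _ H (is_lim_seq_const a) L) as E. simpl in E. lra.
Qed.

Lemma geometric_cauchy_limit (x : nat -> R) (C : R) :
  (forall k, Rabs (x (S k) - x k) <= C * (/ 2) ^ k) ->
  forall k, Rabs (real (Lim_seq x) - x k) <= 2 * C * (/ 2) ^ k.
Proof.
  intros H.
  assert (Hstep : forall k j, Rabs (x (k + j)%nat - x k) <= 2 * C * (/ 2) ^ k * (1 - (/ 2) ^ j)).
  { intros k j. induction j as [|j IH].
    - rewrite Nat.add_0_r, Rminus_diag, Rabs_R0. simpl. lra.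
    - replace (x (k + S j)%nat - x k) with ((x (S (k + j)) - x (k + j)%nat) + (x (k + j)%nat - x k))
        by (rewrite Nat.add_succ_r; ring).
      eapply Rle_trans; [apply Rabs_triang|]. specialize (H (k + j)%nat).
      rewrite pow_add in H. simpl. lra. }
  assert (HC : 0 <= C).
  { specialize (H 0%nat). pose proof (Rabs_pos (x 1%nat - x 0%nat)). simpl in H. lra. }
  assert (Hle : forall k j, Rabs (x (k + j)%nat - x k) <= 2 * C * (/ 2) ^ k).
  { intros k j. eapply Rle_trans; [apply Hstep|].
    assert (0 < (/ 2) ^ j) by (apply pow_lt; lra). assert (0 < (/ 2) ^ k) by (apply pow_lt; lra).
    assert (0 <= 2 * C * (/ 2) ^ k) by (apply Rmult_le_pos; lra). nra. }
  assert (Hex : ex_finite_lim_seq x).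
  { apply ex_lim_seq_cauchy_corr. intros e.
    assert (He : 0 < e / (4 * C + 1)) by (apply Rdiv_lt_0_compat; [apply cond_pos|lra]).
    destruct (pow_lt_1_zero (/ 2) ltac:(rewrite Rabs_pos_eq; lra) _ He) as [N HN].
    specialize (HN N (Nat.le_refl N)). rewrite Rabs_pos_eq in HN by (apply pow_le; lra).
    exists N. intros i j Hi Hj.
    pose proof (Hle N (i - N)%nat) as E1. pose proof (Hle N (j - N)%nat) as E2.
    replace (N + (i - N))%nat with i in E1 by lia. replace (N + (j - N))%nat with j in E2 by lia.
    replace (x i - x j) with ((x i - x N) - (x j - x N)) by ring.
    eapply Rle_lt_trans; [apply Rabs_triang|]. rewrite Rabs_Ropp.
    assert ((4 * C + 1) * (/ 2) ^ N < e).
    { replace (pos e) with ((4 * C + 1) * (e / (4 * C + 1))) by (field; lra).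
      apply Rmult_lt_compat_l; lra. }
    assert (0 < (/ 2) ^ N) by (apply pow_lt; lra). lra. }
  intros k. destruct Hex as [l Hl]. rewrite (is_lim_seq_unique _ _ Hl). simpl.
  apply (is_lim_seq_le (fun j => Rabs (x (j + k)%nat - x k)) (fun _ => 2 * C * (/ 2) ^ k)
    (Rabs (l - x k)) (2 * C * (/ 2) ^ k)).
  - intros j. rewrite Nat.add_comm. apply Hle.
  - apply (is_lim_seq_abs _ (l - x k)). apply (is_lim_seq_minus _ _ l (x k)); [|apply is_lim_seq_const|reflexivity].
    apply (is_lim_seq_incr_n x k), Hl.
  - apply is_lim_seq_const.
Qed.

Lemma continuous_uniform_limit (v : nat -> R -> R) (l : R -> R) (x : R) :
  (forall k, continuous (v k) x) ->
  (forall eps, 0 < eps -> exists k, forall y, Rabs (y - x) < 1 -> Rabs (l y - v k y) <= eps) ->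
  continuous l x.
Proof.
  intros Hv H. apply continuous_eps. intros e He.
  destruct (H (e / 4)) as [k Hk]; [lra|].
  destruct (continuous_eps_inv _ _ (Hv k) (e / 4)) as [d [Hd Hc]]; [lra|].
  exists (Rmin d 1). split; [apply Rmin_pos; lra|]. intros y Hy.
  pose proof (Rmin_l d 1). pose proof (Rmin_r d 1).
  specialize (Hc y ltac:(lra)). pose proof (Hk y ltac:(lra)) as E1.
  pose proof (Hk x ltac:(rewrite Rminus_diag, Rabs_R0; lra)) as E2.
  apply Rabs_def2 in Hc. apply Rabs_le_between in E1. apply Rabs_le_between in E2.
  apply Rabs_def1; lra.
Qed.

(** * Truncation of the nonlinearity *)

Definition clamp (D s : R) : R := Rmax (- D) (Rmin D s).

Lemma clamp_abs (D s : R) : 0 < D -> Rabs (clamp D s) <= D.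
Proof.
  intros H. unfold clamp. apply Rabs_le. split; [apply Rmax_l|].
  apply Rmax_lub; [lra|apply Rmin_l].
Qed.

Lemma clamp_id (D s : R) : Rabs s <= D -> clamp D s = s.
Proof.
  intros H. apply Rabs_le_between in H. unfold clamp.
  rewrite Rmin_right, Rmax_right by lra. reflexivity.
Qed.

Lemma clamp_opp (D s : R) : 0 < D -> clamp D (- s) = - clamp D s.
Proof. intros. unfold clamp, Rmax, Rmin. repeat destruct (Rle_dec _ _); lra. Qed.

Lemma clamp_pos (D s : R) : 0 < D -> 0 < s -> 0 < clamp D s.
Proof. intros. unfold clamp, Rmax, Rmin. repeat destruct (Rle_dec _ _); lra. Qed.

Lemma clamp_lipschitz (D s t : R) : Rabs (clamp D s - clamp D t) <= Rabs (s - t).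
Proof.
  unfold clamp, Rmax, Rmin. repeat destruct (Rle_dec _ _);
  unfold Rabs; repeat destruct (Rcase_abs _); lra.
Qed.

(** Bounded and globally Lipschitz, unlike [sgnpow]; the iteration can therefore be run on any
    interval without a prior bound on the iterates. *)
Definition tpow (m D s : R) : R := sgnpow m (clamp D s).

Lemma tpow_id (m D s : R) : Rabs s <= D -> tpow m D s = sgnpow m s.
Proof. intros H. unfold tpow. rewrite clamp_id by exact H. reflexivity. Qed.

Lemma tpow_bound (m D s : R) : 2 <= m -> 0 < D -> Rabs (tpow m D s) <= Rpower D (m - 2) * D.
Proof.
  intros Hm HD. unfold tpow. pose proof (clamp_abs D s HD) as H.
  eapply Rle_trans; [apply (sgnpow_abs_le m D); assumption|].
  apply Rmult_le_compat_l; [apply Rlt_le, Rpower_pos|exact H].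
Qed.

Lemma tpow_lipschitz (m D s t : R) : 2 <= m -> 0 < D ->
  Rabs (tpow m D s - tpow m D t) <= (m - 1) * Rpower D (m - 2) * Rabs (s - t).
Proof.
  intros Hm HD. unfold tpow.
  eapply Rle_trans; [apply (sgnpow_lipschitz m D); try assumption; apply clamp_abs, HD|].
  pose proof (Rpower_pos D (m - 2)).
  apply Rmult_le_compat_l; [apply Rmult_le_pos; lra|apply clamp_lipschitz].
Qed.

Lemma tpow_continuous (m D s : R) : 2 <= m -> continuous (tpow m D) s.
Proof.
  intros Hm. apply (continuous_comp (clamp D) (sgnpow m)); [|apply sgnpow_continuous, Hm].
  apply continuous_eps. intros e He. exists e. split; [exact He|].
  intros y Hy. eapply Rle_lt_trans; [apply clamp_lipschitz|exact Hy].
Qed.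

Definition weight (K K' : R -> R) : Prop :=
  (forall r, 0 <= r -> 0 < K r) /\ lim0 K (K 0) /\
  (forall r s, 0 <= r -> r <= s -> K r <= K s) /\
  forall r, 0 < r -> is_derive K r (K' r) /\ 0 <= K' r /\ continuous K' r.

Lemma cumulative_slope_lim0 (n : nat) (g w : R -> R) (g0 : R) :
  lim0 w 0 -> (forall r, 0 < r -> is_derive w r (r ^ (n - 1) * g r)) -> lim0 g g0 ->
  lim0 (fun r => w r / r ^ (n - 1)) 0.
Proof.
  intros Hw Dw Hg. destruct (lim0_bounded _ _ Hg) as [del [Hdel HB]].
  set (G := Rabs g0 + 1) in HB.
  apply (lim0_squeeze _ (fun x => G * x) del Hdel).
  - intros x Hx. apply (cumulative_bound n g w x G Hw); [exact Dw|intros y Hy; apply HB; lra|lra].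
  - replace 0 with (G * 0) by ring. apply lim0_mult; [apply lim0_const|apply lim0_id].
Qed.

Section Solutions.

Context (n : nat) (p q : R) (K K' : R -> R).
Context (Hp : 1 < p < INR n).
Context (Hp2 : p <= 2).
Context (Hq : 2 <= q).
Context (HK : weight K K').

Lemma weight_continuous (r : R) : 0 < r -> continuous K r.
Proof.
  intros Hr. apply (ex_derive_continuous K r). exists (K' r).
  destruct HK as [_ [_ [_ H]]]. apply H, Hr.
Qed.

(* [|u'|^p (p - 1) / (p K) + F (u)], with [F' = f], is nonincreasing. *)
Lemma amplitude_bound (f : R -> R) (d : R) (u w : R -> R) :
  (forall s, continuous f s) -> (forall s, f (- s) = - f s) -> (forall s, 0 < s -> 0 < f s) ->
  0 < d -> sysol n p (fun r => K r * f (u r)) d u w ->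
  forall r, 0 <= r -> Rabs (u r) <= d.
Proof.
  intros Hc Hodd Hpos Hd [H0 [Hu [Hw D]]] r Hr.
  destruct HK as [KP [K0 [_ KD]]].
  destruct Hr as [Hr|<-]; [|rewrite H0, Rabs_pos_eq; lra].
  pose proof (conj_exp_ge_2 n p Hp Hp2) as Hp'. set (p' := p / (p - 1)) in *.
  pose (F := fun s => RInt f 0 s).
  assert (DF : forall s, is_derive F s (f s)) by (intros s; apply is_derive_primitive, Hc).
  pose (Q := fun r => w r / r ^ (n - 1)).
  assert (HQ : lim0 Q 0).
  { apply (cumulative_slope_lim0 n (fun r => K r * f (u r)) w (K 0 * f d) Hw).
    - intros y Hy. apply D, Hy.
    - apply lim0_mult; [exact K0|]. apply lim0_comp; [exact Hu|apply Hc]. }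
  (* [|Q| ^ p'] is [|u'| ^ p] and [/ p'] is [(p - 1) / p]. The sign is reversed to make the energy
     nondecreasing; at 0 only [- F d] survives. *)
  pose (H := fun x => - (/ K x * (/ p' * rpow (Rabs (Q x)) p') + F (u x))).
  pose (dH := fun x => - (- K' x / K x ^ 2 * (/ p' * rpow (Rabs (Q x)) p')
      + / K x * (sgnpow p' (Q x) * (K x * f (u x) - INR (n - 1) * Q x / x))
      + f (u x) * - sgnpow p' (Q x))).
  assert (E : - F d <= H r).
  { apply (deriv_nonneg_le0 H dH (- F d) r Hr).
    - replace (- F d) with (- (/ K 0 * (/ p' * rpow (Rabs 0) p') + F d)).
      2:{ rewrite Rabs_R0, rpow_0. ring. }
      apply lim0_opp, lim0_plus.
      + apply lim0_mult.
        * apply (lim0_comp K Rinv); [exact K0|]. apply (ex_derive_continuous Rinv).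
          apply (ex_derive_inv (fun x => x)); [apply ex_derive_id|].
          specialize (KP 0 (Rle_refl 0)). lra.
        * apply lim0_mult; [apply lim0_const|].
          apply (lim0_comp Q (fun s => rpow (Rabs s) p')); [exact HQ|].
          apply (ex_derive_continuous (fun s => rpow (Rabs s) p')).
          eexists. apply is_derive_rpow_abs. lra.
      + apply (lim0_comp u F); [exact Hu|]. apply (ex_derive_continuous F). eexists. apply DF.
    - intros x Hx. assert (Hxn : 0 < x ^ (n - 1)) by (apply pow_lt; lra).
      specialize (KP x ltac:(lra)). destruct (KD x ltac:(lra)) as [KD1 _].
      destruct (D x ltac:(lra)) as [Du Dw].
      assert (DQ : is_derive Q x (K x * f (u x) - INR (n - 1) * Q x / x)).
      { unfold Q. replace (K x * f (u x) - INR (n - 1) * (w x / x ^ (n - 1)) / x) with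
          ((x ^ (n - 1) * (K x * f (u x)) * x ^ (n - 1) - w x * (INR (n - 1) * (x ^ (n - 1) / x)))
            / (x ^ (n - 1)) ^ 2) by (field; lra).
        apply is_derive_div; [exact Dw|apply is_derive_pow_div; lra|lra]. }
      unfold H, dH. apply (is_derive_opp (fun x => / K x * (/ p' * rpow (Rabs (Q x)) p') + F (u x))).
      apply (is_derive_plus (fun x => / K x * (/ p' * rpow (Rabs (Q x)) p')) (fun x => F (u x))).
      + apply (is_derive_mult (fun x => / K x) (fun x => / p' * rpow (Rabs (Q x)) p')).
        * apply is_derive_inv; [exact KD1|lra].
        * replace (sgnpow p' (Q x) * (K x * f (u x) - INR (n - 1) * Q x / x)) with
            (/ p' * ((K x * f (u x) - INR (n - 1) * Q x / x) * (p' * sgnpow p' (Q x)))) by (field; lra).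
          apply is_derive_scal.
          apply (is_derive_comp (fun s => rpow (Rabs s) p') Q); [apply is_derive_rpow_abs; lra|exact DQ].
        * intros a b. apply Rmult_comm.
      + replace (f (u x) * - sgnpow p' (Q x)) with (- sgnpow p' (Q x) * f (u x)) by ring.
        apply (is_derive_comp F u); [apply DF|exact Du].
    - intros x Hx. unfold dH. specialize (KP x ltac:(lra)). destruct (KD x ltac:(lra)) as [_ [KD1 _]].
      pose proof (rpow_nonneg (Rabs (Q x)) p') as R1. pose proof (sgnpow_mult_nonneg p' (Q x)) as R2.
      (* The terms in [f (u x)] cancel. What remains is one term carrying [K' >= 0] and the damping
         term carrying [n - 1 >= 0]. *)
      replace (- (- K' x / K x ^ 2 * (/ p' * rpow (Rabs (Q x)) p') +
        / K x * (sgnpow p' (Q x) * (K x * f (u x) - INR (n - 1) * Q x / x)) + f (u x) * - sgnpow p' (Q x)))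
        with (K' x * (/ K x ^ 2 * (/ p' * rpow (Rabs (Q x)) p'))
              + INR (n - 1) * (/ x * (/ K x * (Q x * sgnpow p' (Q x))))) by (field; lra).
      assert (0 < / K x) by (apply Rinv_0_lt_compat; lra).
      assert (0 < / K x ^ 2) by (apply Rinv_0_lt_compat, pow_lt; lra).
      assert (0 < / x) by (apply Rinv_0_lt_compat; lra).
      assert (0 < / p') by (apply Rinv_0_lt_compat; lra).
      pose proof (pos_INR (n - 1)).
      apply Rplus_le_le_0_compat; repeat (apply Rmult_le_pos; [lra|]); lra. }
  assert (HF : F (u r) <= F d).
  { unfold H in E.
    assert (0 <= / K r * (/ p' * rpow (Rabs (Q r)) p')); [|lra].
    pose proof (rpow_nonneg (Rabs (Q r)) p'). specialize (KP r ltac:(lra)).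
    apply Rmult_le_pos; [apply Rlt_le, Rinv_0_lt_compat; lra|].
    apply Rmult_le_pos; [apply Rlt_le, Rinv_0_lt_compat; lra|lra]. }
  (* [u] may be negative; evenness of [F] reduces the claim to [F (Rabs (u r)) <= F d], where [F] is
     strictly increasing. *)
  assert (Hev : forall s, 0 < s -> F (- s) = F s).
  { intros s Hs.
    assert (Rabs (F s - F (- s) - (F 0 - F (- 0))) <= 0 * s - 0 * 0).
    { apply (deriv_bound (fun s => F s - F (- s)) (fun s => f s - -1 * f (- s)) (fun s => 0 * s) (fun _ => 0));
        [lra| | |].
      - intros x _. apply (is_derive_minus F (fun s => F (- s))); [apply DF|].
        apply (is_derive_comp F Ropp); [apply DF|]. apply (is_derive_opp (fun x => x) x 1), (is_derive_id x).
      - intros x _. apply is_derive_linear.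
      - intros x _. rewrite Hodd. replace (f x - -1 * - f x) with 0 by ring. rewrite Rabs_R0. lra. }
    rewrite Ropp_0 in *.
    replace (0 * s - 0 * 0) with 0 in * by ring.
    pose proof (Rabs_pos (F s - F (- s) - (F 0 - F 0))) as A1.
    assert (A2 : Rabs (F s - F (- s) - (F 0 - F 0)) = 0) by lra.
    destruct (Req_dec (F s - F (- s) - (F 0 - F 0)) 0) as [A3|A3]; [lra|].
    apply Rabs_no_R0 in A3. lra. }
  destruct (Rle_or_lt (Rabs (u r)) d) as [|Hlt]; [assumption|exfalso].
  assert (Hinc : F d < F (Rabs (u r))).
  { apply (deriv_pos_lt F f); [exact Hlt|intros x _; apply DF|intros x Hx; apply Hpos; lra]. }
  assert (F (Rabs (u r)) = F (u r)); [|lra].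
  unfold Rabs. destruct (Rcase_abs (u r)); [|reflexivity].
  rewrite <- (Hev (- u r)), Ropp_involutive by lra. reflexivity.
Qed.

Lemma sysol_ext (g1 g2 : R -> R) (d : R) (u w : R -> R) :
  (forall r, 0 < r -> g1 r = g2 r) -> sysol n p g1 d u w -> sysol n p g2 d u w.
Proof.
  intros H [H0 [Hu [Hw D]]]. split; [exact H0|split; [exact Hu|split; [exact Hw|]]].
  intros r Hr. rewrite <- H by exact Hr. apply D, Hr.
Qed.

Lemma truncated_contraction (M D : R) : 0 < M -> 0 < D -> exists c, 0 < c /\
  forall m d1 d2 v1 v2 u1 w1 u2 w2, 0 <= m ->
    sysol n p (fun r => K r * tpow q D (v1 r)) d1 u1 w1 ->
    sysol n p (fun r => K r * tpow q D (v2 r)) d2 u2 w2 ->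
    (forall r, 0 < r <= M -> Rabs (v1 r - v2 r) <= m * exp (c * r)) ->
    forall r, 0 < r <= M -> Rabs (u1 r - u2 r) <= Rabs (d1 - d2) + m / 2 * exp (c * r).
Proof.
  intros HM HD. destruct HK as [KP [_ [KM _]]].
  pose proof (KP M ltac:(lra)) as HKM.
  pose proof (Rpower_pos D (q - 2)) as HDq.
  pose proof (conj_exp_ge_2 n p Hp Hp2) as Hp'.
  set (G := K M * (Rpower D (q - 2) * D)).
  assert (HG : 0 < G) by (repeat apply Rmult_lt_0_compat; lra).
  set (Lf := (q - 1) * Rpower D (q - 2)).
  assert (HLf : 0 < Lf) by (apply Rmult_lt_0_compat; lra).
  set (La := (p / (p - 1) - 1) * Rpower (G * M) (p / (p - 1) - 2) * M).
  assert (HLa : 0 < La).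
  { repeat apply Rmult_lt_0_compat; try lra. apply Rpower_pos. }
  (* Twice the product of the Lipschitz constants of the two steps, so that the contraction factor
     is exactly 1/2. By monotonicity [K M] bounds [K] on [(0, M]]. *)
  exists (2 * La * (K M * Lf)).
  assert (HKL : 0 < K M * Lf) by (apply Rmult_lt_0_compat; lra).
  assert (Hc : 0 < 2 * La * (K M * Lf)) by (apply Rmult_lt_0_compat; lra).
  split; [exact Hc|].
  intros m d1 d2 v1 v2 u1 w1 u2 w2 Hm S1 S2 Hv r Hr.
  assert (HB : forall v x, 0 < x <= M -> Rabs (K x * tpow q D (v x)) <= G).
  { intros v x Hx. rewrite Rabs_mult. rewrite Rabs_pos_eq by (apply Rlt_le, KP; lra).
    apply Rmult_le_compat; [apply Rlt_le, KP; lra|apply Rabs_pos|apply KM; lra|apply tpow_bound; lra]. }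
  eapply Rle_trans.
  - apply (volterra_contraction n p Hp Hp2 _ _ u1 w1 u2 w2 d1 d2 M G (2 * La * (K M * Lf))
      (K M * Lf * m) S1 S2 HM HG Hc).
    + apply Rmult_le_pos; lra.
    + intros x Hx. split; apply HB; lra.
    + intros x Hx. rewrite <- Rmult_minus_distr_l, Rabs_mult, Rabs_pos_eq by (apply Rlt_le, KP; lra).
      replace (K M * Lf * m * exp (2 * La * (K M * Lf) * x)) with
        (K M * (Lf * (m * exp (2 * La * (K M * Lf) * x)))) by ring.
      apply Rmult_le_compat; [apply Rlt_le, KP; lra|apply Rabs_pos|apply KM; lra|].
      eapply Rle_trans; [apply (tpow_lipschitz q D); lra|]. fold Lf.
      apply Rmult_le_compat_l; [lra|]. apply Hv, Hx.
    + exact Hr.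
  - apply Rplus_le_compat_l. apply Req_le. fold La. field. lra.
Qed.

(** Each solution is its own forcing, so the contraction can be iterated on [u1 - u2] itself,
    starting from the crude bound [2 * D]; [2 * del] is the fixed point of [m |-> del + m / 2].
    Equal amplitudes give uniqueness. *)
Lemma sysol_dependence (M D : R) : 0 < M -> 0 < D -> exists C, 0 < C /\
  forall d1 d2 u1 w1 u2 w2,
    sysol n p (fun r => K r * sgnpow q (u1 r)) d1 u1 w1 ->
    sysol n p (fun r => K r * sgnpow q (u2 r)) d2 u2 w2 ->
    (forall r, 0 < r -> Rabs (u1 r) <= D /\ Rabs (u2 r) <= D) ->
    forall r, 0 < r <= M -> Rabs (u1 r - u2 r) <= C * Rabs (d1 - d2).
Proof.
  intros HM HD. destruct (truncated_contraction M D HM HD) as [c [Hc H]].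
  exists (2 * exp (c * M)). split; [pose proof (exp_pos (c * M)); lra|].
  intros d1 d2 u1 w1 u2 w2 S1 S2 HB.
  assert (S1' : sysol n p (fun r => K r * tpow q D (u1 r)) d1 u1 w1).
  { revert S1. apply sysol_ext. intros r Hr. rewrite tpow_id; [reflexivity|apply HB, Hr]. }
  assert (S2' : sysol n p (fun r => K r * tpow q D (u2 r)) d2 u2 w2).
  { revert S2. apply sysol_ext. intros r Hr. rewrite tpow_id; [reflexivity|apply HB, Hr]. }
  pose proof (Rabs_pos (d1 - d2)) as Hd. set (del := Rabs (d1 - d2)) in *.
  assert (Hk : forall (k : nat) r, 0 < r <= M ->
    Rabs (u1 r - u2 r) <= (2 * del + 2 * D * (/ 2) ^ k) * exp (c * r)).
  { intros k. induction k as [|k IH]; intros r Hr.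
    - assert (1 <= exp (c * r)) by (rewrite <- exp_0; apply Rlt_le, exp_increasing; nra).
      destruct (HB r ltac:(lra)) as [B1 B2]. simpl. rewrite Rmult_1_r.
      apply Rabs_le_between in B1. apply Rabs_le_between in B2.
      apply Rle_trans with (2 * D); [apply Rabs_le; lra|]. nra.
    - assert (0 < (/ 2) ^ k) by (apply pow_lt; lra).
      eapply Rle_trans; [apply (H _ d1 d2 u1 u2 u1 w1 u2 w2) with (2 := S1') (3 := S2') (4 := IH); [nra|exact Hr]|].
      assert (1 <= exp (c * r)) by (rewrite <- exp_0; apply Rlt_le, exp_increasing; nra).
      fold del. simpl. nra. }
  intros r Hr.
  apply (le_of_le_half_pow _ _ (2 * D * exp (c * r))). intros k.
  eapply Rle_trans; [apply (Hk k r Hr)|]. rewrite Rmult_plus_distr_r.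
  apply Rplus_le_compat; [|lra].
  assert (exp (c * r) <= exp (c * M)).
  { destruct (Req_dec r M) as [->|]; [lra|]. apply Rlt_le, exp_increasing. nra. }
  nra.
Qed.

End Solutions.

(** * Existence by Picard iteration *)

Section Existence.

Context (n : nat) (p q : R) (K K' : R -> R).
Context (Hp : 1 < p < INR n).
Context (Hp2 : p <= 2).
Context (Hq : 2 <= q).
Context (HK : weight K K').

Lemma volterra_solution (d : R) (g : R -> R) : (forall x, continuous g x) ->
  exists u w, (forall x, continuous u x) /\ sysol n p g d u w.
Proof.
  intros Hg. pose proof (conj_exp_ge_2 n p Hp Hp2) as Hp'.
  pose (w := fun r => RInt (fun t => t ^ (n - 1) * g t) 0 r).
  assert (Cg : forall x, continuous (fun t => t ^ (n - 1) * g t) x).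
  { intros x. apply (continuous_mult (fun t => t ^ (n - 1)) g); [|apply Hg].
    apply (ex_derive_continuous (fun t => t ^ (n - 1))). auto_derive. exact I. }
  assert (Dw : forall r, is_derive w r (r ^ (n - 1) * g r)).
  { intros r. apply (is_derive_primitive (fun t => t ^ (n - 1) * g t) r). exact Cg. }
  assert (Cw : forall r, continuous w r) by (intros r; apply (ex_derive_continuous w); eexists; apply Dw).
  assert (w0 : w 0 = 0) by (unfold w; apply (RInt_point (V := R_CompleteNormedModule))).
  assert (Lw : lim0 w 0) by (rewrite <- w0; apply lim0_continuous, Cw).
  pose (Q := fun r => w r / r ^ (n - 1)).
  (* Division by zero is harmless at 0: the numerator vanishes, and the resulting 0 is also the
     limit of [Q]. *)
  assert (Q0 : Q 0 = 0) by (unfold Q; rewrite w0; unfold Rdiv; ring).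
  assert (LQ : lim0 Q (Q 0)).
  { rewrite Q0. destruct (continuous_bounded g 0 1) as [G [HG HB]]; [lra|intros x _; apply Hg|].
    apply (lim0_squeeze _ (fun r => G * r) 1); [lra| |].
    - intros x Hx. apply (cumulative_bound n g w 1 G Lw); [intros r _; apply Dw|intros r Hr; apply HB; lra|lra].
    - replace 0 with (G * 0) by ring. apply lim0_mult; [apply lim0_const|apply lim0_id]. }
  assert (CQ : forall x, continuous (fun r => Q (Rmax 0 r)) x).
  { apply continuous_extend; [exact LQ|]. intros r Hr.
    apply (continuous_mult w (fun r => / r ^ (n - 1))); [apply Cw|].
    assert (0 < r ^ (n - 1)) by (apply pow_lt, Hr).
    apply (ex_derive_continuous (fun r => / r ^ (n - 1))). auto_derive. lra. }
  pose (y := fun r => sgnpow (p / (p - 1)) (Q (Rmax 0 r))).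
  assert (Cy : forall x, continuous y x).
  { intros x. apply (continuous_comp (fun r => Q (Rmax 0 r)) (sgnpow (p / (p - 1)))); [apply CQ|].
    apply sgnpow_continuous, Hp'. }
  pose (u := fun r => d + - RInt y 0 r).
  assert (Du : forall r, is_derive u r (- y r)).
  { intros r. unfold u. rewrite <- (Rplus_0_l (- y r)).
    apply (is_derive_plus (fun _ => d) (fun r => - RInt y 0 r)).
    - apply (is_derive_const (V := R_NormedModule)).
    - apply (is_derive_opp (fun r => RInt y 0 r)). apply is_derive_primitive, Cy. }
  assert (Cu : forall r, continuous u r) by (intros r; apply (ex_derive_continuous u); eexists; apply Du).
  assert (u0 : u 0 = d).
  { unfold u. rewrite (RInt_point (V := R_CompleteNormedModule)).
    change (d + - 0 = d). ring. }
  exists u, w. split; [exact Cu|].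
  split; [exact u0|split; [|split; [exact Lw|]]].
  - rewrite <- u0. apply lim0_continuous, Cu.
  - intros r Hr. split; [|apply Dw].
    replace (w r / r ^ (n - 1)) with (Q (Rmax 0 r)) by (rewrite Rmax_right by lra; reflexivity).
    apply Du.
Qed.

(** The implication stands under the existential so that choice yields a step defined on every [v],
    continuous or not. *)
Lemma truncated_step_ex (d D : R) (v : R -> R) :
  exists u, (forall x, continuous v x) -> (forall x, continuous u x) /\
    exists w, sysol n p (fun r => K r * tpow q D (v r)) d u w.
Proof.
  destruct (classic (forall x, continuous v x)) as [Hv|Hv]; [|exists v; tauto].
  destruct (volterra_solution d (fun r => K (Rmax 0 r) * tpow q D (v r))) as [u [w [Hu S]]].
  - intros x. apply (continuous_mult (fun r => K (Rmax 0 r)) (fun r => tpow q D (v r))).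
    + apply continuous_extend; [apply HK|]. intros r Hr. apply (weight_continuous K K' HK r Hr).
    + apply (continuous_comp v (tpow q D)); [apply Hv|apply tpow_continuous, Hq].
  - exists u. intros _. split; [exact Hu|]. exists w. revert S.
    apply sysol_ext. intros r Hr. rewrite Rmax_right by lra. reflexivity.
Qed.

Definition truncated_step (d D : R) (v : R -> R) : R -> R :=
  proj1_sig (constructive_indefinite_description _ (truncated_step_ex d D v)).

Lemma truncated_step_spec (d D : R) (v : R -> R) : (forall x, continuous v x) ->
  (forall x, continuous (truncated_step d D v) x) /\
  exists w, sysol n p (fun r => K r * tpow q D (v r)) d (truncated_step d D v) w.
Proof.
  unfold truncated_step. destruct (constructive_indefinite_description _ _) as [u Hu]. exact Hu.
Qed.

Fixpoint picard (d D : R) (k : nat) : R -> R :=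
  match k with
  | O => fun _ => d
  | S k => truncated_step d D (picard d D k)
  end.

Lemma picard_continuous (d D : R) (k : nat) (x : R) : continuous (picard d D k) x.
Proof.
  revert x. induction k as [|k IH]; intros x; simpl.
  - apply continuous_const.
  - apply truncated_step_spec, IH.
Qed.

(** Returns the contraction estimate together with the rate because [exists_sysol] combines the two
    and requires the same [c] in both. *)
Lemma picard_rate (d D M : R) : 0 < M -> 0 < D -> exists c m, 0 < c /\ 0 < m /\
  (forall d1 d2 v1 v2 u1 w1 u2 w2 m, 0 <= m ->
    sysol n p (fun r => K r * tpow q D (v1 r)) d1 u1 w1 ->
    sysol n p (fun r => K r * tpow q D (v2 r)) d2 u2 w2 ->
    (forall r, 0 < r <= M -> Rabs (v1 r - v2 r) <= m * exp (c * r)) ->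
    forall r, 0 < r <= M -> Rabs (u1 r - u2 r) <= Rabs (d1 - d2) + m / 2 * exp (c * r)) /\
  forall k r, 0 <= r <= M ->
    Rabs (picard d D (S k) r - picard d D k r) <= m * exp (c * r) * (/ 2) ^ k.
Proof.
  intros HM HD. destruct (truncated_contraction n p q K K' Hp Hp2 Hq HK M D HM HD) as [c [Hc H]].
  destruct (continuous_bounded (fun r => picard d D 1 r - picard d D 0 r) 0 M) as [m [Hm HB]]; [lra| |].
  { intros x _. apply (continuous_minus (picard d D 1) (picard d D 0)); apply picard_continuous. }
  exists c, m. split; [exact Hc|split; [exact Hm|split]].
  - intros d1 d2 v1 v2 u1 w1 u2 w2 m0. apply H.
  - assert (Hk : forall k r, 0 < r <= M ->
      Rabs (picard d D (S k) r - picard d D k r) <= m * (/ 2) ^ k * exp (c * r)).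
    { intros k. induction k as [|k IH]; intros r Hr.
      - assert (1 <= exp (c * r)) by (rewrite <- exp_0; apply Rlt_le, exp_increasing; nra).
        eapply Rle_trans; [apply HB; lra|]. simpl. nra.
      - destruct (truncated_step_spec d D (picard d D (S k)) (picard_continuous d D (S k))) as [_ [w1 S1]].
        destruct (truncated_step_spec d D (picard d D k) (picard_continuous d D k)) as [_ [w2 S2]].
        assert (0 < (/ 2) ^ k) by (apply pow_lt; lra).
        pose proof (H (m * (/ 2) ^ k) d d _ _ _ w1 _ w2 ltac:(nra) S1 S2 IH r Hr) as E.
        rewrite Rminus_diag, Rabs_R0 in E.
        replace (m * (/ 2) ^ S k * exp (c * r)) with (0 + m * (/ 2) ^ k / 2 * exp (c * r)) by (simpl; field).
        exact E. }
    intros k r [[Hr0|<-] Hr].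
    + replace (m * exp (c * r) * (/ 2) ^ k) with (m * (/ 2) ^ k * exp (c * r)) by ring. apply Hk; lra.
    + assert (E0 : forall j, picard d D j 0 = d).
      { intros [|j]; [reflexivity|].
        destruct (truncated_step_spec d D (picard d D j) (picard_continuous d D j)) as [_ [w [S0 _]]]. exact S0. }
      rewrite !E0, Rminus_diag, Rabs_R0.
      pose proof (exp_pos (c * 0)). assert (0 < (/ 2) ^ k) by (apply pow_lt; lra).
      repeat apply Rmult_le_pos; lra.
Qed.

(* By [amplitude_bound], truncating the nonlinearity at level [d] is harmless. *)
Lemma exists_sysol (d : R) : 0 < d ->
  exists u w, sysol n p (fun r => K r * sgnpow q (u r)) d u w.
Proof.
  intros Hd.
  pose (U := fun r => real (Lim_seq (fun k => picard d d k (Rmax 0 r)))).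
  assert (HU : forall M, 0 < M -> exists C, 0 < C /\ forall k r, r <= M ->
    Rabs (U r - picard d d k (Rmax 0 r)) <= C * (/ 2) ^ k).
  { intros M HM. destruct (picard_rate d d M HM Hd) as [c [m [Hc [Hm [_ H]]]]].
    exists (2 * (m * exp (c * M))). pose proof (exp_pos (c * M)).
    split; [nra|]. intros k r Hr.
    apply (geometric_cauchy_limit (fun k => picard d d k (Rmax 0 r)) (m * exp (c * M))).
    intros j. eapply Rle_trans; [apply H; split; [apply Rmax_l|apply Rmax_lub; lra]|].
    assert (0 < (/ 2) ^ j) by (apply pow_lt; lra).
    apply Rmult_le_compat_r; [lra|]. apply Rmult_le_compat_l; [lra|].
    assert (Rmax 0 r <= M) by (apply Rmax_lub; lra).
    destruct (Req_dec (Rmax 0 r) M) as [->|]; [lra|]. apply Rlt_le, exp_increasing. nra. }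
  assert (CU : forall x, continuous U x).
  { intros x. destruct (HU (Rabs x + 1)) as [C [HC H]]; [pose proof (Rabs_pos x); lra|].
    apply (continuous_uniform_limit (fun k r => picard d d k (Rmax 0 r))).
    - intros k. apply continuous_extend; [apply lim0_continuous, picard_continuous|].
      intros r _. apply picard_continuous.
    - intros e He. assert (HeC : 0 < e / C) by (apply Rdiv_lt_0_compat; lra).
      destruct (pow_lt_1_zero (/ 2) ltac:(rewrite Rabs_pos_eq; lra) _ HeC) as [N HN].
      specialize (HN N (Nat.le_refl N)). rewrite Rabs_pos_eq in HN by (apply pow_le; lra).
      exists N. intros y Hy. eapply Rle_trans; [apply H|].
      + apply Rabs_def2 in Hy. pose proof (Rle_abs x). lra.
      + replace e with (C * (e / C)) by (field; lra). apply Rmult_le_compat_l; lra. }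
  (* No derivative is passed to the limit: [V], one more step applied to [U], solves its equation by
     construction, and the contraction shows that it agrees with [U] on [r > 0]. *)
  destruct (truncated_step_spec d d U CU) as [_ [w S]].
  set (V := truncated_step d d U) in *.
  assert (HV : forall r, 0 < r -> V r = U r).
  { intros r Hr. destruct (picard_rate d d r Hr Hd) as [c [m [Hc [Hm [H1 H2]]]]].
    apply Rminus_diag_uniq. destruct (Req_dec (V r - U r) 0) as [|Hne]; [assumption|exfalso].
    apply Rabs_no_R0 in Hne. pose proof (Rabs_pos (V r - U r)) as Hpos.
    assert (Rabs (V r - U r) <= 0); [|lra].
    apply (le_of_le_half_pow _ _ (2 * (m * exp (c * r)))). intros k. rewrite Rplus_0_l.
    assert (Hk : 0 < (/ 2) ^ k) by (apply pow_lt; lra).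
    assert (HUk : forall j x, 0 < x <= r -> Rabs (U x - picard d d j x) <= 2 * (m * exp (c * x)) * (/ 2) ^ j).
    { intros j x Hx. unfold U. rewrite Rmax_right by lra.
      apply (geometric_cauchy_limit (fun k => picard d d k x) (m * exp (c * x))).
      intros i. apply H2. lra. }
    destruct (truncated_step_spec d d (picard d d k) (picard_continuous d d k)) as [_ [w2 S2]].
    pose proof (H1 d d U (picard d d k) V w _ w2 (2 * m * (/ 2) ^ k) ltac:(nra) S S2) as E.
    specialize (E ltac:(intros x Hx; eapply Rle_trans; [apply HUk, Hx|lra]) r ltac:(lra)).
    rewrite Rminus_diag, Rabs_R0 in E.
    pose proof (HUk (Datatypes.S k) r ltac:(lra)) as E2. simpl in E2.
    change (truncated_step d d (picard d d k)) with (picard d d (Datatypes.S k)) in E. simpl in E.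
    replace (V r - U r) with ((V r - truncated_step d d (picard d d k) r)
      - (U r - truncated_step d d (picard d d k) r)) by ring.
    eapply Rle_trans; [apply Rabs_triang|]. rewrite Rabs_Ropp. lra. }
  assert (S' : sysol n p (fun r => K r * tpow q d (V r)) d V w).
  { revert S. apply sysol_ext. intros r Hr. rewrite HV by exact Hr. reflexivity. }
  exists V, w. revert S'. apply sysol_ext. intros r Hr. f_equal. apply tpow_id.
  apply (amplitude_bound n p K K' Hp Hp2 HK (tpow q d) d V w); auto.
  - intros s. apply tpow_continuous, Hq.
  - intros s. unfold tpow. rewrite clamp_opp, sgnpow_opp by exact Hd. reflexivity.
  - intros s Hs. unfold tpow. pose proof (clamp_pos d s Hd Hs).
    rewrite sgnpow_pos by assumption. apply Rpower_pos.
  - revert S. apply sysol_ext. intros x Hx. rewrite HV by exact Hx. reflexivity.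
  - lra.
Qed.

End Existence.

(** * The Pohozaev function and comparison with bubbles *)

Lemma is_derive_sgnpow_pos (m s : R) :
  0 < s -> is_derive (sgnpow m) s ((m - 1) * (sgnpow m s / s)).
Proof.
  intros Hs. rewrite sgnpow_pos, <- Rpower_minus_1 by exact Hs.
  apply (is_derive_ext_loc (fun x => Rpower x (m - 1))); [|apply is_derive_Rpower_id, Hs].
  exists (mkposreal s Hs). intros y Hy. change (Rabs (y - s) < s) in Hy.
  apply Rabs_def2 in Hy. rewrite sgnpow_pos; lra.
Qed.

Lemma is_derive_ln_comp (f : R -> R) (x l : R) :
  is_derive f x l -> 0 < f x -> is_derive (fun t => ln (f t)) x (l / f x).
Proof.
  intros Hf Hp. apply (is_derive_comp ln f); [|exact Hf].
  apply is_derive_Reals, derivable_pt_lim_ln, Hp.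
Qed.

Section Positive.

Context (n : nat) (p q : R) (K K' : R -> R).
Context (Hp : 1 < p < INR n).
Context (Hp2 : p <= 2).
Context (Hq : 2 <= q).
Context (Hqn : q = INR n * p / (INR n - p)).
Context (HK : weight K K').

(* [slope w = - u'], so that [r * (slope w r * w r)] below is [r ^ n |u'| ^ p]. *)
Definition slope (w : R -> R) (r : R) : R := sgnpow (p / (p - 1)) (w r / r ^ (n - 1)).

(** Obtained by testing the equation with [r u' + (n - p) / p * u], the generator of the scaling
    that preserves the critical problem with constant weight. *)
Definition pohozaev (u w : R -> R) (r : R) : R :=
  (p - 1) / p * (r * (slope w r * w r)) + r ^ n * (K r * (/ q * rpow (Rabs (u r)) q))
  - (INR n - p) / p * (u r * w r).

(** With [0 <= u Rad] the estimates apply both at a first zero and at any radius of a solution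
    supposed positive everywhere. *)
Context (d Rad : R) (u w : R -> R).
Context (Hd : 0 < d).
Context (HS : sysol n p (fun r => K r * sgnpow q (u r)) d u w).
Context (Hpos : forall r, 0 < r < Rad -> 0 < u r).
Context (HRad : 0 <= u Rad).

Let KP : forall r, 0 <= r -> 0 < K r := proj1 HK.
Let KM : forall r s, 0 <= r -> r <= s -> K r <= K s := proj1 (proj2 (proj2 HK)).
Let KD : forall r, 0 < r -> is_derive K r (K' r) /\ 0 <= K' r /\ continuous K' r := proj2 (proj2 (proj2 HK)).

Let u_nonneg : forall r, 0 < r <= Rad -> 0 <= u r.
Proof.
  intros r Hr. destruct (Req_dec r Rad) as [->|]; [exact HRad|]. apply Rlt_le, Hpos; lra.
Qed.

Lemma sgnpow_nonneg_of_nonneg (m s : R) : 0 <= s -> 0 <= sgnpow m s.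
Proof. intros H. unfold sgnpow. apply Rmult_le_pos; [exact H|apply rpow_nonneg]. Qed.

Lemma w_derive (r : R) : 0 < r -> is_derive w r (r ^ (n - 1) * (K r * sgnpow q (u r))).
Proof. intros Hr. destruct HS as [_ [_ [_ D]]]. apply D, Hr. Qed.

Lemma u_derive (r : R) : 0 < r -> is_derive u r (- slope w r).
Proof. intros Hr. destruct HS as [_ [_ [_ D]]]. apply D, Hr. Qed.

Lemma w_incr (r s : R) : 0 < r -> r <= s -> s <= Rad -> w r <= w s.
Proof.
  intros Hr Hrs Hs. apply (deriv_nonneg_le w (fun x => x ^ (n - 1) * (K x * sgnpow q (u x))) r s Hrs).
  - intros x Hx. apply w_derive; lra.
  - intros x Hx. apply Rmult_le_pos; [apply pow_le; lra|].
    apply Rmult_le_pos; [apply Rlt_le, KP; lra|]. apply sgnpow_nonneg_of_nonneg, u_nonneg; lra.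
Qed.

Lemma w_lower_gen (r a : R) : 0 < r <= Rad -> (forall s, 0 < s <= r -> a <= sgnpow q (u s)) -> 0 <= a ->
  K 0 * a * (r ^ n / INR n) <= w r.
Proof.
  intros Hr Ha Ha0. pose proof (dim_ge_2 n p Hp).
  assert (E : 0 - K 0 * a * (0 / INR n) <= w r - K 0 * a * (r ^ n / INR n)).
  { apply (deriv_nonneg_le0 (fun s => w s - K 0 * a * (s ^ n / INR n))
      (fun s => s ^ (n - 1) * (K s * sgnpow q (u s)) - K 0 * a * (s ^ (n - 1)))); [lra| | |].
    - apply lim0_minus; [apply HS|]. apply lim0_mult; [apply lim0_const|].
      apply lim0_mult; [|apply lim0_const].
      replace 0 with (0 ^ n) by (apply pow_i; lia). apply (lim0_continuous (fun s => s ^ n)).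
      apply (ex_derive_continuous (fun s => s ^ n)). auto_derive. exact I.
    - intros x Hx. apply (is_derive_minus w (fun s => K 0 * a * (s ^ n / INR n))); [apply w_derive; lra|].
      apply is_derive_scal.
      replace (x ^ (n - 1)) with (/ INR n * (INR n * (x ^ n / x))).
      2:{ rewrite (pow_split_pred n x) by lia. field. lra. }
      apply (is_derive_ext (fun s => / INR n * s ^ n)); [intros t; apply Rmult_comm|].
      apply is_derive_scal, is_derive_pow_div; lra.
    - intros x Hx. specialize (Ha x Hx). pose proof (KM 0 x ltac:(lra) ltac:(lra)). pose proof (KP 0 ltac:(lra)).
      assert (0 <= x ^ (n - 1)) by (apply pow_le; lra).
      replace (x ^ (n - 1) * (K x * sgnpow q (u x)) - K 0 * a * x ^ (n - 1)) with
        (x ^ (n - 1) * (K x * sgnpow q (u x) - K 0 * a)) by ring.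
      apply Rmult_le_pos; [lra|]. nra. }
  unfold Rdiv in E at 1. lra.
Qed.

Lemma w_pos (r : R) : 0 < r <= Rad -> 0 < w r.
Proof.
  (* Strict growth is used on [[r / 4, r / 2]] only, well inside [(0, Rad)], since [u] may vanish at
     [Rad]. *)
  intros Hr. apply Rlt_le_trans with (w (r / 2)); [|apply w_incr; lra].
  apply Rle_lt_trans with (w (r / 4)).
  - replace 0 with (K 0 * 0 * ((r / 4) ^ n / INR n)) by ring.
    apply w_lower_gen; [lra| |lra]. intros s Hs. apply sgnpow_nonneg_of_nonneg, u_nonneg; lra.
  - apply (deriv_pos_lt w (fun r => r ^ (n - 1) * (K r * sgnpow q (u r)))); [lra| |].
    + intros x Hx. apply w_derive; lra.
    + intros x Hx. apply Rmult_lt_0_compat; [apply pow_lt; lra|].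
      apply Rmult_lt_0_compat; [apply KP; lra|]. rewrite sgnpow_pos by (apply Hpos; lra). apply Rpower_pos.
Qed.

Lemma slope_eq (r : R) : 0 < r <= Rad -> slope w r = Rpower (w r / r ^ (n - 1)) (/ (p - 1)).
Proof.
  intros Hr. unfold slope. rewrite sgnpow_pos.
  - f_equal. field. lra.
  - apply Rdiv_lt_0_compat; [apply w_pos, Hr|apply pow_lt; lra].
Qed.

Lemma slope_pos (r : R) : 0 < r <= Rad -> 0 < slope w r.
Proof. intros Hr. rewrite slope_eq by exact Hr. apply Rpower_pos. Qed.

Lemma u_decr (r s : R) : 0 < r -> r < s -> s <= Rad -> u s < u r.
Proof.
  intros Hr Hrs Hs. apply Ropp_lt_cancel.
  apply (deriv_pos_lt (fun x => - u x) (slope w)); [lra| |].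
  - intros x Hx. rewrite <- (Ropp_involutive (slope w x)).
    apply (is_derive_opp u), u_derive; lra.
  - intros x Hx. apply slope_pos; lra.
Qed.

Lemma w_lower (r : R) : 0 < r <= Rad -> 0 < u r ->
  K 0 * Rpower (u r) (q - 1) * (r ^ n / INR n) <= w r.
Proof.
  intros Hr Hu. apply w_lower_gen; [exact Hr| |apply Rlt_le, Rpower_pos].
  intros s Hs. assert (u r <= u s).
  { destruct (Req_dec s r) as [->|]; [lra|]. apply Rlt_le, u_decr; lra. }
  rewrite sgnpow_pos by lra. apply Rle_Rpower_l; lra.
Qed.

Lemma slope_derive (r : R) : 0 < r <= Rad ->
  is_derive (slope w) r (/ (p - 1) * slope w r *
    (r ^ (n - 1) * (K r * sgnpow q (u r)) / w r - (INR n - 1) / r)).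
Proof.
  intros Hr. pose proof (w_pos r Hr) as Hw.
  assert (Hrn : 0 < r ^ (n - 1)) by (apply pow_lt; lra).
  unfold slope.
  replace (/ (p - 1) * sgnpow (p / (p - 1)) (w r / r ^ (n - 1)) *
    (r ^ (n - 1) * (K r * sgnpow q (u r)) / w r - (INR n - 1) / r)) with
    ((r ^ (n - 1) * (K r * sgnpow q (u r)) * r ^ (n - 1) - w r * (INR (n - 1) * (r ^ (n - 1) / r)))
       / (r ^ (n - 1)) ^ 2 *
     ((p / (p - 1) - 1) * (sgnpow (p / (p - 1)) (w r / r ^ (n - 1)) / (w r / r ^ (n - 1))))).
  - apply (is_derive_comp (sgnpow (p / (p - 1))) (fun r => w r / r ^ (n - 1))).
    + apply is_derive_sgnpow_pos, Rdiv_lt_0_compat; lra.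
    + apply is_derive_div; [apply w_derive; lra|apply is_derive_pow_div; lra|lra].
  - rewrite (INR_dim_pred n p Hp). field. lra.
Qed.

(** The terms in [y * w] and in [y * ph] cancel for every [q]; the terms in [K * u * ph] cancel
    because [n / q = (n - p) / p], which is the criticality of [q]. *)
Lemma pohozaev_derive (r : R) : 0 < r <= Rad ->
  is_derive (pohozaev u w) r (r ^ n * (K' r * (/ q * rpow (Rabs (u r)) q))).
Proof.
  intros Hr. pose proof (w_pos r Hr) as Hw. pose proof (dim_ge_2 n p Hp) as Hn.
  assert (Hrn : 0 < r ^ (n - 1)) by (apply pow_lt; lra).
  set (y := slope w r). set (ph := sgnpow q (u r)). set (rho := r ^ (n - 1)) in *.
  assert (Hph : rpow (Rabs (u r)) q = u r * ph) by (symmetry; apply sgnpow_mult_self).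
  assert (Hrr : r ^ n = r * rho) by (apply pow_split_pred; lia).
  assert (D1 : is_derive (fun r => r * (slope w r * w r)) r
    (1 * (y * w r) + r * (/ (p - 1) * y * (rho * (K r * ph) / w r - (INR n - 1) / r) * w r + y * (rho * (K r * ph))))).
  { apply (is_derive_mult (fun r => r) (fun r => slope w r * w r)); [apply (is_derive_id r)| |exact Rmult_comm].
    apply (is_derive_mult (slope w) w); [apply slope_derive, Hr|apply w_derive; lra|exact Rmult_comm]. }
  assert (D2 : is_derive (fun r => r ^ n * (K r * (/ q * rpow (Rabs (u r)) q))) r
    (INR n * (r ^ n / r) * (K r * (/ q * rpow (Rabs (u r)) q)) +
     r ^ n * (K' r * (/ q * rpow (Rabs (u r)) q) + K r * (/ q * (- y * (q * ph)))))).
  { apply (is_derive_mult (fun r => r ^ n) (fun r => K r * (/ q * rpow (Rabs (u r)) q)));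
      [apply is_derive_pow_div; lra| |exact Rmult_comm].
    apply (is_derive_mult K (fun r => / q * rpow (Rabs (u r)) q)); [apply KD; lra| |exact Rmult_comm].
    apply is_derive_scal. apply (is_derive_comp (fun s => rpow (Rabs s) q) u).
    - apply is_derive_rpow_abs. lra.
    - apply u_derive; lra. }
  assert (D3 : is_derive (fun r => u r * w r) r (- y * w r + u r * (rho * (K r * ph)))).
  { apply (is_derive_mult u w); [apply u_derive; lra|apply w_derive; lra|exact Rmult_comm]. }
  pose proof (is_derive_minus _ _ _ _ _ (is_derive_plus _ _ _ _ _ (is_derive_scal _ _ ((p - 1) / p) _ D1) D2)
    (is_derive_scal _ _ ((INR n - p) / p) _ D3)) as D.
  unfold pohozaev. evar_last; [exact D|].
  unfold minus, plus, opp; simpl. rewrite Hph, Hrr, Hqn. field.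
  repeat split; try lra; apply Rgt_not_eq; nra.
Qed.

Lemma pohozaev_lim0 : lim0 (pohozaev u w) 0.
Proof.
  destruct HS as [_ [Hu [Hw D]]]. pose proof (dim_ge_2 n p Hp) as Hn.
  pose proof (conj_exp_ge_2 n p Hp Hp2) as Hp'.
  pose proof (proj1 (proj2 HK)) as K0.
  assert (HQ : lim0 (slope w) 0).
  { rewrite <- (sgnpow_0 (p / (p - 1))).
    apply (lim0_comp (fun r => w r / r ^ (n - 1)) (sgnpow (p / (p - 1)))); [|apply sgnpow_continuous, Hp'].
    apply (cumulative_slope_lim0 n (fun r => K r * sgnpow q (u r)) w (K 0 * sgnpow q d) Hw).
    - intros y Hy. apply D, Hy.
    - apply lim0_mult; [exact K0|]. apply lim0_comp; [exact Hu|apply sgnpow_continuous, Hq]. }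
  unfold pohozaev.
  replace 0 with ((p - 1) / p * (0 * (0 * 0)) + 0 * (K 0 * (/ q * rpow (Rabs d) q)) - (INR n - p) / p * (d * 0)) by ring.
  apply lim0_minus; [apply lim0_plus|].
  1: apply lim0_mult; [apply lim0_const|apply lim0_mult; [apply lim0_id|apply lim0_mult; assumption]].
  2: apply lim0_mult; [apply lim0_const|apply lim0_mult; assumption].
  apply lim0_mult; [|apply lim0_mult; [exact K0|apply lim0_mult; [apply lim0_const|]]].
  - replace 0 with (0 ^ n) by (apply pow_i; lia). apply (lim0_continuous (fun s => s ^ n)).
    apply (ex_derive_continuous (fun s => s ^ n)). auto_derive. exact I.
  - apply (lim0_comp u (fun s => rpow (Rabs s) q)); [exact Hu|].
    apply (ex_derive_continuous (fun s => rpow (Rabs s) q)). eexists. apply is_derive_rpow_abs. lra.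
Qed.

Lemma pohozaev_incr (r s : R) : 0 < r -> r <= s -> s <= Rad -> pohozaev u w r <= pohozaev u w s.
Proof.
  intros Hr Hrs Hs. apply (deriv_nonneg_le (pohozaev u w) (fun r => r ^ n * (K' r * (/ q * rpow (Rabs (u r)) q))) r s Hrs).
  - intros x Hx. apply pohozaev_derive; lra.
  - intros x Hx. apply Rmult_le_pos; [apply pow_le; lra|].
    apply Rmult_le_pos; [apply KD; lra|]. apply Rmult_le_pos; [apply Rlt_le, Rinv_0_lt_compat; lra|apply rpow_nonneg].
Qed.

Lemma pohozaev_nonneg (r : R) : 0 < r <= Rad -> 0 <= pohozaev u w r.
Proof.
  intros Hr. apply (deriv_nonneg_le0 (pohozaev u w) (fun r => r ^ n * (K' r * (/ q * rpow (Rabs (u r)) q))));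
    [lra|apply pohozaev_lim0| |].
  - intros x Hx. apply pohozaev_derive; lra.
  - intros x Hx. apply Rmult_le_pos; [apply pow_le; lra|].
    apply Rmult_le_pos; [apply KD; lra|]. apply Rmult_le_pos; [apply Rlt_le, Rinv_0_lt_compat; lra|apply rpow_nonneg].
Qed.

(* Up to an additive constant, the right-hand side is the logarithm of
   [(r ^ (- 1 / (p - 1)) (u ^ (- p / (n - p)))') ^ (p - 1)], which is constant
   for the bubbles of a constant weight; its derivative is
   [q * pohozaev / (r u w)], and its limit at 0 is bounded below by [w_lower]. *)
Lemma log_flux_lower (r : R) : 0 < r < Rad ->
  ln (K 0 / INR n) + p / (INR n - p) * ln d
  <= ln (w r) - INR n * ln r - INR n * (p - 1) / (INR n - p) * ln (u r).
Proof.
  intros Hr. pose proof (KP 0 ltac:(lra)) as HK0. pose proof (dim_ge_2 n p Hp) as Hn.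
  set (c := INR n * (p - 1) / (INR n - p)).
  assert (Hu0 : lim0 u d) by apply HS.
  apply (lim0_le (fun s => ln (K 0 / INR n) + p / (INR n - p) * ln (u s))
    (fun _ => ln (w r) - INR n * ln r - c * ln (u r)) _ _ r); [lra| | |apply lim0_const].
  - intros s Hs.
    (* At a point [s] near 0, [w_lower] bounds the quantity below in terms of [u s]; monotonicity
       carries this to [r], and then [s] tends to 0. *)
    apply Rle_trans with (ln (w s) - INR n * ln s - c * ln (u s)).
    + assert (Hsn : 0 < s ^ n) by (apply pow_lt; lra). pose proof (Hpos s ltac:(lra)) as Hus.
      pose proof (w_lower s ltac:(lra) Hus) as Hlow.
      pose proof (Rpower_pos (u s) (q - 1)) as HRp.
      assert (E : ln (K 0 * Rpower (u s) (q - 1) * (s ^ n / INR n)) <= ln (w s)).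
      { apply ln_le; [|exact Hlow]. repeat apply Rmult_lt_0_compat; try lra. apply Rinv_0_lt_compat; lra. }
      replace (K 0 * Rpower (u s) (q - 1) * (s ^ n / INR n)) with
        (K 0 / INR n * (Rpower (u s) (q - 1) * Rpower s (INR n))) in E.
      2:{ rewrite Rpower_pow by lra. field. lra. }
      assert (0 < K 0 / INR n) by (apply Rdiv_lt_0_compat; lra).
      rewrite ln_mult, ln_mult, !ln_Rpower in E; try apply Rpower_pos; try assumption.
      2:{ apply Rmult_lt_0_compat; apply Rpower_pos. }
      replace (p / (INR n - p)) with (q - 1 - c); [lra|].
      unfold c. rewrite Hqn. field. lra.
    + apply (deriv_nonneg_le (fun s => ln (w s) - INR n * ln s - c * ln (u s))
        (fun s => s ^ (n - 1) * (K s * sgnpow q (u s)) / w s - INR n * (1 / s) - c * (- slope w s / u s))); [lra| |].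
      * intros x Hx.
        apply (is_derive_minus (fun s => ln (w s) - INR n * ln s) (fun s => c * ln (u s))).
        -- apply (is_derive_minus (fun s => ln (w s)) (fun s => INR n * ln s)).
           ++ apply is_derive_ln_comp; [apply w_derive; lra|apply w_pos; lra].
           ++ apply is_derive_scal. apply (is_derive_ln_comp (fun x => x)); [apply (is_derive_id x)|lra].
        -- apply is_derive_scal. apply is_derive_ln_comp; [apply u_derive; lra|apply Hpos; lra].
      * intros x Hx. pose proof (Hpos x ltac:(lra)) as Hux. pose proof (w_pos x ltac:(lra)) as Hwx.
        pose proof (pohozaev_nonneg x ltac:(lra)) as HP. unfold pohozaev in HP.
        rewrite <- sgnpow_mult_self, (pow_split_pred n x) in HP by lia.
        replace (x ^ (n - 1) * (K x * sgnpow q (u x)) / w x - INR n * (1 / x) - c * (- slope w x / u x))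
          with (q * ((p - 1) / p * (x * (slope w x * w x)) +
            x * x ^ (n - 1) * (K x * (/ q * (u x * sgnpow q (u x)))) - (INR n - p) / p * (u x * w x))
            * / (x * (u x * w x))).
        2:{ unfold c. rewrite Hqn. field. repeat split; try lra; apply Rgt_not_eq; nra. }
        apply Rmult_le_pos; [nra|]. apply Rlt_le, Rinv_0_lt_compat. repeat apply Rmult_lt_0_compat; lra.
  - apply lim0_plus; [apply lim0_const|]. apply lim0_mult; [apply lim0_const|].
    apply (lim0_comp u ln); [exact Hu0|]. apply (ex_derive_continuous ln).
    exists (/ d). apply is_derive_Reals, derivable_pt_lim_ln, Hd.
Qed.

(** Exponentiating [log_flux_lower] gives [(u^(-a))' >= a C0 r^b] with [a = p/(n-p)] and
    [b = 1/(p-1)]. Integrating from 0 gives [u^(-a) >= a C0 r^(b+1) / (b+1)], and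
    [(b+1)/a = (n-p)/(p-1)] is the decay exponent. *)
Lemma bubble_bound (r : R) : 0 < r < Rad ->
  ln (u r) <= - ((INR n - p) / p) * (ln (p / (INR n - p) * / (p / (p - 1))) + / (p - 1) * ln (K 0 / INR n))
    - / (p - 1) * ln d - (INR n - p) / (p - 1) * ln r.
Proof.
  intros Hr. set (a := p / (INR n - p)). set (b := / (p - 1)).
  assert (Ha : 0 < a) by (apply Rdiv_lt_0_compat; lra).
  assert (Hb : 0 < b) by (apply Rinv_0_lt_compat; lra).
  assert (Hb1 : p / (p - 1) = b + 1) by (unfold b; field; lra).
  set (C0 := exp (b * (ln (K 0 / INR n) + a * ln d))).
  assert (HC0 : 0 < C0) by apply exp_pos.
  assert (E : Rpower d (- a) - a * C0 / (b + 1) * 0 <= Rpower (u r) (- a) - a * C0 / (b + 1) * Rpower r (b + 1)).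
  { apply (deriv_nonneg_le0 (fun x => Rpower (u x) (- a) - a * C0 / (b + 1) * Rpower x (b + 1))
      (fun x => - a * (- slope w x / u x) * Rpower (u x) (- a) - a * C0 / (b + 1) * ((b + 1) * Rpower x (b + 1 - 1))));
      [lra| | |].
    - apply lim0_minus.
      + apply (lim0_comp u (fun s => Rpower s (- a))); [apply HS|].
        apply (ex_derive_continuous (fun s => Rpower s (- a))). eexists. apply is_derive_Rpower_id, Hd.
      + apply lim0_mult; [apply lim0_const|]. apply lim0_Rpower. lra.
    - intros x Hx. apply (is_derive_minus (fun x => Rpower (u x) (- a)) (fun x => a * C0 / (b + 1) * Rpower x (b + 1))).
      + apply is_derive_Rpower; [apply u_derive; lra|apply Hpos; lra].
      + apply is_derive_scal, is_derive_Rpower_id; lra.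
    - intros x Hx. pose proof (Hpos x ltac:(lra)) as Hux. pose proof (w_pos x ltac:(lra)) as Hwx.
      assert (Hxn : 0 < x ^ (n - 1)) by (apply pow_lt; lra).
      replace (b + 1 - 1) with b by ring.
      replace (- a * (- slope w x / u x) * Rpower (u x) (- a) - a * C0 / (b + 1) * ((b + 1) * Rpower x b))
        with (a * (slope w x * (Rpower (u x) (- a) / u x) - C0 * Rpower x b)) by (field; lra).
      apply Rmult_le_pos; [lra|]. apply -> Rminus_le_0.
      rewrite slope_eq, <- Rpower_minus_1 by lra. unfold C0, Rpower. rewrite <- !exp_plus.
      fold b.
      assert (HL : ln (w x / x ^ (n - 1)) = ln (w x) - (INR n - 1) * ln x).
      { rewrite ln_div by lra. rewrite <- Rpower_pow, ln_Rpower, (INR_dim_pred n p Hp) by lra. reflexivity. }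
      rewrite HL. pose proof (log_flux_lower x ltac:(lra)) as HF. fold a in HF.
      assert (Hmain : b * (ln (K 0 / INR n) + a * ln d) + b * ln x
        <= b * (ln (w x) - (INR n - 1) * ln x) + (- a - 1) * ln (u x)).
      { replace ((- a - 1) * ln (u x)) with (- b * (INR n * (p - 1) / (INR n - p) * ln (u x)))
          by (unfold a, b; field; lra). nra. }
      destruct (Req_dec (b * (ln (K 0 / INR n) + a * ln d) + b * ln x)
        (b * (ln (w x) - (INR n - 1) * ln x) + (- a - 1) * ln (u x))) as [->|Hne]; [lra|].
      apply Rlt_le, exp_increasing. lra. }
  (* The term [d^(-a)] is dropped; it matters only inside the concentration scale, where [u <= d] is
     used instead. *)
  pose proof (Rpower_pos d (- a)) as Hda.
  assert (E2 : a * / (b + 1) * (C0 * Rpower r (b + 1)) <= Rpower (u r) (- a)) by (unfold Rdiv in E; lra).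
  assert (H1 : 0 < a * / (b + 1)) by (apply Rdiv_lt_0_compat; lra).
  pose proof (Rpower_pos r (b + 1)) as H2.
  apply ln_le in E2; [|apply Rmult_lt_0_compat; [exact H1|apply Rmult_lt_0_compat; assumption]].
  rewrite (ln_mult _ (C0 * _)), (ln_mult C0), !ln_Rpower in E2; try assumption; [|apply Rmult_lt_0_compat; assumption].
  unfold C0 in E2. rewrite ln_exp in E2. rewrite Hb1.
  assert (E3 : (INR n - p) / p * (ln (a * / (b + 1)) + (b * (ln (K 0 / INR n) + a * ln d) + (b + 1) * ln r))
     <= (INR n - p) / p * (- a * ln (u r))).
  { apply Rmult_le_compat_l; [|exact E2]. apply Rlt_le, Rdiv_lt_0_compat; lra. }
  replace ((INR n - p) / p * (- a * ln (u r))) with (- ln (u r)) in E3 by (unfold a; field; lra).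
  replace ((INR n - p) / (p - 1)) with ((INR n - p) / p * (b + 1)) by (unfold b; field; lra).
  assert ((INR n - p) / p * (b * (a * ln d)) = b * ln d) by (unfold a; field; lra).
  lra.
Qed.

End Positive.

(** * Existence and location of the first zero *)

Lemma exp_le (x y : R) : x <= y -> exp x <= exp y.
Proof. intros [H| ->]; [apply Rlt_le, exp_increasing, H|lra]. Qed.

Section Zeros.

Context (n : nat) (p q : R) (K K' : R -> R).
Context (Hp : 1 < p < INR n).
Context (Hp2 : p <= 2).
Context (Hq : 2 <= q).
Context (Hqn : q = INR n * p / (INR n - p)).
Context (HK : weight K K').

Lemma sysol_amplitude (d : R) (u w : R -> R) : 0 < d ->
  sysol n p (fun r => K r * sgnpow q (u r)) d u w -> forall r, 0 <= r -> Rabs (u r) <= d.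
Proof.
  intros Hd S. apply (amplitude_bound n p K K' Hp Hp2 HK (sgnpow q) d u w); auto.
  - intros s. apply sgnpow_continuous, Hq.
  - apply sgnpow_opp.
  - intros s Hs. rewrite sgnpow_pos by exact Hs. apply Rpower_pos.
Qed.

(** If [u] stayed positive, [w] would be bounded and [u] would tend to 0, so the slope part of the
    Pohozaev function would vanish in the limit. Its positive lower bound then forces [r u w'] to
    stay above a positive constant, and with [u] small [w] would grow over [[r, 2 r]] by more than
    its bound. *)
Lemma exists_zero (d : R) (u w : R -> R) : 0 < d ->
  sysol n p (fun r => K r * sgnpow q (u r)) d u w ->
  (exists a b, 0 <= a < b /\ forall r s, a < r -> r < s -> s < b -> K r < K s) ->
  ~ (forall r, 0 < r -> 0 < u r).
Proof.
  intros Hd S [a [b [Hab Hs]]] Hpos.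
  pose proof HK as [KP [_ [KM KD]]].
  pose proof (dim_ge_2 n p Hp) as Hn.
  assert (Hw : forall r, 0 < r -> 0 < w r).
  { intros r Hr. apply (w_pos n p q K K' Hp HK d r u w S); try lra.
    - intros x Hx. apply Hpos; lra.
    - apply Rlt_le, Hpos, Hr. }
  assert (Hwi : forall r s, 0 < r -> r <= s -> w r <= w s).
  { intros r s Hr Hrs. apply (w_incr n p q K K' HK d s u w S); try lra.
    - intros x Hx. apply Hpos; lra.
    - apply Rlt_le, Hpos; lra. }
  assert (Hud : forall r s, 0 < r -> r <= s -> u s <= u r).
  { intros r s Hr [Hrs| ->]; [|lra]. apply Rlt_le.
    apply (u_decr n p q K K' Hp HK d s u w S); try lra.
    - intros x Hx. apply Hpos; lra.
    - apply Rlt_le, Hpos; lra. }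
  assert (HP : forall r, 0 < r -> is_derive (pohozaev n p q K u w) r (r ^ n * (K' r * (/ q * rpow (Rabs (u r)) q)))).
  { intros r Hr. apply (pohozaev_derive n p q K K' Hp Hq Hqn HK d r u w S); try lra.
    - intros x Hx. apply Hpos; lra.
    - apply Rlt_le, Hpos; lra. }
  assert (HPi : forall r s, 0 < r -> r <= s -> pohozaev n p q K u w r <= pohozaev n p q K u w s).
  { intros r s Hr Hrs. apply (pohozaev_incr n p q K K' Hp Hq Hqn HK d s u w S); try lra.
    - intros x Hx. apply Hpos; lra.
    - apply Rlt_le, Hpos; lra. }
  assert (HP0 : forall r, 0 < r -> 0 <= pohozaev n p q K u w r).
  { intros r Hr. apply (pohozaev_nonneg n p q K K' Hp Hp2 Hq Hqn HK d r u w S); try lra.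
    - intros x Hx. apply Hpos; lra.
    - apply Rlt_le, Hpos; lra. }
  (* The middle third of [(a, b)] keeps the mean value theorem away from 0 when [a = 0]. *)
  assert (Hxi : exists xi, 0 < xi /\ 0 < K' xi).
  { destruct (mvt K K' (a + (b - a) / 3) (a + 2 * (b - a) / 3)) as [c [Hc E]]; [lra| |].
    - intros x Hx. apply KD; lra.
    - specialize (Hs (a + (b - a) / 3) (a + 2 * (b - a) / 3) ltac:(lra) ltac:(lra) ltac:(lra)).
      exists c. split; [lra|].
      replace (a + 2 * (b - a) / 3 - (a + (b - a) / 3)) with ((b - a) / 3) in E by lra.
      destruct (Rle_or_lt (K' c) 0); [nra|assumption]. }
  destruct Hxi as [xi [Hxi HKxi]].
  set (del := pohozaev n p q K u w (xi + 1)).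
  assert (Hdel : 0 < del).
  (* Being nonnegative and nondecreasing, the Pohozaev function would vanish on [(0, xi + 1]],
     against its positive derivative at [xi]. *)
  { destruct (Rle_or_lt del 0) as [Hle|]; [exfalso|assumption].
    assert (Hz : forall r, 0 < r <= xi + 1 -> pohozaev n p q K u w r = 0).
    { intros r Hr. apply Rle_antisym; [|apply HP0; lra].
      apply Rle_trans with del; [apply HPi; lra|exact Hle]. }
    assert (D0 : is_derive (pohozaev n p q K u w) xi 0).
    { apply (is_derive_ext_loc (fun _ => 0)); [|apply (is_derive_const (V := R_NormedModule))].
      assert (Hm : 0 < Rmin xi 1) by (apply Rmin_pos; lra).
      exists (mkposreal _ Hm). intros y Hy. change (Rabs (y - xi) < Rmin xi 1) in Hy.
      pose proof (Rmin_l xi 1). pose proof (Rmin_r xi 1). apply Rabs_def2 in Hy.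
      symmetry. apply Hz. lra. }
    pose proof (HP xi Hxi) as D1. apply is_derive_unique in D0. apply is_derive_unique in D1.
    rewrite D0 in D1. pose proof (Hpos xi Hxi).
    rewrite Rabs_pos_eq, rpow_pos in D1 by lra. pose proof (Rpower_pos (u xi) q).
    assert (0 < xi ^ n * (K' xi * (/ q * Rpower (u xi) q))); [|lra].
    repeat apply Rmult_lt_0_compat; try lra; [apply pow_lt; lra|apply Rinv_0_lt_compat; lra]. }
  set (ls := (INR n - p) / (p - 1)).
  assert (Hls : 0 < ls) by (apply Rdiv_lt_0_compat; lra).
  set (be := / (p - 1)).
  assert (Hbe : 0 < be) by (apply Rinv_0_lt_compat; lra).
  assert (Hbub : exists C, 0 < C /\ forall r, 0 < r -> u r <= C * Rpower r (- ls)).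
  { eexists (exp _). split; [apply exp_pos|]. intros r Hr.
    rewrite <- (exp_ln (u r)) by (apply Hpos, Hr). unfold Rpower. rewrite <- exp_plus. apply exp_le.
    eapply Rle_trans.
    - apply (bubble_bound n p q K K' Hp Hp2 Hq Hqn HK d (r + 1) u w Hd S); [|apply Rlt_le, Hpos; lra|lra].
      intros x Hx. apply Hpos; lra.
    - fold ls. match goal with |- ?A - ls * ln r <= _ => apply Req_le; instantiate (1 := A) end. ring. }
  destruct Hbub as [C [HC Hbub]].
  set (ka := Rpower (/ 2 ^ (n - 1)) be).
  assert (Hka : 0 < ka) by apply Rpower_pos.
  assert (Hsl : forall r, 0 < r -> slope n p w r = Rpower (w r / r ^ (n - 1)) be).
  { intros r Hr. apply (slope_eq n p q K K' Hp HK d r u w S); try lra.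
    - intros x Hx. apply Hpos; lra.
    - apply Rlt_le, Hpos; lra. }
  (* On [[r, 2 r]] the flux does not decrease and [x ^ (n - 1)] grows by at most [2 ^ (n - 1)], so
     the slope keeps a fraction [ka]; as [u (2 r) > 0], the resulting drop is at most [u r]. *)
  assert (Hdrop : forall r, 0 < r -> r * slope n p w r * ka <= u r).
  { intros r Hr. destruct (mvt u (fun x => - slope n p w x) r (2 * r)) as [c [Hc E]]; [lra| |].
    - intros x Hx. apply (u_derive n p q K d u w S). lra.
    - pose proof (Hpos (2 * r) ltac:(lra)).
      assert (Hle : slope n p w r * ka <= slope n p w c); [|nra].
      rewrite !Hsl by lra. unfold ka.
      assert (Hrn : 0 < r ^ (n - 1)) by (apply pow_lt; lra). assert (0 < c ^ (n - 1)) by (apply pow_lt; lra).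
      assert (0 < 2 ^ (n - 1)) by (apply pow_lt; lra). pose proof (Hw r Hr).
      rewrite Rpower_mult_distr; [|apply Rdiv_lt_0_compat; lra|apply Rinv_0_lt_compat; lra].
      apply Rle_Rpower_l; [lra|]. split.
      + apply Rmult_lt_0_compat; [apply Rdiv_lt_0_compat; lra|apply Rinv_0_lt_compat; lra].
      + replace (w r / r ^ (n - 1) * / 2 ^ (n - 1)) with (w r / (2 * r) ^ (n - 1)) by (rewrite Rpow_mult_distr; field; lra).
        apply Rmult_le_compat; [lra|apply Rlt_le, Rinv_0_lt_compat, pow_lt; lra|apply Hwi; lra|].
        apply Rinv_le_contravar; [assumption|]. apply pow_incr. lra. }
  set (W := exp ((p - 1) * (ln C - ln ka))).
  (* [Hdrop] against the bubble bound: the powers of [r] cancel because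
     [1 - (n - 1)/(p - 1) = - ls]. *)
  assert (HW : forall r, 0 < r -> w r <= W).
  { intros r Hr. pose proof (Hw r Hr). assert (Hrn : 0 < r ^ (n - 1)) by (apply pow_lt; lra).
    pose proof (Hdrop r Hr) as E1. pose proof (Hbub r Hr) as E2.
    assert (E : r * slope n p w r * ka <= C * Rpower r (- ls)) by lra.
    rewrite Hsl in E by exact Hr.
    pose proof (Rpower_pos (w r / r ^ (n - 1)) be). pose proof (Rpower_pos r (- ls)).
    apply ln_le in E; [|repeat apply Rmult_lt_0_compat; assumption].
    rewrite (ln_mult (r * _)), (ln_mult r), (ln_mult C), !ln_Rpower in E; try assumption;
      [|apply Rmult_lt_0_compat; assumption].
    rewrite ln_div in E by assumption.
    rewrite <- (Rpower_pow (n - 1) r), ln_Rpower, (INR_dim_pred n p Hp) in E by exact Hr.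
    rewrite <- (exp_ln (w r)) by assumption. apply exp_le.
    replace (ln r + be * (ln (w r) - (INR n - 1) * ln r)) with (be * ln (w r) + - ls * ln r) in E
      by (unfold be, ls; field; lra).
    assert (E3 : (p - 1) * (be * ln (w r)) <= (p - 1) * (ln C - ln ka)) by (apply Rmult_le_compat_l; lra).
    replace ((p - 1) * (be * ln (w r))) with (ln (w r)) in E3 by (unfold be; field; lra). exact E3. }
  assert (HWp : 0 < W) by apply exp_pos.
  set (C1 := (p - 1) / p / ka).
  assert (HC1 : 0 < C1) by (unfold C1; repeat apply Rdiv_lt_0_compat; lra).
  (* The first bound keeps the slope term below [del / 2]; the second makes the growth of [w] over
     [[r, 2 r]] contradict [w <= W]. *)
  set (eta := Rmin (del / (2 * C1 * W)) (q * del / (8 * W))).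
  assert (Heta : 0 < eta).
  { assert (0 < C1 * W) by (apply Rmult_lt_0_compat; lra).
    apply Rmin_pos; apply Rdiv_lt_0_compat; nra. }
  set (r := Rmax (xi + 1) (Rpower (C / eta) (/ ls))).
  assert (Hr : xi + 1 <= r) by apply Rmax_l.
  assert (Hur : u r <= eta).
  { eapply Rle_trans; [apply Hbub; lra|].
    assert (HCe : 0 < C / eta) by (apply Rdiv_lt_0_compat; lra).
    rewrite Rpower_Ropp. pose proof (Rpower_pos r ls).
    assert (C / eta <= Rpower r ls).
    { replace (C / eta) with (Rpower (Rpower (C / eta) (/ ls)) ls).
      - apply Rle_Rpower_l; [lra|]. split; [apply Rpower_pos|apply Rmax_r].
      - rewrite Rpower_mult, Rinv_l, Rpower_1; lra. }
    apply Rmult_le_reg_r with (Rpower r ls); [assumption|].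
    rewrite Rmult_assoc, Rinv_l, Rmult_1_r by lra.
    replace C with (C / eta * eta) by (field; lra). nra. }
  assert (He1 : u r * (2 * C1 * W) <= del).
  { assert (0 < C1 * W) by (apply Rmult_lt_0_compat; lra).
    apply Rle_trans with (del / (2 * C1 * W) * (2 * C1 * W)).
    - apply Rmult_le_compat_r; [lra|]. eapply Rle_trans; [exact Hur|apply Rmin_l].
    - apply Req_le. field. lra. }
  assert (He2 : u r * (8 * W) <= q * del).
  { apply Rle_trans with (q * del / (8 * W) * (8 * W)).
    - apply Rmult_le_compat_r; [lra|]. eapply Rle_trans; [exact Hur|apply Rmin_r].
    - apply Req_le. field. lra. }
  assert (Hgrow : forall x, r <= x -> q * del / 2 <= x * u x * (x ^ (n - 1) * (K x * sgnpow q (u x)))).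
  { intros x Hx. pose proof (Hpos x ltac:(lra)) as Hux. pose proof (Hw x ltac:(lra)) as Hwx.
    assert (E1 : del <= pohozaev n p q K u w x) by (apply HPi; lra).
    unfold pohozaev in E1.
    assert (E2 : (p - 1) / p * (x * (slope n p w x * w x)) <= C1 * (u x * w x)).
    { pose proof (Hdrop x ltac:(lra)) as E3. unfold C1.
      replace ((p - 1) / p * (x * (slope n p w x * w x))) with
        ((p - 1) / p / ka * (x * slope n p w x * ka * w x)) by (field; lra).
      apply Rmult_le_compat_l; [unfold C1 in HC1; lra|]. apply Rmult_le_compat_r; lra. }
    assert (E3 : 0 <= (INR n - p) / p * (u x * w x)).
    { apply Rmult_le_pos; [apply Rlt_le, Rdiv_lt_0_compat; lra|nra]. }
    assert (E4 : C1 * (u x * w x) <= del / 2).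
    { apply Rle_trans with (C1 * (u r * W)); [|lra].
      apply Rmult_le_compat_l; [lra|].
      apply Rmult_le_compat; [lra|lra|apply Hud; lra|apply HW; lra]. }
    assert (E5 : x ^ n * (K x * (/ q * rpow (Rabs (u x)) q)) =
      / q * (x * u x * (x ^ (n - 1) * (K x * sgnpow q (u x))))).
    { rewrite <- sgnpow_mult_self, (pow_split_pred n x) by lia. ring. }
    rewrite E5 in E1.
    assert (E6 : del / 2 <= / q * (x * u x * (x ^ (n - 1) * (K x * sgnpow q (u x))))) by lra.
    apply Rmult_le_compat_l with (r := q) in E6; [|lra].
    rewrite <- Rmult_assoc, Rinv_r, Rmult_1_l in E6 by lra. lra. }
  destruct (mvt w (fun r => r ^ (n - 1) * (K r * sgnpow q (u r))) r (2 * r)) as [c [Hc E]]; [lra| |].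
  { intros x Hx. apply (w_derive n p q K d u w S). lra. }
  specialize (Hgrow c ltac:(lra)). pose proof (HW (2 * r) ltac:(lra)) as H2W. pose proof (Hw r ltac:(lra)) as Hwr.
  pose proof (Hpos c ltac:(lra)) as Huc. pose proof (Hpos r ltac:(lra)) as Hurp. pose proof (Hud r c ltac:(lra) ltac:(lra)) as Hucr.
  set (dw := c ^ (n - 1) * (K c * sgnpow q (u c))) in *.
  assert (Hdw : 0 <= dw).
  { destruct (Rle_or_lt 0 dw); [assumption|]. assert (0 < c * u c) by nra.
    assert (0 < q * del) by nra. nra. }
  assert (H3 : c * u c * dw <= 2 * r * u r * dw).
  { apply Rmult_le_compat_r; [exact Hdw|]. apply Rmult_le_compat; lra. }
  assert (H4 : r * dw < W) by nra.
  assert (H5 : u r * (r * dw) < u r * W) by (apply Rmult_lt_compat_l; lra).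
  nra.
Qed.

(** * Quantitative bounds on the first zero *)

(** The amplitude bound limits the forcing by [K M * d^(q-1)] whatever the sign of [u], and this
    limits [|u'|] on [(0, r]]. *)
Lemma drop_bound (d M r : R) (u w : R -> R) : 0 < d -> 0 < r <= M ->
  sysol n p (fun r => K r * sgnpow q (u r)) d u w ->
  d - u r <= r * Rpower (K M * Rpower d (q - 1) * r) (/ (p - 1)).
Proof.
  intros Hd Hr S. pose proof HK as [KP [_ [KM _]]].
  pose proof (sysol_amplitude d u w Hd S) as HA.
  pose proof (KP M ltac:(lra)) as HKM. pose proof (Rpower_pos d (q - 1)) as HRd.
  assert (HG : 0 < K M * Rpower d (q - 1)) by (apply Rmult_lt_0_compat; assumption).
  destruct S as [_ [Hu [Hw D]]].
  assert (HB : forall x, 0 < x <= M -> Rabs (K x * sgnpow q (u x)) <= K M * Rpower d (q - 1)).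
  { intros x Hx. rewrite Rabs_mult, Rabs_pos_eq by (apply Rlt_le, KP; lra).
    apply Rmult_le_compat; [apply Rlt_le, KP; lra|apply Rabs_pos|apply KM; lra|].
    destruct (Req_dec (u x) 0) as [->|Hne]; [rewrite sgnpow_0, Rabs_R0; lra|].
    rewrite sgnpow_abs by exact Hne. apply Rle_Rpower_l; [lra|].
    split; [apply Rabs_pos_lt, Hne|apply HA; lra]. }
  assert (E : Rabs (u r - d) <= Rpower (K M * Rpower d (q - 1) * r) (/ (p - 1)) * r).
  { apply (deriv_const_bound0 u (fun r => - sgnpow (p / (p - 1)) (w r / r ^ (n - 1)))); [lra|exact Hu| |].
    - intros x Hx. apply D; lra.
    - intros x Hx. rewrite Rabs_Ropp.
      pose proof (cumulative_bound n _ w M _ Hw (fun r H => proj2 (D r H)) HB x ltac:(lra)) as E.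
      destruct (Req_dec (w x / x ^ (n - 1)) 0) as [->|Hne].
      + rewrite sgnpow_0, Rabs_R0. apply Rlt_le, Rpower_pos.
      + rewrite sgnpow_abs by exact Hne. replace (p / (p - 1) - 1) with (/ (p - 1)) by (field; lra).
        apply Rle_Rpower_l; [apply Rlt_le, Rinv_0_lt_compat; lra|].
        split; [apply Rabs_pos_lt, Hne|]. nra. }
  apply Rabs_le_between in E. lra.
Qed.

(** [u] has to lose all of [d], so [drop_bound] gives [1 <= K(M) Rad^p d^(q-p)]. As [q > p], this
    excludes zeros in [(0, M]] for small [d]. *)
Lemma zero_small_amplitude (d M Rad : R) (u w : R -> R) : 0 < d -> 0 < Rad <= M ->
  sysol n p (fun r => K r * sgnpow q (u r)) d u w -> u Rad = 0 ->
  0 <= p * ln Rad + ln (K M) + (q - p) * ln d.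
Proof.
  intros Hd HR S Hz. pose proof (drop_bound d M Rad u w Hd HR S) as E. rewrite Hz, Rminus_0_r in E.
  assert (HKM : 0 < K M) by (apply HK; lra). pose proof (Rpower_pos d (q - 1)) as HRd.
  apply ln_le in E; [|exact Hd].
  rewrite ln_mult in E; [|lra|apply Rpower_pos].
  rewrite ln_Rpower, ln_mult, ln_mult, ln_Rpower in E; try assumption; try lra; [|nra].
  assert (E2 : (p - 1) * ln d <= (p - 1) * (ln Rad + / (p - 1) * (ln (K M) + (q - 1) * ln d + ln Rad)))
    by (apply Rmult_le_compat_l; lra).
  rewrite Rmult_plus_distr_l, <- Rmult_assoc, Rinv_r, Rmult_1_l in E2 by lra. lra.
Qed.

(* [u >= d / 2] on the concentration scale [r1 ~ d ^ (- p / (n - p))], where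
   already [w r1 >= c / d]. *)
Lemma flux_at_zero_lower (M : R) : 0 < M -> exists c, forall d Rad u w,
  0 < d -> 0 < Rad <= M -> sysol n p (fun r => K r * sgnpow q (u r)) d u w ->
  (forall r, 0 < r < Rad -> 0 < u r) -> u Rad = 0 -> c - ln d <= ln (w Rad).
Proof.
  intros HM. pose proof (proj1 HK M ltac:(lra)) as HKM. pose proof (proj1 HK 0 ltac:(lra)) as HK0.
  pose proof (dim_ge_2 n p Hp) as Hn.
  (* Chosen so that [drop_bound] at [r1] equals exactly [d / 2]. *)
  set (k := (ln (K M) + (p - 1) * ln 2) / p).
  exists (ln (K 0 / INR n) - (q - 1) * ln 2 - INR n * k).
  intros d Rad u w Hd HR S Hpos Hz.
  assert (Hqp : q - p = p * (p / (INR n - p))) by (rewrite Hqn; field; lra).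
  set (r1 := exp (- (p / (INR n - p)) * ln d - k)).
  assert (Hr1 : 0 < r1) by apply exp_pos.
  assert (Hl1 : ln r1 = - (p / (INR n - p)) * ln d - k) by apply ln_exp.
  assert (Hk : p * k = ln (K M) + (p - 1) * ln 2) by (unfold k; field; lra).
  pose proof ln_lt_2 as Hl2.
  (* Losing all of [d] takes longer than losing half of it: [Rad <= r1] would violate
     [zero_small_amplitude] by the factor [2^(p-1)]. *)
  assert (Hlt : r1 < Rad).
  { pose proof (zero_small_amplitude d M Rad u w Hd HR S Hz) as E.
    rewrite Hqp in E. destruct (Rlt_or_le r1 Rad) as [|Hle]; [assumption|exfalso].
    apply ln_le in Hle; [|lra]. rewrite Hl1 in Hle.
    assert (p * ln Rad <= p * (- (p / (INR n - p)) * ln d - k)) by (apply Rmult_le_compat_l; lra).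
    assert (0 < (p - 1) * ln 2) by (apply Rmult_lt_0_compat; lra). lra. }
  pose proof (Rpower_pos d (q - 1)) as HRd.
  assert (Hhalf : d / 2 <= u r1).
  { pose proof (drop_bound d M r1 u w Hd ltac:(lra) S) as E.
    assert (E2 : r1 * Rpower (K M * Rpower d (q - 1) * r1) (/ (p - 1)) = d / 2); [|lra].
    apply ln_inv; [apply Rmult_lt_0_compat; [lra|apply Rpower_pos]|lra|].
    rewrite ln_mult; [|lra|apply Rpower_pos]. rewrite ln_Rpower.
    rewrite ln_mult, ln_mult, ln_Rpower, ln_div; try assumption; try lra; [|nra].
    apply Rmult_eq_reg_l with (p - 1); [|lra].
    rewrite Rmult_plus_distr_l, <- Rmult_assoc, Rinv_r, Rmult_1_l by lra.
    assert (p * ln r1 = - (q - p) * ln d - ln (K M) - (p - 1) * ln 2) by (rewrite Hl1, Hqp; lra). lra. }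
  assert (HRz : 0 <= u Rad) by lra.
  pose proof (w_lower n p q K K' Hp Hq HK d Rad u w S Hpos HRz r1 ltac:(lra) ltac:(lra)) as E.
  pose proof (w_incr n p q K K' HK d Rad u w S Hpos HRz r1 Rad Hr1 ltac:(lra) ltac:(lra)) as E1.
  assert (Hp1 : Rpower (d / 2) (q - 1) <= Rpower (u r1) (q - 1)) by (apply Rle_Rpower_l; lra).
  assert (Hrn : 0 < r1 ^ n) by (apply pow_lt; lra).
  pose proof (Rpower_pos (d / 2) (q - 1)) as Hp3.
  assert (E3 : K 0 / INR n * (Rpower (d / 2) (q - 1) * Rpower r1 (INR n)) <= w Rad).
  { rewrite Rpower_pow by lra. eapply Rle_trans; [|exact E1]. eapply Rle_trans; [|exact E].
    replace (K 0 * Rpower (u r1) (q - 1) * (r1 ^ n / INR n)) with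
      (K 0 / INR n * (Rpower (u r1) (q - 1) * r1 ^ n)) by (field; lra).
    apply Rmult_le_compat_l; [apply Rlt_le, Rdiv_lt_0_compat; lra|].
    apply Rmult_le_compat_r; lra. }
  assert (HK0n : 0 < K 0 / INR n) by (apply Rdiv_lt_0_compat; lra).
  pose proof (Rpower_pos r1 (INR n)) as Hp4.
  apply ln_le in E3; [|apply Rmult_lt_0_compat; [assumption|apply Rmult_lt_0_compat; assumption]].
  rewrite (ln_mult (K 0 / INR n)), (ln_mult (Rpower _ _)), !ln_Rpower, (ln_div d 2) in E3; try assumption; try lra;
    [|apply Rmult_lt_0_compat; assumption].
  rewrite Hl1 in E3.
  assert ((q - 1) * ln d + INR n * (- (p / (INR n - p)) * ln d) = - ln d) by (rewrite Hqn; field; lra).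
  lra.
Qed.

(** [P'] is integrated in two ranges split at [eps = d^(-p/(n-p))]: inside with [u <= d], outside
    with the bubble bound, whose tail is integrable because [lam < n/(p-1)]. Both contributions are
    multiples of [eps^lam]. *)
Lemma pohozaev_upper (lam M C : R) :
  0 < M -> 0 < C -> 0 < lam -> lam < INR n / (p - 1) ->
  (forall r, 0 < r <= M -> K' r <= C * Rpower r (lam - 1)) ->
  exists c, 0 < c /\ forall d Rad u w,
  0 < d -> 0 < Rad <= M -> sysol n p (fun r => K r * sgnpow q (u r)) d u w ->
  (forall r, 0 < r < Rad -> 0 < u r) -> u Rad = 0 ->
  pohozaev n p q K u w Rad <= c * Rpower d (- (p / (INR n - p)) * lam).
Proof.
  intros HM HC Hlam Hlam2 HK'. pose proof (dim_ge_2 n p Hp) as Hn.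
  pose proof HK as [KP [_ [KM KD]]].
  set (nb := INR n / (p - 1)) in *.
  set (lka := - ((INR n - p) / p) * (ln (p / (INR n - p) * / (p / (p - 1))) + / (p - 1) * ln (K 0 / INR n))).
  set (c1 := C / q / (INR n + lam)). set (c2 := C / q * exp (q * lka) / (nb - lam)).
  assert (Hc1 : 0 < c1) by (unfold c1; repeat apply Rdiv_lt_0_compat; lra).
  assert (Hc2 : 0 < c2).
  { unfold c2. apply Rdiv_lt_0_compat; [|lra]. apply Rmult_lt_0_compat; [apply Rdiv_lt_0_compat; lra|apply exp_pos]. }
  exists (c1 + c2). split; [lra|].
  intros d Rad u w Hd HR S Hpos Hz.
  assert (HRz : 0 <= u Rad) by lra.
  pose proof (pohozaev_derive n p q K K' Hp Hq Hqn HK d Rad u w S Hpos HRz) as DP.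
  pose proof (pohozaev_lim0 n p q K K' Hp Hp2 Hq HK d u w S) as LP.
  pose proof (sysol_amplitude d u w Hd S) as HA.
  set (P := pohozaev n p q K u w) in *.
  set (a := p / (INR n - p)).
  assert (Hphase1 : forall r, 0 < r <= Rad -> P r <= c1 * Rpower d q * Rpower r (INR n + lam)).
  { intros r Hr.
    assert (E : c1 * Rpower d q * 0 - 0 <= c1 * Rpower d q * Rpower r (INR n + lam) - P r).
    { apply (deriv_nonneg_le0 (fun x => c1 * Rpower d q * Rpower x (INR n + lam) - P x)
        (fun x => c1 * Rpower d q * ((INR n + lam) * Rpower x (INR n + lam - 1)) -
           x ^ n * (K' x * (/ q * rpow (Rabs (u x)) q)))); [lra| | |].
      - apply lim0_minus; [|exact LP]. apply lim0_mult; [apply lim0_const|apply lim0_Rpower; lra].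
      - intros x Hx. apply (is_derive_minus (fun x => c1 * Rpower d q * Rpower x (INR n + lam)) P); [|apply DP; lra].
        apply is_derive_scal, is_derive_Rpower_id; lra.
      - intros x Hx. rewrite <- (Rpower_pow n x) by lra.
        replace (INR n + lam - 1) with (INR n + (lam - 1)) by ring. rewrite Rpower_plus.
        pose proof (Rpower_pos x (INR n)). pose proof (Rpower_pos x (lam - 1)). pose proof (Rpower_pos d q).
        assert (Hrp : 0 <= rpow (Rabs (u x)) q <= Rpower d q).
        { split; [apply rpow_nonneg|]. unfold rpow. destruct (Rlt_dec 0 (Rabs (u x))); [|lra].
          apply Rle_Rpower_l; [lra|]. split; [assumption|apply HA; lra]. }
        replace (c1 * Rpower d q * ((INR n + lam) * (Rpower x (INR n) * Rpower x (lam - 1)))) with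
          (Rpower x (INR n) * (C * Rpower x (lam - 1) * (/ q * Rpower d q))) by (unfold c1; field; lra).
        apply -> Rminus_le_0. apply Rmult_le_compat_l; [lra|].
        assert (0 < / q) by (apply Rinv_0_lt_compat; lra).
        apply Rmult_le_compat; [apply KD; lra|nra|apply HK'; lra|nra]. }
    lra. }
  set (eps := Rpower d (- a)).
  assert (Heps : 0 < eps) by apply Rpower_pos.
  assert (Hc1eps : c1 * Rpower d q * Rpower eps (INR n + lam) = c1 * Rpower d (- a * lam)).
  { unfold eps. rewrite Rpower_mult, Rmult_assoc, <- Rpower_plus. f_equal. f_equal.
    unfold a. rewrite Hqn. field. lra. }
  fold a. pose proof (Rpower_pos d (- a * lam)) as Hdl.
  destruct (Rle_or_lt Rad eps) as [Hle|Hlt].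
  - eapply Rle_trans; [apply Hphase1; lra|].
    apply Rle_trans with (c1 * Rpower d q * Rpower eps (INR n + lam)).
    + apply Rmult_le_compat_l; [pose proof (Rpower_pos d q); nra|]. apply Rle_Rpower_l; lra.
    + rewrite Hc1eps. nra.
  - pose proof (Hphase1 eps ltac:(lra)) as E1. rewrite Hc1eps in E1.
    (* [A * x ^ (lam - nb)] is the tail integral of the bubble bound for [P']; at [x = eps] its size
       is again [c2 * eps ^ lam]. *)
    set (A := c2 * Rpower d (- q / (p - 1))).
    assert (HA0 : 0 < A) by (apply Rmult_lt_0_compat; [assumption|apply Rpower_pos]).
    assert (E2 : - A * Rpower eps (lam - nb) - P eps <= - A * Rpower Rad (lam - nb) - P Rad).
    { apply (deriv_nonneg_le (fun x => - A * Rpower x (lam - nb) - P x)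
        (fun x => - A * ((lam - nb) * Rpower x (lam - nb - 1)) - x ^ n * (K' x * (/ q * rpow (Rabs (u x)) q))));
        [lra| |].
      - intros x Hx. apply (is_derive_minus (fun x => - A * Rpower x (lam - nb)) P); [|apply DP; lra].
        apply is_derive_scal, is_derive_Rpower_id; lra.
      - intros x Hx. rewrite <- (Rpower_pow n x) by lra.
        assert (Hrp : rpow (Rabs (u x)) q <= exp (q * lka) * Rpower d (- q / (p - 1)) * Rpower x (- nb - INR n)).
        (* The bubble bound holds strictly before the zero; at [x = Rad] the convention [rpow 0 = 0]
           settles the claim. *)
        { unfold rpow. destruct (Rlt_dec 0 (Rabs (u x))) as [Hux|_].
          2:{ apply Rlt_le. repeat apply Rmult_lt_0_compat; try apply Rpower_pos. apply exp_pos. }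
          assert (Hx2 : x < Rad).
          { destruct (Req_dec x Rad) as [->|]; [|lra]. rewrite Hz, Rabs_R0 in Hux. lra. }
          pose proof (Hpos x ltac:(lra)). rewrite Rabs_pos_eq by lra.
          pose proof (bubble_bound n p q K K' Hp Hp2 Hq Hqn HK d Rad u w Hd S Hpos HRz x ltac:(lra)) as Hbub.
          fold lka in Hbub. unfold Rpower. rewrite <- !exp_plus. apply exp_le.
          assert (E : q * ln (u x) <= q * (lka - / (p - 1) * ln d - (INR n - p) / (p - 1) * ln x))
            by (apply Rmult_le_compat_l; lra).
          eapply Rle_trans; [exact E|]. apply Req_le.
          assert (q * ((INR n - p) / (p - 1)) = nb + INR n) by (unfold nb; rewrite Hqn; field; lra).
          replace (q * (lka - / (p - 1) * ln d - (INR n - p) / (p - 1) * ln x)) with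
            (q * lka - q / (p - 1) * ln d - q * ((INR n - p) / (p - 1)) * ln x) by (field; lra).
          rewrite H0. field. lra. }
        replace (- A * ((lam - nb) * Rpower x (lam - nb - 1))) with
          (Rpower x (INR n) * (C * Rpower x (lam - 1) *
            (/ q * (exp (q * lka) * Rpower d (- q / (p - 1)) * Rpower x (- nb - INR n))))).
        2:{ replace (lam - nb - 1) with (INR n + (lam - 1) + (- nb - INR n)) by ring.
            rewrite !Rpower_plus. unfold A, c2. field. lra. }
        apply -> Rminus_le_0. apply Rmult_le_compat_l; [apply Rlt_le, Rpower_pos|].
        assert (0 < / q) by (apply Rinv_0_lt_compat; lra). pose proof (rpow_nonneg (Rabs (u x)) q).
        apply Rmult_le_compat; [apply KD; lra|nra|apply HK'; lra|].
        apply Rmult_le_compat_l; lra. }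
    assert (E3 : A * Rpower eps (lam - nb) = c2 * Rpower d (- a * lam)).
    { unfold A, eps. rewrite Rpower_mult, Rmult_assoc, <- Rpower_plus. f_equal. f_equal.
      unfold a, nb. rewrite Hqn. field. lra. }
    pose proof (Rpower_pos Rad (lam - nb)). nra.
Qed.

(** At the zero, [P] is a multiple of [Rad^(-s) w^(p/(p-1))], with [s = (n-p)/(p-1)]. Since
    [w >= c / d] and [P <= C d^(-p lam/(n-p))], this yields [Rad^s >= c d^(p (lam - s)/(n-p))]. *)
Lemma zero_lower_bound (lam M C : R) :
  0 < M -> 0 < C -> 0 < lam -> lam < INR n / (p - 1) ->
  (forall r, 0 < r <= M -> K' r <= C * Rpower r (lam - 1)) ->
  exists c, forall d Rad u w,
  0 < d -> 0 < Rad <= M -> sysol n p (fun r => K r * sgnpow q (u r)) d u w ->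
  (forall r, 0 < r < Rad -> 0 < u r) -> u Rad = 0 ->
  c + p / (INR n - p) * (lam - (INR n - p) / (p - 1)) * ln d <= (INR n - p) / (p - 1) * ln Rad.
Proof.
  intros HM HC Hlam Hlam2 HK'. pose proof (dim_ge_2 n p Hp) as Hn.
  destruct (pohozaev_upper lam M C HM HC Hlam Hlam2 HK') as [c1 [Hc1 H1]].
  destruct (flux_at_zero_lower M HM) as [c2 H2].
  exists (ln ((p - 1) / p) + p / (p - 1) * c2 - ln c1).
  intros d Rad u w Hd HR S Hpos Hz.
  specialize (H1 d Rad u w Hd HR S Hpos Hz). specialize (H2 d Rad u w Hd HR S Hpos Hz).
  assert (HRz : 0 <= u Rad) by lra.
  pose proof (w_pos n p q K K' Hp HK d Rad u w S Hpos HRz Rad ltac:(lra)) as Hw.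
  pose proof (slope_eq n p q K K' Hp HK d Rad u w S Hpos HRz Rad ltac:(lra)) as Hsl.
  unfold pohozaev in H1. rewrite Hz, Rabs_R0, rpow_0, Hsl in H1.
  assert (Hrn : 0 < Rad ^ (n - 1)) by (apply pow_lt; lra).
  pose proof (Rpower_pos (w Rad / Rad ^ (n - 1)) (/ (p - 1))) as HQ.
  assert (Hpp : 0 < (p - 1) / p) by (apply Rdiv_lt_0_compat; lra).
  assert (E : (p - 1) / p * (Rad * (Rpower (w Rad / Rad ^ (n - 1)) (/ (p - 1)) * w Rad))
     <= c1 * Rpower d (- (p / (INR n - p)) * lam)) by lra.
  apply ln_le in E.
  2:{ apply Rmult_lt_0_compat; [assumption|apply Rmult_lt_0_compat; [lra|apply Rmult_lt_0_compat; assumption]]. }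
  rewrite (ln_mult ((p - 1) / p)), (ln_mult Rad), (ln_mult (Rpower _ _)), (ln_mult c1), !ln_Rpower in E;
    try assumption; try lra; try apply Rpower_pos; try (apply Rmult_lt_0_compat; assumption).
  2:{ apply Rmult_lt_0_compat; [lra|apply Rmult_lt_0_compat; assumption]. }
  rewrite (ln_div (w Rad)) in E by assumption.
  rewrite <- (Rpower_pow (n - 1) Rad), ln_Rpower, (INR_dim_pred n p Hp) in E by lra.
  assert (E2 : p / (p - 1) * (c2 - ln d) <= p / (p - 1) * ln (w Rad)).
  { apply Rmult_le_compat_l; [apply Rlt_le, Rdiv_lt_0_compat; lra|exact H2]. }
  assert (E3 : ln Rad + (/ (p - 1) * (ln (w Rad) - (INR n - 1) * ln Rad) + ln (w Rad)) =
    p / (p - 1) * ln (w Rad) - (INR n - p) / (p - 1) * ln Rad) by (field; lra).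
  rewrite E3 in E.
  assert (E4 : p / (INR n - p) * (lam - (INR n - p) / (p - 1)) * ln d =
    p / (INR n - p) * lam * ln d - p / (p - 1) * ln d) by (field; lra).
  rewrite E4. lra.
Qed.

End Zeros.

(** * The first zero as a function of [d] *)

Lemma deriv_neg_right (f : R -> R) (x l eta : R) :
  is_derive f x l -> l < 0 -> 0 < eta -> exists y, x < y < x + eta /\ f y < f x.
Proof.
  intros Hf Hl Heta. apply is_derive_Reals in Hf.
  destruct (Hf (- l) ltac:(lra)) as [d Hd]. pose proof (cond_pos d).
  set (k := Rmin d eta / 2).
  assert (Hk : 0 < k /\ k < d /\ k < eta).
  { unfold k. pose proof (Rmin_l d eta). pose proof (Rmin_r d eta).
    assert (0 < Rmin d eta) by (apply Rmin_pos; lra). lra. }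
  specialize (Hd k ltac:(lra) ltac:(rewrite Rabs_pos_eq; lra)).
  exists (x + k). split; [lra|].
  apply Rabs_def2 in Hd. assert (Hq : (f (x + k) - f x) / k < 0) by lra.
  assert ((f (x + k) - f x) / k * k < 0) by nra.
  replace ((f (x + k) - f x) / k * k) with (f (x + k) - f x) in H0 by (field; lra). lra.
Qed.

Lemma weight_of_C1_halfline (K : R -> R) :
  C1_halfline K -> (forall r, 0 <= r -> 0 < K r) -> (forall r s, 0 <= r -> r <= s -> K r <= K s) ->
  exists K', weight K K'.
Proof.
  intros [K' H] KP KM. exists K'.
  split; [exact KP|]. split; [|split; [exact KM|]].
  - destruct (H 0 (Rle_refl 0)) as [H0 _].
    assert (L : lim0 (fun s => (K s - K 0) / (s - 0)) (K' 0)).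
    { intros P HP. destruct (H0 P HP) as [e He]. exists e. intros y Hy Hy0. apply He; [exact Hy|lra|lra]. }
    (* Continuity at 0 is recovered from the one-sided derivative there. *)
    apply (lim0_ext (fun s => K 0 + (K s - K 0) / (s - 0) * s)).
    { intros x Hx. field. lra. }
    pose proof (lim0_plus _ _ _ _ (lim0_const (K 0)) (lim0_mult _ _ _ _ L lim0_id)) as E.
    rewrite Rmult_0_r, Rplus_0_r in E. exact E.
  - intros r Hr. destruct (H r ltac:(lra)) as [H1 H2].
    assert (D : is_derive K r (K' r)).
    { apply is_derive_Reals. intros e He.
      destruct (proj1 (filterlim_locally _ _) H1 (mkposreal e He)) as [d Hd].
      assert (Hm : 0 < Rmin d r) by (apply Rmin_pos; [apply cond_pos|exact Hr]).
      exists (mkposreal _ Hm). intros k Hk Hkd. simpl in Hkd.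
      pose proof (Rmin_l d r). pose proof (Rmin_r d r).
      assert (Hb : ball r d (r + k)).
      { change (Rabs (r + k - r) < d). replace (r + k - r) with k by ring. lra. }
      specialize (Hd (r + k) Hb ltac:(lra) ltac:(apply Rabs_def2 in Hkd; lra)).
      replace (r + k - r) with k in Hd by ring. exact Hd. }
    split; [exact D|split].
    + destruct (Rle_or_lt 0 (K' r)) as [|Hlt]; [assumption|exfalso].
      destruct (deriv_neg_right K r (K' r) 1 D Hlt Rlt_0_1) as [y [Hy Hlty]].
      specialize (KM r y ltac:(lra) ltac:(lra)). lra.
    + intros P HP. destruct (H2 P HP) as [d Hd].
      assert (Hm : 0 < Rmin d r) by (apply Rmin_pos; [apply cond_pos|exact Hr]).
      exists (mkposreal _ Hm). intros y Hy. change (Rabs (y - r) < Rmin d r) in Hy.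
      pose proof (Rmin_l d r). pose proof (Rmin_r d r).
      apply Hd; [change (Rabs (y - r) < d); lra|]. apply Rabs_def2 in Hy. lra.
Qed.

(** Near 0 the expansion gives [K' <= (B l + 1) r^(l-1)], weakened to exponent [lam - 1] by
    [lam <= l]; on the rest of [(0, M]] continuity of [K'] on a compact interval suffices. *)
Lemma weight_derivative_growth (K K' h : R -> R) (A B l lam M : R) :
  weight K K' -> 0 < B -> 0 < l -> lam <= l -> 0 < M ->
  (forall r, 0 <= r -> K r = A + B * rpow r l + h r) ->
  lim0 (fun r => (Rabs (h r) + r * Rabs (Derive h r)) / rpow r l) 0 ->
  exists C, 0 < C /\ forall r, 0 < r <= M -> K' r <= C * Rpower r (lam - 1).
Proof.
  intros [_ [_ [_ KD]]] HB Hl Hlam HM HK Hh.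
  (* The derivative of [h] is read off from that of [K], since [h = K - A - B r^l] on [r > 0]. *)
  assert (Dh : forall r, 0 < r -> Derive h r = K' r - B * (l * Rpower r (l - 1))).
  { intros r Hr. apply is_derive_unique.
    apply (is_derive_ext_loc (fun s => K s - (A + B * Rpower s l))).
    - exists (mkposreal r Hr). intros y Hy. change (Rabs (y - r) < r) in Hy. apply Rabs_def2 in Hy.
      change (K y - (A + B * Rpower y l) = h y). rewrite HK, rpow_pos by lra. ring.
    - rewrite <- (Rplus_0_l (B * _)).
      apply (is_derive_minus K (fun s => A + B * Rpower s l)); [apply KD, Hr|].
      apply (is_derive_plus (fun _ => A) (fun s => B * Rpower s l)).
      + apply (is_derive_const (V := R_NormedModule)).
      + apply is_derive_scal, is_derive_Rpower_id, Hr. }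
  destruct (proj1 (lim0_eps _ _) Hh 1 Rlt_0_1) as [d [Hd Hsm]].
  assert (Hnear : forall r, 0 < r < d -> K' r <= (B * l + 1) * Rpower r (l - 1)).
  { intros r Hr. specialize (Hsm r Hr). rewrite Rminus_0_r, rpow_pos, Dh in Hsm by lra.
    pose proof (Rpower_pos r l) as Hrl. apply Rabs_def2 in Hsm. destruct Hsm as [Hsm _].
    apply Rmult_lt_compat_r with (r := Rpower r l) in Hsm; [|exact Hrl].
    unfold Rdiv in Hsm. rewrite Rmult_assoc, Rinv_l, Rmult_1_r, Rmult_1_l in Hsm by lra.
    assert (E : Rpower r l = r * Rpower r (l - 1)) by (rewrite Rpower_minus_1 by lra; field; lra).
    rewrite E in Hsm. pose proof (Rabs_pos (h r)).
    pose proof (Rle_abs (K' r - B * (l * Rpower r (l - 1)))) as Ha.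
    assert (r * Rabs (K' r - B * (l * Rpower r (l - 1))) < r * Rpower r (l - 1)) by lra.
    assert (Rabs (K' r - B * (l * Rpower r (l - 1))) < Rpower r (l - 1)) by (apply Rmult_lt_reg_l with r; lra).
    lra. }
  set (d0 := Rmin d M / 2).
  assert (Hd0 : 0 < d0 /\ d0 < d /\ d0 < M).
  { unfold d0. pose proof (Rmin_l d M). pose proof (Rmin_r d M).
    assert (0 < Rmin d M) by (apply Rmin_pos; lra). lra. }
  destruct (continuous_bounded (fun r => K' r * Rpower r (1 - lam)) d0 M) as [C2 [HC2 HB2]]; [lra| |].
  { intros x Hx. apply (continuous_mult K' (fun r => Rpower r (1 - lam))); [apply KD; lra|].
    apply (ex_derive_continuous (fun r => Rpower r (1 - lam))). eexists. apply is_derive_Rpower_id. lra. }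
  set (C1 := (B * l + 1) * Rpower M (l - lam)).
  assert (HC1 : 0 < C1) by (apply Rmult_lt_0_compat; [nra|apply Rpower_pos]).
  exists (C1 + C2). split; [lra|]. intros r Hr.
  pose proof (Rpower_pos r (lam - 1)) as Hrl.
  destruct (Rlt_or_le r d0) as [Hlt|Hle].
  - eapply Rle_trans; [apply Hnear; lra|].
    apply Rle_trans with (C1 * Rpower r (lam - 1)); [|nra].
    unfold C1. rewrite Rmult_assoc. apply Rmult_le_compat_l; [nra|].
    replace (l - 1) with ((l - lam) + (lam - 1)) by ring. rewrite Rpower_plus.
    apply Rmult_le_compat_r; [lra|]. apply Rle_Rpower_l; lra.
  - specialize (HB2 r ltac:(lra)). pose proof (Rle_abs (K' r * Rpower r (1 - lam))) as Ha.
    apply Rle_trans with (C2 * Rpower r (lam - 1)); [|nra].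
    replace (K' r) with (K' r * Rpower r (1 - lam) * Rpower r (lam - 1)).
    + apply Rmult_le_compat_r; lra.
    + rewrite Rmult_assoc, <- Rpower_plus. replace (1 - lam + (lam - 1)) with 0 by ring.
      rewrite Rpower_O by lra. ring.
Qed.

(** The zero is the supremum of the radii up to which [u] is positive: the limit [d > 0] makes it
    positive, and continuity excludes either sign of [u] there. *)
Lemma first_zero (u : R -> R) (d r1 : R) :
  0 < d -> lim0 u d -> (forall r, 0 < r -> continuous u r) -> 0 < r1 -> u r1 <= 0 ->
  exists Rad, 0 < Rad /\ (forall r, 0 < r < Rad -> 0 < u r) /\ u Rad = 0.
Proof.
  intros Hd Hu Cu Hr1 Hu1.
  destruct (proj1 (lim0_eps u d) Hu d Hd) as [e [He Hnear]].
  destruct (completeness (fun x => 0 <= x <= r1 /\ forall s, 0 < s <= x -> 0 < u s)) as [m [Hub Hlub]].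
  { exists r1. intros x [Hx _]. lra. }
  { exists 0. split; [lra|]. intros s Hs. lra. }
  assert (Hm1 : m <= r1) by (apply Hlub; intros x [Hx _]; lra).
  assert (Hbelow : forall s, 0 < s < m -> 0 < u s).
  { intros s Hs. destruct (Rlt_or_le 0 (u s)) as [|Hle]; [assumption|exfalso].
    assert (m <= s); [|lra]. apply Hlub. intros x [Hx Hx2].
    destruct (Rle_or_lt x s) as [|Hlt]; [assumption|]. specialize (Hx2 s ltac:(lra)). lra. }
  assert (Hext : forall s, (forall x, 0 < x <= s -> 0 < u x) -> 0 <= s -> s <= m).
  { intros s Hs Hs0. apply Hub. split; [|exact Hs]. split; [exact Hs0|].
    destruct (Rle_or_lt s r1) as [|Hlt]; [assumption|]. specialize (Hs r1 ltac:(lra)). lra. }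
  assert (Hm0 : 0 < m).
  { assert (e / 2 <= m); [|lra]. apply Hext; [|lra]. intros x Hx.
    specialize (Hnear x ltac:(lra)). apply Rabs_def2 in Hnear. lra. }
  exists m. split; [exact Hm0|]. split; [exact Hbelow|].
  destruct (Rtotal_order (u m) 0) as [Hlt|[Heq|Hgt]]; [exfalso|exact Heq|exfalso].
  - destruct (continuous_eps_inv u m (Cu m Hm0) (- u m) ltac:(lra)) as [dl [Hdl Hc]].
    set (s := m - Rmin dl m / 2).
    pose proof (Rmin_l dl m). pose proof (Rmin_r dl m).
    assert (0 < Rmin dl m) by (apply Rmin_pos; lra).
    specialize (Hc s ltac:(apply Rabs_def1; unfold s; lra)). apply Rabs_def2 in Hc.
    specialize (Hbelow s ltac:(unfold s; lra)). lra.
  - destruct (continuous_eps_inv u m (Cu m Hm0) (u m) ltac:(lra)) as [dl [Hdl Hc]].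
    assert (m + dl / 2 <= m); [|lra]. apply Hext; [|lra]. intros x Hx.
    destruct (Rlt_or_le x m) as [|Hxm]; [apply Hbelow; lra|].
    specialize (Hc x ltac:(apply Rabs_def1; lra)). apply Rabs_def2 in Hc. lra.
Qed.

Lemma exists_minimum (f : R -> R) (t0 a b : R) :
  continuity f -> a <= t0 <= b -> (forall t, t < a \/ b < t -> f t0 < f t) ->
  exists m, forall t, f m <= f t.
Proof.
  intros Cf Hab Hout.
  destruct (continuity_ab_min f a b) as [m [Hm _]]; [lra|intros c _; apply Cf|].
  exists m. intros t. destruct (Rlt_or_le t a) as [|Ha]; [|destruct (Rlt_or_le b t) as [|Hb]].
  - apply Rle_trans with (f t0); [apply Hm; lra|apply Rlt_le, Hout; auto].
  - apply Rle_trans with (f t0); [apply Hm; lra|apply Rlt_le, Hout; auto].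
  - apply Hm. lra.
Qed.

Lemma ivt_between (f : R -> R) (a b y : R) :
  continuity f -> a < b -> f a < y < f b \/ f b < y < f a -> exists t, a < t < b /\ f t = y.
Proof.
  intros Cf Hab Hy.
  destruct (IVT_gen f a b y Cf) as [t [Ht E]].
  - destruct Hy; [rewrite Rmin_left, Rmax_right|rewrite Rmin_right, Rmax_left]; lra.
  - rewrite Rmin_left, Rmax_right in Ht by lra. exists t. split; [|exact E].
    assert (t <> a) by (intros ->; lra). assert (t <> b) by (intros ->; lra). lra.
Qed.

Section FirstZero.

Context (n : nat) (p : R) (K K' : R -> R).
Let q := crit_exp n p.
Context (Hp : 1 < p < INR n).
Context (Hp2 : p <= 2).
Context (Hq : 2 <= q).
Context (HK : weight K K').
Context (Hstrict : exists a b, 0 <= a < b /\ forall r s, a < r -> r < s -> s < b -> K r < K s).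

Definition shoots_to (d Rad : R) (u : R -> R) : Prop :=
  0 < Rad /\ (exists w, sysol n p (fun r => K r * sgnpow q (u r)) d u w) /\
  (forall r, 0 < r < Rad -> 0 < u r) /\ u Rad = 0.

(** Radius and solution are chosen as one pair, with a dummy pair for [d <= 0], so that
    [zero_radius] is a total function. *)
Lemma shoots_to_ex (d : R) : exists ru : R * (R -> R), 0 < d -> shoots_to d (fst ru) (snd ru).
Proof.
  destruct (Rlt_or_le 0 d) as [Hd|Hd]; [|exists (0, fun _ => 0); lra].
  destruct (exists_sysol n p q K K' Hp Hp2 Hq HK d Hd) as [u [w S]].
  pose proof (exists_zero n p q K K' Hp Hp2 Hq eq_refl HK d u w Hd S Hstrict) as Hz.
  assert (Hz2 : exists r, 0 < r /\ u r <= 0).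
  { apply NNPP. intros H. apply Hz. intros r Hr. apply Rnot_le_lt. intros Hle. apply H. exists r. auto. }
  destruct Hz2 as [r1 [Hr1 Hu1]].
  destruct (first_zero u d r1 Hd (proj1 (proj2 S))) as [Rad [HR [Hpos H0]]]; auto.
  - intros r Hr. apply (ex_derive_continuous u). eexists. apply (u_derive n p q K d u w S r Hr).
  - exists (Rad, u). intros _. split; [exact HR|]. split; [exists w; exact S|]. auto.
Qed.

Definition zero_radius (d : R) : R := fst (proj1_sig (constructive_indefinite_description _ (shoots_to_ex d))).

Lemma zero_radius_spec (d : R) : 0 < d -> exists u, shoots_to d (zero_radius d) u.
Proof.
  intros Hd. unfold zero_radius. destruct (constructive_indefinite_description _ _) as [ru H].
  exists (snd ru). apply H, Hd.
Qed.

Lemma shoots_to_dependence (M D : R) : 0 < M -> 0 < D -> exists C, 0 < C /\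
  forall d1 d2 R1 R2 u1 u2, 0 < d1 <= D -> 0 < d2 <= D -> shoots_to d1 R1 u1 -> shoots_to d2 R2 u2 ->
    forall r, 0 < r <= M -> Rabs (u1 r - u2 r) <= C * Rabs (d1 - d2).
Proof.
  intros HM HD. destruct (sysol_dependence n p q K K' Hp Hp2 Hq HK M D HM HD) as [C [HC H]].
  exists C. split; [exact HC|].
  intros d1 d2 R1 R2 u1 u2 Hd1 Hd2 [_ [[w1 S1] _]] [_ [[w2 S2] _]].
  apply (H d1 d2 u1 w1 u2 w2 S1 S2). intros r Hr. split.
  - eapply Rle_trans; [apply (sysol_amplitude n p q K K' Hp Hp2 Hq HK d1 u1 w1); auto; lra|lra].
  - eapply Rle_trans; [apply (sysol_amplitude n p q K K' Hp Hp2 Hq HK d2 u2 w2); auto; lra|lra].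
Qed.

(** With equal amplitudes the Lipschitz estimate makes the two solutions coincide; hence
    [zero_radius] depends on no choice. *)
Lemma zero_radius_unique (d Rad : R) (u : R -> R) : 0 < d -> shoots_to d Rad u -> Rad = zero_radius d.
Proof.
  intros Hd S. destruct (zero_radius_spec d Hd) as [v Sv]. set (R0 := zero_radius d) in *.
  pose proof (proj1 S) as HR. pose proof (proj1 Sv) as HR0.
  destruct (shoots_to_dependence (Rad + R0) d ltac:(lra) Hd) as [C [HC H]].
  assert (E : forall r, 0 < r <= Rad + R0 -> u r = v r).
  { intros r Hr. specialize (H d d Rad R0 u v ltac:(lra) ltac:(lra) S Sv r Hr).
    rewrite Rminus_diag, Rabs_R0, Rmult_0_r in H.
    apply Rminus_diag_uniq. destruct (Req_dec (u r - v r) 0) as [|Hne]; [assumption|].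
    apply Rabs_pos_lt in Hne. lra. }
  destruct S as [_ [_ [P1 Z1]]]. destruct Sv as [_ [_ [P2 Z2]]].
  destruct (Rtotal_order Rad R0) as [Hlt|[Heq|Hgt]]; [|exact Heq|].
  - specialize (P2 Rad ltac:(lra)). rewrite <- E in P2 by lra. lra.
  - specialize (P1 R0 ltac:(lra)). rewrite E in P1 by lra. lra.
Qed.

(** The zero is transversal: the slope is positive at [R0], so [u0] is positive at [R0 - e] and
    negative at some [r2] just after [R0]. A solution within [m] of [u0] has its first zero in
    between. *)
Lemma zero_radius_continuous (d0 eta : R) : 0 < d0 -> 0 < eta -> exists del, 0 < del /\
  forall d, 0 < d -> Rabs (d - d0) < del -> Rabs (zero_radius d - zero_radius d0) < eta.
Proof.
  intros Hd0 Heta. destruct (zero_radius_spec d0 Hd0) as [u0 S0]. set (R0 := zero_radius d0) in *.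
  pose proof S0 as [HR0 [[w0 S] [Hpos Hz]]].
  set (e := Rmin eta R0 / 2).
  assert (He : 0 < e /\ e < eta /\ e < R0).
  { unfold e. pose proof (Rmin_l eta R0). pose proof (Rmin_r eta R0).
    assert (0 < Rmin eta R0) by (apply Rmin_pos; lra). lra. }
  assert (Hz0 : 0 <= u0 R0) by lra.
  destruct (deriv_neg_right u0 R0 (- slope n p w0 R0) e) as [r2 [Hr2 Hneg]]; [| |lra|].
  { apply (u_derive n p q K d0 u0 w0 S). exact HR0. }
  { pose proof (slope_pos n p q K K' Hp HK d0 R0 u0 w0 S Hpos Hz0 R0). lra. }
  rewrite Hz in Hneg. pose proof (Hpos (R0 - e) ltac:(lra)) as Hmu.
  destruct (shoots_to_dependence (R0 + e) (2 * d0) ltac:(lra) ltac:(lra)) as [C [HC HD]].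
  set (m := Rmin (u0 (R0 - e)) (- u0 r2)).
  assert (Hm : 0 < m) by (apply Rmin_pos; lra).
  exists (Rmin d0 (m / C)). split; [apply Rmin_pos; [lra|apply Rdiv_lt_0_compat; lra]|].
  intros d Hd Hdd. destruct (zero_radius_spec d Hd) as [u Su]. set (Rd := zero_radius d) in *.
  pose proof (Rmin_l d0 (m / C)). pose proof (Rmin_r d0 (m / C)).
  assert (Hdle : d <= 2 * d0) by (apply Rabs_def2 in Hdd; lra).
  assert (Hclose : forall r, 0 < r <= R0 + e -> Rabs (u r - u0 r) < m).
  { intros r Hr. eapply Rle_lt_trans; [apply (HD d d0 Rd R0 u u0); auto; lra|].
    replace m with (C * (m / C)) by (field; lra). apply Rmult_lt_compat_l; lra. }
  pose proof (Rmin_l (u0 (R0 - e)) (- u0 r2)) as Hm1. pose proof (Rmin_r (u0 (R0 - e)) (- u0 r2)) as Hm2.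
  fold m in Hm1, Hm2.
  destruct Su as [HRd [_ [Pu Zu]]].
  assert (Hup : Rd < r2).
  { specialize (Hclose r2 ltac:(lra)). apply Rabs_def2 in Hclose.
    destruct (Rtotal_order Rd r2) as [|[Heq|Hgt]]; [assumption| |].
    - rewrite <- Heq in Hclose at 1 3. rewrite Zu in Hclose. rewrite Heq in *. lra.
    - specialize (Pu r2 ltac:(lra)). lra. }
  (* An earlier zero is excluded because [u0] is decreasing, hence at least [u0 (R0 - e) >= m]
     before [R0 - e]. *)
  assert (Hlo : R0 - e < Rd).
  { destruct (Rlt_or_le (R0 - e) Rd) as [|Hle]; [assumption|exfalso].
    specialize (Hclose Rd ltac:(lra)). rewrite Zu in Hclose. apply Rabs_def2 in Hclose.
    assert (u0 (R0 - e) <= u0 Rd); [|lra].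
    destruct Hle as [Hlt| ->]; [|lra]. apply Rlt_le.
    apply (u_decr n p q K K' Hp HK d0 R0 u0 w0 S Hpos Hz0); lra. }
  apply Rabs_def1; lra.
Qed.

(** The parameter [t = ln d] ranges over all of [R], which suits the intermediate value theorem for
    functions continuous everywhere. *)
Lemma zero_radius_exp_continuity : continuity (fun t => zero_radius (exp t)).
Proof.
  intros t. apply continuity_pt_filterlim.
  change (continuous (fun t => zero_radius (exp t)) t). apply continuous_eps. intros e He.
  destruct (zero_radius_continuous (exp t) e (exp_pos t) He) as [d [Hd H]].
  assert (Ce : continuous exp t) by (apply (ex_derive_continuous exp); auto_derive; exact I).
  destruct (continuous_eps_inv exp t Ce d Hd) as [d2 [Hd2 H2]].
  exists d2. split; [exact Hd2|]. intros y Hy. apply H; [apply exp_pos|apply H2, Hy].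
Qed.

Lemma zero_radius_pos (d : R) : 0 < d -> 0 < zero_radius d.
Proof. intros Hd. destruct (zero_radius_spec d Hd) as [u S]. apply S. Qed.

Lemma zero_radius_small_amplitude (M : R) : 0 < M ->
  exists T, forall t, t < T -> M < zero_radius (exp t).
Proof.
  intros HM. assert (Hqp : 0 < q - p).
  { replace (q - p) with (p * p / (INR n - p)) by (unfold q, crit_exp; field; lra).
    apply Rdiv_lt_0_compat; nra. }
  (* The root in [t] of [p ln M + ln (K M) + (q - p) t], the bound of [zero_small_amplitude]. *)
  exists (- (p * ln M + ln (K M)) / (q - p)). intros t Ht.
  destruct (zero_radius_spec (exp t) (exp_pos t)) as [u [HR [[w S] [_ Hz]]]].
  destruct (Rlt_or_le M (zero_radius (exp t))) as [|Hle]; [assumption|exfalso].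
  pose proof (zero_small_amplitude n p q K K' Hp Hp2 Hq HK (exp t) M _ u w (exp_pos t) ltac:(split; eauto) S Hz) as E.
  rewrite ln_exp in E. apply ln_le in Hle; [|exact HR].
  assert (p * ln (zero_radius (exp t)) <= p * ln M) by (apply Rmult_le_compat_l; lra).
  apply Rmult_lt_compat_l with (r := q - p) in Ht; [|exact Hqp].
  replace ((q - p) * (- (p * ln M + ln (K M)) / (q - p))) with (- (p * ln M + ln (K M))) in Ht by (field; lra).
  lra.
Qed.

Lemma zero_radius_lower (lam M C : R) :
  0 < M -> 0 < C -> 0 < lam -> lam < INR n / (p - 1) ->
  (forall r, 0 < r <= M -> K' r <= C * Rpower r (lam - 1)) ->
  exists c, forall t, zero_radius (exp t) <= M ->
  c + p / (INR n - p) * (lam - crit_ell n p) * t <= crit_ell n p * ln (zero_radius (exp t)).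
Proof.
  intros HM HC Hl Hl2 HK'.
  destruct (zero_lower_bound n p q K K' Hp Hp2 Hq eq_refl HK lam M C HM HC Hl Hl2 HK') as [c H].
  exists c. intros t Ht. destruct (zero_radius_spec (exp t) (exp_pos t)) as [u [HR [[w S] [Hpos Hz]]]].
  specialize (H (exp t) (zero_radius (exp t)) u w (exp_pos t) ltac:(split; lra) S Hpos Hz).
  rewrite ln_exp in H. exact H.
Qed.

(** The value at 0 is recorded so that solutions coming from different [t] can be told apart. *)
Lemma admits_of_radius (t : R) : exists u,
  radial_solution n p K (zero_radius (exp t)) u /\ u 0 = exp t.
Proof.
  destruct (zero_radius_spec (exp t) (exp_pos t)) as [u [HR [[w S] [Hpos Hz]]]].
  exists u. assert (H0 : u 0 = exp t) by apply S. split; [|exact H0].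
  exists (exp t). split; [apply exp_pos|]. split; [|split; [|exact Hz]].
  - apply (sysol_regular n p Hp K (exp t) u w _ S). reflexivity.
  - intros r [[Hr| <-] Hr2]; [apply Hpos; lra|]. rewrite H0. apply exp_pos.
Qed.

Lemma radius_of_admits (Rad : R) : 0 < Rad -> admits_radial_solution n p K Rad ->
  exists t, zero_radius (exp t) = Rad.
Proof.
  intros HR [u [d [Hd [Hreg [Hpos Hz]]]]]. exists (ln d). rewrite exp_ln by exact Hd.
  symmetry. apply (zero_radius_unique d Rad u Hd).
  split; [exact HR|]. split; [|split; [intros r Hr; apply Hpos; lra|exact Hz]].
  exists (fun r => - flux n p u r). apply (regular_sysol n p Hp K d u Hq); [apply HK|exact Hreg].
Qed.

End FirstZero.

Theorem theorem2 :
  forall (n : nat) (p : R) (K : R -> R) (A B l : R) (h : R -> R),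
    (0 < n)%nat ->
    1 < p < INR n ->
    2 * INR n / (INR n + 2) <= p <= 2 ->
    (forall r, 0 <= r -> 0 < K r) ->
    C1_halfline K ->
    0 < A -> 0 < B -> 0 < l ->
    (forall r, 0 <= r -> K r = A + B * rpow r l + h r) ->
    filterlim (fun r => (Rabs (h r) + r * Rabs (Derive h r)) / rpow r l)
      (at_right 0) (locally 0) ->
    (forall r s, 0 <= r -> r <= s -> K r <= K s) ->
    (exists a b, 0 <= a < b /\
      forall r s, a < r -> r < s -> s < b -> K r < K s) ->
    (l = crit_ell n p ->
      exists R0, 0 < R0 /\
        (forall Rad, 0 < Rad < R0 -> ~ admits_radial_solution n p K Rad) /\
        (forall Rad, R0 < Rad -> admits_radial_solution n p K Rad)) /\
    (l > crit_ell n p ->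
      exists R0, 0 < R0 /\
        (forall Rad, 0 < Rad < R0 -> ~ admits_radial_solution n p K Rad) /\
        admits_radial_solution n p K R0 /\
        (forall Rad, R0 < Rad -> admits_two_radial_solutions n p K Rad)).
Proof.
  intros n p K A B l h _ Hp Hp2 KP KC _ HB Hl HKh Hh KM Hstrict.
  destruct (weight_of_C1_halfline K KC KP KM) as [K' HK].
  assert (Hq : 2 <= crit_exp n p).
  { unfold crit_exp. apply Rmult_le_reg_r with (INR n - p); [lra|].
    replace (INR n * p / (INR n - p) * (INR n - p)) with (INR n * p) by (field; lra).
    destruct Hp2 as [H1 _]. apply Rmult_le_compat_r with (r := INR n + 2) in H1; [|lra].
    replace (2 * INR n / (INR n + 2) * (INR n + 2)) with (2 * INR n) in H1 by (field; lra). lra. }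
  assert (Hp2' : p <= 2) by lra.
  set (f := fun t => zero_radius n p K K' Hp Hp2' Hq HK Hstrict (exp t)).
  assert (Cf : continuity f) by apply zero_radius_exp_continuity.
  assert (fpos : forall t, 0 < f t) by (intros t; apply zero_radius_pos, exp_pos).
  assert (fsmall : forall M, 0 < M -> exists T, forall t, t < T -> M < f t)
    by apply zero_radius_small_amplitude.
  assert (fadm : forall t, exists u, radial_solution n p K (f t) u /\ u 0 = exp t)
    by apply admits_of_radius.
  assert (admf : forall Rad, 0 < Rad -> admits_radial_solution n p K Rad -> exists t, f t = Rad)
    by apply radius_of_admits.
  assert (flow : forall lam M, 0 < lam -> lam <= l -> lam < INR n / (p - 1) -> 0 < M ->
    exists c, forall t, f t <= M ->
      c + p / (INR n - p) * (lam - crit_ell n p) * t <= crit_ell n p * ln (f t)).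
  { intros lam M H1 H2 H3 H4.
    destruct (weight_derivative_growth K K' h A B l lam M HK HB Hl H2 H4 HKh Hh) as [C [HC HG]].
    apply (zero_radius_lower n p K K' Hp Hp2' Hq HK Hstrict lam M C); assumption. }
  (* From here on [f] is just a positive continuous function whose values are exactly the solvable
     radii, with its behaviour at both ends. *)
  clearbody f.
  assert (Hls : 0 < crit_ell n p) by (apply Rdiv_lt_0_compat; lra).
  assert (Hnb : crit_ell n p < INR n / (p - 1)).
  { apply Rmult_lt_compat_r; [apply Rinv_0_lt_compat; lra|lra]. }
  split.
  (* With [lam = l] equal to the critical exponent, the coefficient of [t] vanishes and the bound is
     uniform; [M = 1] is an arbitrary cutoff. *)
  - intros El. destruct (flow l 1) as [c Hc]; [lra|lra|lra|lra|].
    set (rho := Rmin 1 (exp (c / crit_ell n p))).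
    assert (Hrho : forall t, rho <= f t).
    { intros t. destruct (Rle_or_lt (f t) 1) as [Hle|Hlt].
      - specialize (Hc t Hle). rewrite El, Rminus_diag, Rmult_0_r, Rmult_0_l, Rplus_0_r in Hc.
        apply Rle_trans with (exp (c / crit_ell n p)); [apply Rmin_r|].
        rewrite <- (exp_ln (f t)) by apply fpos. apply exp_le.
        apply Rmult_le_reg_r with (crit_ell n p); [exact Hls|].
        replace (c / crit_ell n p * crit_ell n p) with c by (field; lra). lra.
      - apply Rle_trans with 1; [apply Rmin_l|lra]. }
    assert (Hrp : 0 < rho) by (apply Rmin_pos; [lra|apply exp_pos]).
    (* The infimum of [f], obtained as the supremum of its lower bounds. It may be only a limit of
       values as [t] tends to infinity. *)
    destruct (completeness (fun x => forall t, x <= f t)) as [R0 [Hub Hlub]].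
    { exists (f 0). intros x Hx. apply Hx. }
    { exists rho. exact Hrho. }
    assert (HR0 : rho <= R0) by (apply Hub; exact Hrho).
    exists R0. split; [lra|]. split.
    + intros Rad HRad Hadm. destruct (admf Rad (proj1 HRad) Hadm) as [t Ht].
      assert (R0 <= f t); [|lra]. apply Hlub. intros x Hx. apply Hx.
    + intros Rad HRad.
      assert (Hex : exists t, f t < Rad).
      { apply NNPP. intros Hno. assert (Rad <= R0); [|lra]. apply Hub. intros t.
        apply Rnot_lt_le. intros Hlt. apply Hno. exists t. exact Hlt. }
      destruct Hex as [t1 Ht1]. destruct (fsmall Rad ltac:(lra)) as [T HT].
      set (t2 := Rmin T t1 - 1). pose proof (Rmin_l T t1). pose proof (Rmin_r T t1).
      specialize (HT t2 ltac:(unfold t2; lra)).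
      destruct (ivt_between f t2 t1 Rad Cf) as [t [_ Ht]]; [unfold t2; lra|lra|].
      destruct (fadm t) as [u [Hu _]]. rewrite Ht in Hu. exists u. exact Hu.
  - intros El.
    (* [l] may exceed [n/(p-1)]; the midpoint lies strictly between the critical exponent and that
       bound. *)
    set (lam := Rmin l ((crit_ell n p + INR n / (p - 1)) / 2)).
    assert (Hlam : crit_ell n p < lam) by (apply Rmin_glb_lt; lra).
    assert (Hlam1 : lam <= l) by apply Rmin_l.
    assert (Hlam2 : lam < INR n / (p - 1)).
    { eapply Rle_lt_trans; [apply Rmin_r|lra]. }
    set (k := p / (INR n - p) * (lam - crit_ell n p)).
    assert (Hk : 0 < k) by (apply Rmult_lt_0_compat; [apply Rdiv_lt_0_compat|]; lra).
    assert (flarge : forall M, 0 < M -> exists T, forall t, T < t -> M < f t).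
    { intros M HM. destruct (flow lam M ltac:(lra) Hlam1 Hlam2 HM) as [c Hc]. fold k in Hc.
      exists ((crit_ell n p * ln M - c) / k). intros t Ht.
      destruct (Rlt_or_le M (f t)) as [|Hle]; [assumption|exfalso].
      specialize (Hc t Hle). apply ln_le in Hle; [|apply fpos].
      apply Rmult_lt_compat_l with (r := k) in Ht; [|exact Hk].
      replace (k * ((crit_ell n p * ln M - c) / k)) with (crit_ell n p * ln M - c) in Ht by (field; lra).
      assert (crit_ell n p * ln (f t) <= crit_ell n p * ln M) by (apply Rmult_le_compat_l; lra).
      lra. }
    (* Both ends of the line exceed [f 0], so a minimum over a compact interval around 0 is
       global. *)
    destruct (fsmall (f 0) (fpos 0)) as [T1 HT1]. destruct (flarge (f 0) (fpos 0)) as [T2 HT2].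
    destruct (exists_minimum f 0 (Rmin T1 0) (Rmax T2 0) Cf) as [m Hm].
    { split; [apply Rmin_r|apply Rmax_r]. }
    { pose proof (Rmin_l T1 0). pose proof (Rmax_l T2 0). intros t [Ht|Ht]; [apply HT1|apply HT2]; lra. }
    exists (f m). split; [apply fpos|]. split; [|split].
    + intros Rad HRad Hadm. destruct (admf Rad (proj1 HRad) Hadm) as [t Ht].
      specialize (Hm t). lra.
    + destruct (fadm m) as [u [Hu _]]. exists u. exact Hu.
    + intros Rad HRad. pose proof (fpos m).
      destruct (fsmall Rad ltac:(lra)) as [S1 HS1]. destruct (flarge Rad ltac:(lra)) as [S2 HS2].
      (* Any level above the minimum is crossed once on each side of [m]; the two amplitudes differ,
         so the solutions differ at [r = 0]. *)
      set (a := Rmin S1 m - 1). set (b := Rmax S2 m + 1).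
      pose proof (Rmin_l S1 m). pose proof (Rmin_r S1 m). pose proof (Rmax_l S2 m). pose proof (Rmax_r S2 m).
      specialize (HS1 a ltac:(unfold a; lra)). specialize (HS2 b ltac:(unfold b; lra)).
      destruct (ivt_between f a m Rad Cf) as [t1 [Ht1 E1]]; [unfold a; lra|lra|].
      destruct (ivt_between f m b Rad Cf) as [t2 [Ht2 E2]]; [unfold b; lra|lra|].
      destruct (fadm t1) as [u1 [Hu1 Hd1]]. destruct (fadm t2) as [u2 [Hu2 Hd2]].
      rewrite E1 in Hu1. rewrite E2 in Hu2.
      exists u1, u2. split; [exact Hu1|]. split; [exact Hu2|].
      exists 0. split; [lra|]. rewrite Hd1, Hd2. apply Rlt_not_eq, exp_increasing. lra.
Qed.
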